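(* Suppose that $\mathcal P$ is a given set of primes for which $\#\{p\in\mathcal P:\ p\le y\}\gg\pi(y)$ for all $y\in(\sqrt z,z]$. There exist constants $c>0$ such that for any $u\ll\sqrt z$ there exist intervals $I_+$ and $I_-$ of length $\ge z^u$ for which $$\mathcal S(I_+,\mathcal P,z)\ \ge\ \Big\{1+\Big(\frac{c}{u\log u}\Big)^u\Big\}\,|I_+|\prod_{p\in\mathcal P,\ p\le z}\Big(1-\frac1p\Big)$$ and $$\mathcal S(I_-,\mathcal P,z)\ \le\ \Big\{1-\Big(\frac{c}{u\log u}\Big)^u\Big\}\,|I_-|\prod_{p\in\mathcal P,\ p\le z}\Big(1-\frac1p\Big).$$ Moreover, if $u\le(1-o(1))\log\log z/\log\log\log z$, then these intervals $I_\pm$ have length $\le z^{u+2}$.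
   Context: $\pi(y)$ is the number of primes $\le y$. For a set $\mathcal B$ of integers and a set $\mathcal P$ of primes, $\mathcal S(\mathcal B,\mathcal P,z)$ denotes the number of integers in $\mathcal B$ which do not have a prime factor $p\in\mathcal P$ with $p\le z$. An interval $I$ is identified with the set of integers it contains, and $|I|$ denotes its length. The notation $A\gg B$ (equivalently $B\ll A$) means $A\ge\kappa B$ for some fixed constant $\kappa>0$, and $o(1)$ denotes a quantity tending to $0$ as $z\to\infty$.
   Formalization: u is bounded away from 1: for every u_0 > 1 there is c > 0, depending on u_0 and the implied constants, that works for all u with u_0 ≤ u ≪ √z; for a fixed c the claim fails when u > 1 and u log u < c, since the bound for I_− is then negative. *)

(* Defs.v *)
From HB Require Import structures.
From mathcomp Require Import all_boot all_order all_algebra.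
From mathcomp Require Import finmap.
From mathcomp Require Import all_classical all_reals all_analysis.

Set Implicit Arguments.
Unset Strict Implicit.
Unset Printing Implicit Defensive.

Import Order.TTheory GRing.Theory Num.Theory.
Import numFieldNormedType.Exports.

Local Open Scope classical_set_scope.
Local Open Scope ring_scope.

Definition upto (R : realType) (P : set nat) (y : R) : set nat :=
  [set p | P p /\ p%:R <= y].

Definition count_upto (R : realType) (P : set nat) (y : R) : nat :=
  #|` fset_set (upto P y)|.

Definition primepi (R : realType) (y : R) : nat :=
  count_upto [set p | prime p] y.

(* [fset_set] is the empty set on infinite sets: [sieve B P z] is meaningful
   only for finite [B], such as the integer points of a bounded interval.
   The integer 0 is divisible by every prime. *)
Definition sieve (R : realType) (B : set int) (P : set nat) (z : R) : nat :=
  #|` fset_set [set n | B n /\ forall p, upto P z p -> ~ (p%:Z %| n)%Z]|.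

Definition sieve_density (R : realType) (P : set nat) (z : R) : R :=
  \prod_(p <- fset_set (upto P z)) (1 - p%:R^-1).

Definition int_points (R : realType) (I : interval R) : set int :=
  [set n | n%:~R \in I].

(* The value is 0 on unbounded intervals, so a positive lower bound on
   [ilength I] forces [I] to be bounded (and nonempty). *)
Definition ilength (R : realType) (I : interval R) : R :=
  fine (lebesgue_measure [set` I]).

(* Main.v *)
(** If an interval deviates for a finite subset [P1] of [P], then adding the other primes one
    at a time, and averaging over the translates by multiples of the product of the primes
    already treated, some translate deviates at least as much for [P].  So only [P1] has to be
    chosen, and the interval may start at [0]: with [N n] the number of [m <= n] free of primes
    of [P1] and [delta] their density, one needs [E n = N n - n * delta] to be large.

    Large [u].  Take [P1] in [(z^(1 - c / ln u), z]] and [s = 1 - (xi - i pi) / ln z],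
    [xi = ln u + ln ln u + O(1)].  Since [p^(-i pi / ln z)] is close to [-1], the product of the
    [1 - p^-s] is about [exp (sum p^(-Re s))], and Abel summation writes
    [sum E n (n^-s - (n+1)^-s)] as this product times [zeta s], up to a negligible error.
    Adding a real multiple of [n^(-Re s) - (n+1)^(-Re s)] makes the weights nonnegative, and
    Rankin's bound discards the [n] outside [[z^u, z^(u (1 + 3 lam))]], [lam = O(1 / ln u)];
    hence [E n] is large of either sign inside that window.

    Length at most [z^(u + 2)].  Up to [O(1 / ln z)], [E h / h] is minus the tail
    [L h = sum_(d > h) mu d / d], and with [R x = sum_(d > x) mu d / d * ln (d / x)] one has
    [ln x * L x + R x = - sum_p (ln p / p) L (x / p) + (small)].  Let [x] maximise [|L|] on
    [x >= z^(u + 1)].  The right-hand side is too small unless some [L (x / p)] has the opposite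
    sign and is larger still, so that [x / p < z^(u + 1)]: then [x] and [x / p] both lie in
    [[z^u, z^(u + 2)]].

    Bounded [u].  For [P1] in [(z^(1 - 1 / (K + 4)), z]] and [k <= K], a product of distinct
    primes of [P1] exceeds [z^k] exactly when it has more than [k] factors, so that [L (z^k)]
    has the sign of [(-1)^(k + 1)].

    Bounded [z].  An interval longer, or shorter, by [1/2] than its number of integers. *)

Require Import Defs.
From HB Require Import structures.
From mathcomp Require Import all_boot all_order all_algebra.
From mathcomp Require Import finmap.
From mathcomp Require Import all_classical all_reals all_analysis.
From mathcomp Require complex.
From mathcomp Require Import zify ring lra.

Set Implicit Arguments.
Unset Strict Implicit.
Unset Printing Implicit Defensive.

Import Order.TTheory GRing.Theory Num.Theory.
Import numFieldNormedType.Exports.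

Local Open Scope classical_set_scope.
Local Open Scope ring_scope.

(** The target (c / (u ln u))^u dictates [xi]. An [E n] of size n^(Re s) at n = z^u is a relative
    deviation e^(-xi u), so e^xi may only be of order u ln u. On the other hand the reciprocals of
    the primes of the block sum to about 1 / ln u, hence the p^(-Re s) to about e^xi / ln u, and
    this must be of order u for the bulk of the divisors to lie near z^u. With [lam] of order 1 / ln
    u, [xi * lam] is bounded and the width of the window costs only a factor e^O(u). The condition u
    << sqrt z keeps xi / ln z at most 11 / 20, where the pole of zeta still dominates the rest. The
    window alone gives lengths z^(u + O(u / ln u)), too long for the last claim. The propagation
    works with [L], which differs from [- E h / h] by O(1 / ln z); the deviation has to beat this
    error, that is u (ln u + ln ln u + O(1)) <= ln ln z, and this is the restriction on u. Bounded u
    is treated apart because the estimates for large u need ln u large in terms of kappa. *)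

(** * Inclusion-exclusion over squarefree divisors *)

Lemma prodr_1B (I : finType) (S : comNzRingType) (f : I -> S) :
  \prod_i (1 - f i) = \sum_(J : {set I}) (-1) ^+ #|J| * \prod_(i in J) f i.
Proof.
rewrite (eq_bigr (fun i => (- f i) + 1)); last by move=> i _; rewrite addrC.
rewrite bigA_distr; apply: eq_bigr => J _.
rewrite (bigID (mem J)) /= [X in _ * X]big1 ?mulr1; last first.
  by move=> i /negbTE ->.
rewrite (eq_bigr (fun i => - f i)) => [|i ->//].
by rewrite prodrN.
Qed.

Lemma prodr_1D (I : finType) (S : comNzRingType) (f : I -> S) :
  \prod_i (1 + f i) = \sum_(J : {set I}) \prod_(i in J) f i.
Proof.
rewrite (eq_bigr (fun i => f i + 1)); last by move=> i _; rewrite addrC.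
rewrite bigA_distr; apply: eq_bigr => J _.
rewrite (bigID (mem J)) /= [X in _ * X]big1 ?mulr1; last first.
  by move=> i /negbTE ->.
by apply: eq_bigr => i ->.
Qed.

(** Removing a chosen element matches the pairs (i, J) with [i] in [J] with those having [i] outside
    [J]. This is how one prime is split off a divisor in [mtail_identity], [card_dprod_le] and
    [esumS]. *)
Lemma exchange_setD1 (I : finType) (V : nmodType) (F : I -> {set I} -> V) :
  \sum_(J : {set I}) \sum_(i in J) F i (J :\ i) =
  \sum_(J : {set I}) \sum_(i | i \notin J) F i J.
Proof.
rewrite (exchange_big_dep predT) //= [RHS](exchange_big_dep predT) //=.
apply: eq_bigr => i _.
rewrite (reindex_onto (fun J => i |: J) (fun J => J :\ i)) /=; last first.
  by move=> J iJ; rewrite finset.setD1K.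
apply: eq_big => [J|J]; last by move=> /andP[_ /eqP ->].
rewrite finset.setU11 /=; apply/eqP/idP => [<-|iJ]; first by rewrite !inE eqxx.
by rewrite finset.setU1K.
Qed.

Section SquarefreeDivisors.
Variables (R : realType) (I : finType) (p : I -> nat).
Hypothesis p_prime : forall i, prime (p i).
Hypothesis p_inj : injective p.

Definition dprod (J : {set I}) : nat := \prod_(i in J) p i.

Definition unsieved (n : nat) : bool := [forall i, ~~ (p i %| n)%N].

Definition ncount (m : nat) : nat := \sum_(1 <= n < m.+1) unsieved n.

Definition density : R := \prod_i (1 - (p i)%:R^-1).

(** This is [E m] of the overview in terms of fractional parts: a summand equals -mu(d) {m / d}, the
    form that Rankin's bound uses; [ncountE] links it to the count. *)
Definition discrepancy (m : nat) : R :=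
  \sum_(J : {set I}) (-1) ^+ #|J| *
    ((m %/ dprod J)%:R - m%:R / (dprod J)%:R).

Lemma dprod_gt0 J : (0 < dprod J)%N.
Proof. by apply: prodn_gt0 => i; exact: prime_gt0. Qed.

Lemma dprodR_gt0 J : 0 < (dprod J)%:R :> R.
Proof. by rewrite ltr0n dprod_gt0. Qed.

Lemma dprodR J : (dprod J)%:R = \prod_(i in J) (p i)%:R :> R.
Proof. by rewrite /dprod natr_prod. Qed.

Lemma dprodV J : (dprod J)%:R^-1 = \prod_(i in J) (p i)%:R^-1 :> R.
Proof. by rewrite dprodR prodfV. Qed.

Lemma dprod_setU1 (i : I) (J : {set I}) : i \notin J -> dprod (i |: J) = (p i * dprod J)%N.
Proof. by move=> iJ; rewrite /dprod big_setU1. Qed.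

Lemma dprod_setD1 (i : I) (J : {set I}) : i \in J -> dprod J = (p i * dprod (J :\ i))%N.
Proof. by move=> iJ; rewrite /dprod (big_setD1 i). Qed.

Lemma dvdn_dprod (J : {set I}) n : (dprod J %| n)%N = [forall i in J, (p i %| n)%N].
Proof.
apply/idP/forall_inP => [dn i iJ|].
  by apply: dvdn_trans dn; rewrite (dprod_setD1 iJ) dvdn_mulr.
move: {2}#|J| (erefl #|J|) => k; elim: k J => [|k IH] J Jk H.
  by move/eqP: Jk; rewrite cards_eq0 => /eqP ->; rewrite /dprod big_set0 dvd1n.
have [i iJ] : exists i, i \in J by apply/card_gt0P; rewrite Jk.
rewrite (dprod_setD1 iJ) Gauss_dvd; last first.
  rewrite coprime_sym /dprod; apply: (big_ind (fun x => coprime x (p i))).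
  - exact: coprime1n.
  - by move=> x y cx cy; rewrite coprimeMl cx.
  - move=> j; rewrite !inE => /andP[ji _].
    rewrite prime_coprime// dvdn_prime2//; apply: contra ji => /eqP/p_inj ->//.
rewrite H //= IH //; last by move=> j; rewrite !inE => /andP[_]; exact: H.
by apply/eqP; rewrite -eqSS -Jk (cardsD1 i J) iJ.
Qed.

Lemma unsieved_sum n : (unsieved n)%:R =
  \sum_(J : {set I}) (-1) ^+ #|J| * (dprod J %| n)%:R :> R.
Proof.
transitivity (\prod_i (1 - (p i %| n)%:R) : R).
  rewrite /unsieved; case: (boolP [forall i, _]) => [/forallP H|].
    by rewrite big1 // => i _; rewrite (negbTE (H i)) subr0.
  move=> /forallPn[i]; rewrite negbK => H.
  by rewrite (bigD1 i)//= H subrr mul0r.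
rewrite prodr_1B; apply: eq_bigr => J _; congr (_ * _).
rewrite dvdn_dprod; case: (boolP [forall i in J, _]) => [/forall_inP H|].
  by rewrite big1 // => i /H ->.
move=> /forall_inPn[i iJ /negbTE H].
by rewrite (bigD1 i)//= H mul0r.
Qed.

Lemma sum_dvdn (d m : nat) : (0 < d)%N ->
  (\sum_(1 <= n < m.+1) (d %| n))%N = (m %/ d)%N.
Proof.
move=> d0; elim: m => [|m IH]; first by rewrite big_geq // div0n.
by rewrite big_nat_recr //= IH divnS // addnC.
Qed.

Lemma density_sum : density = \sum_(J : {set I}) (-1) ^+ #|J| / (dprod J)%:R.
Proof.
by rewrite /density prodr_1B; apply: eq_bigr => J _; rewrite dprodV.
Qed.

Lemma ncountE m : (ncount m)%:R = m%:R * density + discrepancy m.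
Proof.
rewrite /ncount /discrepancy density_sum mulr_sumr -big_split /= natr_sum.
under eq_bigr do rewrite unsieved_sum.
rewrite exchange_big /=; apply: eq_bigr => J _.
rewrite -mulr_sumr -natr_sum sum_dvdn ?dprod_gt0 //.
by rewrite mulrBr; ring.
Qed.

Lemma ncountS m : ncount m.+1 = (ncount m + unsieved m.+1)%N.
Proof. by rewrite /ncount big_nat_recr. Qed.

Lemma density_gt0 : 0 < density.
Proof.
apply: prodr_gt0 => i _; rewrite subr_gt0 invf_lt1 ?ltr1n ?ltr0n.
  exact: prime_gt1.
exact: prime_gt0.
Qed.

Lemma density_le1 : density <= 1.
Proof.
apply: prodr_ile1 => i _; apply/andP; split; last first.
  by rewrite gerBl invr_ge0.
by rewrite subr_ge0 invf_le1 ?ler1n ?ltr0n prime_gt0.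
Qed.

End SquarefreeDivisors.

(** * Powers with complex exponent and the trapezoid rule *)

Section ComplexPowers.
Import complex.
Local Open Scope complex_scope.
Variable R : realType.
Local Notation normc := (@Normc.normc R).

Lemma normc_0 : normc 0 = 0.
Proof. by rewrite /= expr0n /= addr0 sqrtr0. Qed.

Lemma normc_1 : normc 1 = 1.
Proof. by rewrite /= expr0n /= addr0 expr1n sqrtr1. Qed.

Lemma Re_le_normc (w : R[i]) : complex.Re w <= normc w.
Proof.
case: w => a d /=; apply: le_trans (ler_norm _) _.
by rewrite -sqrtr_sqr ler_sqrt ?lerDl ?sqr_ge0 // addr_ge0 ?sqr_ge0.
Qed.

Lemma normc_ge0 (w : R[i]) : 0 <= normc w.
Proof. by case: w => a d /=; rewrite sqrtr_ge0. Qed.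

Lemma normc_real (a : R) : normc a%:C = `|a|.
Proof. by rewrite /= expr0n /= addr0 sqrtr_sqr. Qed.

Lemma exists_conj_dir (w : R[i]) : exists c, normc c <= 1 /\ complex.Re (c * w) = normc w.
Proof.
have [->|w0] := eqVneq w 0; first by exists 0; rewrite mulr0 normc_0.
have nw : normc w != 0 by apply: contra w0 => /eqP /Normc.eq0_normc ->.
exists ((normc w)^-1%:C * w^*); split.
  rewrite Normc.normcM; have -> : normc w^* = normc w by case: {+}w => c d /=; rewrite sqrrN.
  by rewrite normc_real ger0_norm ?invr_ge0 ?normc_ge0 // mulVf.
suff -> : (normc w)^-1%:C * w^* * w = (normc w)%:C by [].
have -> : (normc w)^-1%:C * w^* * w = (normc w)^-1%:C * (normc w ^+ 2)%:C.
  rewrite -mulrA; congr (_ * _); case: {+}w => c d /=; simpc.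
  rewrite sqr_sqrtr ?addr_ge0 ?sqr_ge0 //; congr (_ +i* _); ring.
by rewrite -rmorphM expr2 mulKf.
Qed.

(** Testing every direction [c] of the unit disc turns complex estimates into real ones, to which
    monotonicity arguments by derivatives apply. *)
Lemma normc_Re_le (w : R[i]) (b : R) :
  (forall c, normc c <= 1 -> complex.Re (c * w) <= b) -> normc w <= b.
Proof. by move=> H; have [c [/H h <-]] := exists_conj_dir w. Qed.

Lemma normcB_ge (v w : R[i]) : normc v - normc w <= normc (v - w).
Proof.
rewrite lerBlDr; have {1}-> : v = (v - w) + w by rewrite subrK.
exact: le_normcD.
Qed.

Lemma normc_sum (J : Type) (r : seq J) (P : pred J) (F : J -> R[i]) :
  normc (\sum_(i <- r | P i) F i) <= \sum_(i <- r | P i) normc (F i).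
Proof.
elim/big_ind2: _ => //; first by rewrite normc_0.
by move=> x1 x2 y1 y2 h1 h2; apply: le_trans (le_normcD _ _) (lerD h1 h2).
Qed.

Lemma normc_prod (J : Type) (r : seq J) (P : pred J) (F : J -> R[i]) :
  normc (\prod_(i <- r | P i) F i) = \prod_(i <- r | P i) normc (F i).
Proof.
elim/big_ind2: _ => //; first by rewrite normc_1.
by move=> x1 x2 y1 y2 <- <-; rewrite Normc.normcM.
Qed.

Lemma is_derive_le (f df : R -> R) (a b : R) : a <= b ->
  (forall x, a <= x <= b -> is_derive x 1 f (df x)) ->
  (forall x, a <= x <= b -> 0 <= df x) -> f a <= f b.
Proof.
move=> ab fd df0; apply: (@ger0_derive1_ndecr _ f a b) => //.
- by move=> x; rewrite in_itv => /andP[ax xb]; have [] := fd x; rewrite ?(ltW ax) ?(ltW xb).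
- move=> x; rewrite in_itv => /andP[ax xb].
  have xab : a <= x <= b by rewrite (ltW ax) (ltW xb).
  by rewrite derive1E; have [_ ->] := fd x xab; exact: df0.
- by apply: derivable_within_continuous => x; rewrite in_itv => /fd[].
Qed.

Variables (s0 th : R).

(** The power x^(-s) for s = s0 + i th. *)
Definition cpower (x : R) : R[i] :=
  (expR (- s0 * ln x) * cos (th * ln x)) -i* (expR (- s0 * ln x) * sin (th * ln x)).

Lemma cpow1 : cpower 1 = 1.
Proof. by rewrite /cpower ln1 !mulr0 expR0 cos0 sin0 mulr0 mulr1 oppr0. Qed.

Lemma cpowM x y : 0 < x -> 0 < y -> cpower (x * y) = cpower x * cpower y.
Proof.
move=> x0 y0; rewrite /cpower lnM ?posrE // !mulrDr expRD cosD sinD; simpc.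
by congr (_ +i* _); ring.
Qed.

Lemma normc_cpow x : normc (cpower x) = expR (- s0 * ln x).
Proof.
rewrite /= sqrrN !exprMn -mulrDr cos2Dsin2 mulr1 sqrtr_sqr ger0_norm //.
Qed.

Lemma is_derive_osc (a c1 c2 x : R) : 0 < x ->
  is_derive x 1
    (fun y : R => expR (a * ln y) * (c1 * cos (th * ln y) + c2 * sin (th * ln y)))
    (expR (a * ln x) / x *
      ((a * c1 + th * c2) * cos (th * ln x) + (a * c2 - th * c1) * sin (th * ln x))).
Proof.
move=> x0; have dl : is_derive x 1 (@ln R) x^-1 by exact: is_derive1_ln.
apply: is_derive_eq.
rewrite /GRing.scale /=; field; exact: lt0r_neq0.
Qed.


Lemma is_derive_trapezoid (f e g : R -> R) (k m x df de : R) :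
  is_derive x 1 f df -> is_derive x 1 e de -> is_derive x 1 g (f x) ->
  is_derive x 1 (fun y => k * (e m - e y) * (y - m)
                          - ((f m + f y) / 2 * (y - m) - (g y - g m)))
    (k * (- de * (x - m) + (e m - e x))
     - (df / 2 * (x - m) + (f m + f x) / 2 - f x)).
Proof.
move=> fd ed gd; apply: is_derive_eq.
rewrite /GRing.scale /=; ring.
Qed.

Section Oscillation.
Hypotheses (s00 : 0 < s0) (th0 : 0 <= th).
Variables (c1 c2 : R).
Hypothesis c12 : c1 ^+ 2 + c2 ^+ 2 <= 1.
Local Notation ex x := (expR (- s0 * ln x)).
Local Notation osc x := (ex x * (c1 * cos (th * ln x) + c2 * sin (th * ln x))).
(** An upper bound for |s| / s0: the oscillating power x^(-s) varies at most [k0] times as fast as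
    its modulus. *)
Let k0 := 1 + th / s0.

Lemma dot_cos_sin_le (a b x : R) : a ^+ 2 + b ^+ 2 <= 1 ->
  `|a * cos x + b * sin x| <= 1.
Proof.
move=> ab; rewrite -[leRHS]sqrtr1 -sqrtr_sqr ler_sqrt //.
have := cos2Dsin2 x; have := sqr_ge0 (a * sin x - b * cos x); nra.
Qed.

Lemma osc_slope x : `|(- s0 * c1 + th * c2) * cos (th * ln x) +
   (- s0 * c2 - th * c1) * sin (th * ln x)| <= k0 * s0.
Proof.
have -> : k0 * s0 = s0 + th by rewrite /k0; field; exact: lt0r_neq0.
have -> : (- s0 * c1 + th * c2) * cos (th * ln x) +
   (- s0 * c2 - th * c1) * sin (th * ln x) =
   - s0 * (c1 * cos (th * ln x) + c2 * sin (th * ln x)) +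
   th * (c2 * cos (th * ln x) + (- c1) * sin (th * ln x)) by ring.
apply: le_trans (ler_normD _ _) _; rewrite !normrM normrN (gtr0_norm s00) (ger0_norm th0).
have h1 := dot_cos_sin_le (th * ln x) c12.
have h2 : `|c2 * cos (th * ln x) + (- c1) * sin (th * ln x)| <= 1.
  by apply: dot_cos_sin_le; rewrite sqrrN addrC.
by apply: lerD; [rewrite -[leRHS]mulr1|rewrite -[leRHS]mulr1]; apply: ler_wpM2l => //; exact: ltW.
Qed.

Lemma osc_diff_le (m y : R) : 0 < m -> m <= y -> osc m - osc y <= k0 * (ex m - ex y).
Proof.
move=> m0 my.
have H (x : R) (x0 : 0 < x) := is_derive_osc (- s0) c1 c2 x0.
have He (x : R) (x0 : 0 < x) : is_derive x 1 (fun y => ex y) (- s0 * ex x / x).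
  have dl : is_derive x 1 (@ln R) x^-1 by exact: is_derive1_ln.
  apply: is_derive_eq; rewrite /GRing.scale /=; field; exact: lt0r_neq0.
have : osc m - k0 * ex m <= osc y - k0 * ex y.
  apply: (@is_derive_le (fun x => osc x - k0 * ex x) (fun x => ex x / x * ((- s0 * c1 + th * c2) * cos (th * ln x) + (- s0 * c2 - th * c1) * sin (th * ln x)) - k0 * (- s0 * ex x / x)) m y) => //.
    move=> x /andP[mx _]; have x0 := lt_le_trans m0 mx.
    have := H x x0; have := He x x0 => h1 h2.
    by apply: is_derive_eq.
  move=> x /andP[mx _]; have x0 := lt_le_trans m0 mx.
  have := osc_slope x; rewrite ler_norml => /andP[h _].
  have -> : forall A, ex x / x * A - k0 * (- s0 * ex x / x) = ex x / x * (A + k0 * s0) by move=> A; ring.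
  by rewrite mulr_ge0 ?divr_ge0 ?expR_ge0 ?(ltW x0) //; lra.
lra.
Qed.

Variables (g1 g2 : R).
(** Real form of g (1 - s) = c; with it [prim] is Re (g x^(1 - s)), a primitive of [osc]. *)
Hypothesis g1E : (1 - s0) * g1 + th * g2 = c1.
Hypothesis g2E : (1 - s0) * g2 - th * g1 = c2.
Local Notation prim x :=
  (x * ex x * (g1 * cos (th * ln x) + g2 * sin (th * ln x))).

(** Both sides vanish at y = m, and their difference is monotone: its derivative combines the slack
    of [osc_diff_le] and the slack of [osc_slope] with nonnegative coefficients. *)
Lemma trapezoid_le (m y : R) : 0 < m -> m <= y ->
  (osc m + osc y) / 2 * (y - m) - (prim y - prim m) <=
  k0 / 2 * (ex m - ex y) * (y - m).
Proof.
move=> m0 my.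
have H (x : R) (x0 : 0 < x) := is_derive_osc (- s0) c1 c2 x0.
have He (x : R) (x0 : 0 < x) : is_derive x 1 (fun y => ex y) (- s0 * ex x / x).
  have dl : is_derive x 1 (@ln R) x^-1 by exact: is_derive1_ln.
  apply: is_derive_eq; rewrite /GRing.scale /=; field; exact: lt0r_neq0.
have Hg (x : R) (x0 : 0 < x) : is_derive x 1 (fun x => prim x) (osc x).
  have dl : is_derive x 1 (@ln R) x^-1 by exact: is_derive1_ln.
  apply: is_derive_eq; rewrite /GRing.scale /= -g1E -g2E; field; exact: lt0r_neq0.
pose K x := k0 / 2 * (ex m - ex x) * (x - m) - ((osc m + osc x) / 2 * (x - m) - (prim x - prim m)).
pose dosc x := ex x / x * ((- s0 * c1 + th * c2) * cos (th * ln x) + (- s0 * c2 - th * c1) * sin (th * ln x)).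
pose dK x := k0 / 2 * (- (- s0 * ex x / x) * (x - m) + (ex m - ex x)) -
   (dosc x / 2 * (x - m) + (osc m + osc x) / 2 - osc x).
suff : K m <= K y by rewrite /K !subrr !mulr0 subrr; lra.
apply: (@is_derive_le K dK m y my) => x /andP[mx _].
  have x0 := lt_le_trans m0 mx.
  exact: (is_derive_trapezoid (k0 / 2) m (H x x0) (He x x0) (Hg x x0)).
have x0 := lt_le_trans m0 mx.
have h1 := osc_diff_le m0 mx.
have := osc_slope x; rewrite ler_norml => /andP[_ h].
have -> : dK x = (k0 * (ex m - ex x) - (osc m - osc x)) / 2 +
   (x - m) / 2 * (ex x / x) * (k0 * s0 - ((- s0 * c1 + th * c2) * cos (th * ln x) + (- s0 * c2 - th * c1) * sin (th * ln x))).
  rewrite /dK /dosc; field; exact: lt0r_neq0.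
apply: addr_ge0; first lra.
apply: mulr_ge0; last by rewrite subr_ge0.
apply: mulr_ge0; first by rewrite divr_ge0 // subr_ge0.
by rewrite divr_ge0 ?expR_ge0 ?(ltW x0).
Qed.

End Oscillation.
End ComplexPowers.

(** * Partial sums of zeta inside the critical strip *)

Section ZetaPartialSums.
Import complex.
Local Open Scope complex_scope.
Variables (R : realType) (s0 th : R).
Hypotheses (s00 : 0 < s0) (s01 : s0 < 1) (th0 : 0 <= th).
Local Notation normc := (@Normc.normc R).
Local Notation ex x := (expR (- s0 * ln x)).
Local Notation cpow := (cpower s0 th).
Let k0 := 1 + th / s0.
Let gam : R[i] := ((1 - s0) -i* th)^-1.

Lemma onems_neq0 : ((1 - s0) -i* th) != 0 :> R[i].
Proof. by rewrite eq_complex /= negb_and subr_eq0 gt_eqF. Qed.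

Lemma normc_le1_sqr (c : R[i]) : normc c <= 1 -> complex.Re c ^+ 2 + complex.Im c ^+ 2 <= 1.
Proof.
case: c => a b /= h; rewrite -[leLHS]sqr_sqrtr ?addr_ge0 ?sqr_ge0 //.
by rewrite expr_le1 // sqrtr_ge0.
Qed.

Lemma Re_mul_cpow (c : R[i]) (x : R) : complex.Re (c * cpow x) =
  ex x * (complex.Re c * cos (th * ln x) + complex.Im c * sin (th * ln x)).
Proof. by case: c => a b; rewrite /cpower; simpc => /=; ring. Qed.

Lemma Re_realM (a : R) (c : R[i]) : complex.Re (a%:C * c) = a * complex.Re c.
Proof. by case: c => b d; simpc. Qed.

Lemma cpow_diff_le (m y : R) : 0 < m -> m <= y ->
  normc (cpow m - cpow y) <= k0 * (ex m - ex y).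
Proof.
move=> m0 my; apply: normc_Re_le => c /normc_le1_sqr c1.
rewrite mulrBr raddfB /= !Re_mul_cpow; exact: osc_diff_le.
Qed.

Lemma cpow_trapezoid_le (m y : R) : 0 < m -> m <= y ->
  normc (((y - m) / 2)%:C * (cpow m + cpow y)
         - (y%:C * cpow y - m%:C * cpow m) * gam) <=
  k0 / 2 * (ex m - ex y) * (y - m).
Proof.
move=> m0 my; apply: normc_Re_le => c /normc_le1_sqr c1.
pose g := c * gam.
have gE : g * ((1 - s0) -i* th) = c by rewrite /g /gam mulfVK // onems_neq0.
have -> : c * (((y - m) / 2)%:C * (cpow m + cpow y)
         - (y%:C * cpow y - m%:C * cpow m) * gam) =
   ((y - m) / 2)%:C * (c * cpow m + c * cpow y) - (y%:C * (g * cpow y) - m%:C * (g * cpow m)).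
  rewrite /g; ring.
have -> : forall A B : R[i], complex.Re (A - B) = complex.Re A - complex.Re B by move=> [? ?] [? ?].
have -> : forall A B : R[i], complex.Re (A - B) = complex.Re A - complex.Re B by move=> [? ?] [? ?].
rewrite !Re_realM.
have -> : forall A B : R[i], complex.Re (A + B) = complex.Re A + complex.Re B by move=> [? ?] [? ?].
rewrite !Re_mul_cpow.
have g1E : (1 - s0) * complex.Re g + th * complex.Im g = complex.Re c.
  by rewrite -gE; case: (g) => a b; simpc => /=; ring.
have g2E : (1 - s0) * complex.Im g - th * complex.Re g = complex.Im c.
  by rewrite -gE; case: (g) => a b; simpc => /=; ring.
apply: le_trans (trapezoid_le s00 th0 c1 g1E g2E m0 my).
by rewrite le_eqVlt; apply/orP; left; apply/eqP; ring.
Qed.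

(* The partial sums of the zeta series at [s0 + i th], minus their main term [N^(1-s) / (1-s)]. *)
Definition zeta_sum (N : nat) : R[i] :=
  \sum_(1 <= m < N.+1) cpow m%:R - N%:R * cpow N%:R * gam.

(** Each unit step contributes one trapezoid error, at most [k0 / 2] times a decrement of n^(-s0);
    these decrements telescope. *)
Lemma zetaB (M N : nat) : (0 < M)%N -> (M <= N)%N ->
  normc (zeta_sum N - zeta_sum M - (cpow N%:R - cpow M%:R) / 2) <=
  k0 / 2 * (ex M%:R - ex N%:R).
Proof.
move=> M0; elim: N => [|N IH]; first by rewrite leqn0 => /eqP M0'; rewrite M0' in M0.
rewrite leq_eqVlt => /predU1P[->|MN].
  by rewrite !subrr mul0r subr0 normc_0 mulr0.
have N0 : (0 < N)%N := leq_trans M0 MN.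
have h1 := IH MN.
have h2 := @cpow_trapezoid_le N%:R N.+1%:R.
rewrite ltr0n ler_nat N0 leqnSn in h2; move: h2 => /(_ isT isT).
have -> : N.+1%:R - N%:R = 1 :> R by rewrite -natr1; ring.
rewrite mulr1 => h2.
have -> : zeta_sum N.+1 - zeta_sum M - (cpow N.+1%:R - cpow M%:R) / 2 =
   (zeta_sum N - zeta_sum M - (cpow N%:R - cpow M%:R) / 2) +
   ((1 / 2)%:C * (cpow N%:R + cpow N.+1%:R)
         - (N.+1%:R%:C * cpow N.+1%:R - N%:R%:C * cpow N%:R) * gam).
  rewrite {1}/zeta_sum big_nat_recr //= -/(\sum_(1 <= m < N.+1) _) /zeta_sum.
  have -> : (1 / 2)%:C = 1 / 2 :> R[i] by rewrite fmorph_div rmorph1 rmorph_nat.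
  by rewrite !rmorph_nat; field.
apply: le_trans (le_normcD _ _) _.
have -> : k0 / 2 * (ex M%:R - ex N.+1%:R) = k0 / 2 * (ex M%:R - ex N%:R) + k0 / 2 * (ex N%:R - ex N.+1%:R) by ring.
exact: lerD.
Qed.

Let k01 : 1 <= k0.
Proof. by rewrite lerDl divr_ge0 // ltW. Qed.

Lemma normc_half (w : R[i]) : normc (w / 2) = normc w / 2.
Proof.
rewrite Normc.normcM; congr (_ * _).
have -> : 2^-1 = (2^-1)%:C :> R[i] by rewrite fmorphV rmorph_nat.
by rewrite normc_real ger0_norm.
Qed.

Lemma zeta_cauchy (M N : nat) : (0 < M)%N -> (M <= N)%N ->
  normc (zeta_sum N - zeta_sum M) <= k0 * ex M%:R.
Proof.
move=> M0 MN; have h := zetaB M0 MN.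
have -> : zeta_sum N - zeta_sum M = (zeta_sum N - zeta_sum M - (cpow N%:R - cpow M%:R) / 2) + (cpow N%:R / 2 - cpow M%:R / 2) by field.
apply: le_trans (le_normcD _ _) _.
have h2 : normc (cpow N%:R / 2 - cpow M%:R / 2) <= ex N%:R / 2 + ex M%:R / 2.
  apply: le_trans (le_normcD _ _) _.
  by rewrite normcN !normc_half !normc_cpow.
have eN := expR_ge0 (- s0 * ln (N%:R : R)); have eM := expR_ge0 (- s0 * ln (M%:R : R)).
have k1 : 0 <= k0 - 1 by rewrite subr_ge0 k01.
have := mulr_ge0 k1 eN; have := mulr_ge0 k1 eM; lra.
Qed.

(** Started at M = 1, [zetaB] leaves 1 / 2 + 1 / (s - 1) up to an error bounded uniformly in [N], so
    that the pole dominates near s = 1. *)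
Lemma zeta_near (N : nat) : (0 < N)%N -> normc (zeta_sum N - (1 / 2 - gam)) <= k0 / 2.
Proof.
move=> N0; have h := zetaB (ltn0Sn 0) N0.
have z1 : zeta_sum 1 = 1 - gam.
  by rewrite /zeta_sum big_nat1 cpow1 !mul1r.
have -> : zeta_sum N - (1 / 2 - gam) = (zeta_sum N - zeta_sum 1 - (cpow N%:R - cpow 1%:R) / 2) + cpow N%:R / 2.
  by rewrite z1 cpow1; field.
apply: le_trans (le_normcD _ _) _.
rewrite normc_half normc_cpow.
rewrite ln1 mulr0 expR0 in h.
have eN := expR_ge0 (- s0 * ln (N%:R : R)).
have k1 : 0 <= k0 - 1 by rewrite subr_ge0 k01.
have := mulr_ge0 k1 eN; lra.
Qed.

End ZetaPartialSums.

(** * Abel summation against the Euler product *)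

Lemma abel_sum (S : comNzRingType) (a c : nat -> S) (N : nat) : a 0%N = 0 ->
  \sum_(1 <= n < N.+1) (a n - a n.-1) * c n =
  \sum_(1 <= n < N) a n * (c n - c n.+1) + a N * c N.
Proof.
move=> a0; elim: N => [|N IH]; first by rewrite !big_geq // a0 mul0r addr0.
rewrite big_nat_recr //= IH; case: N {IH} => [|N].
  by rewrite !big_geq // a0 mul0r subr0 !add0r.
rewrite [in RHS]big_nat_recr //= mulrBl mulrBr; ring.
Qed.

Section EulerProductIdentity.
Import complex.
Local Open Scope complex_scope.
Variables (R : realType) (I : finType) (p : I -> nat).
Hypothesis p_prime : forall i, prime (p i).
Hypothesis p_inj : injective p.
Variables (s0 th : R).
Hypotheses (s00 : 0 < s0) (s01 : s0 < 1) (th0 : 0 <= th).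
Local Notation normc := (@Normc.normc R).
Local Notation ex x := (expR (- s0 * ln x)).
Local Notation cpow := (cpower s0 th).
Local Notation zeta := (zeta_sum s0 th).
Local Notation d := (dprod p).
Local Notation E := (discrepancy R p).
Local Notation delta := (density R p).
Let Q := d [set: I].
Let k0 := 1 + th / s0.

Definition eulerF : R[i] := \prod_i (1 - cpow (p i)%:R).

Lemma dvdn_Q J : (d J %| Q)%N.
Proof. by rewrite dvdn_dprod //; apply/forall_inP => i _; rewrite /Q (@dprod_setD1 _ p i) ?inE // dvdn_mulr. Qed.

Lemma Q_gt0 : (0 < Q)%N. Proof. exact: dprod_gt0. Qed.

Lemma discrepancy_mulQ M : E (Q * M) = 0.
Proof.
rewrite /discrepancy big1 // => J _; have /dvdnP[k kE] := dvdn_Q J.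
have -> : (Q * M = k * M * d J)%N by rewrite kE mulnAC.
by rewrite mulnK ?dprod_gt0 // (natrM _ (k * M)) mulfK ?subrr ?mulr0 // pnatr_eq0 -lt0n dprod_gt0.
Qed.

Lemma discrepancy0 : E 0 = 0.
Proof. by have := discrepancy_mulQ 0; rewrite muln0. Qed.

Lemma discrepancyS n : E n.+1 - E n = (unsieved p n.+1)%:R - delta.
Proof.
have := @ncountE R _ _ p_prime p_inj n.+1; have := @ncountE R _ _ p_prime p_inj n.
by rewrite ncountS natrD -natr1 => -> h; lra.
Qed.

Lemma cpow_dprod J : cpow (d J)%:R = \prod_(i in J) cpow (p i)%:R.
Proof.
suff: cpow (d J)%:R = \prod_(i in J) cpow (p i)%:R /\ (0 < d J)%N by case.
rewrite /dprod; elim/big_rec2: _ => [|i c n _ [cE n0]]; first by rewrite cpow1.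
have pi0 := prime_gt0 (p_prime i); split; last by rewrite muln_gt0 pi0.
by rewrite natrM cpowM ?ltr0n // cE.
Qed.

Lemma eulerF_sum : eulerF = \sum_(J : {set I}) (-1) ^+ #|J| * cpow (d J)%:R.
Proof. by rewrite /eulerF prodr_1B; apply: eq_bigr => J _; rewrite cpow_dprod. Qed.

Lemma sum_dvd_cpow (D k : nat) : (0 < D)%N ->
  \sum_(1 <= n < (D * k).+1) (D %| n)%:R * cpow n%:R =
  cpow D%:R * \sum_(1 <= m < k.+1) cpow m%:R.
Proof.
move=> D0; elim: k => [|k IH]; first by rewrite muln0 !big_geq // mulr0.
rewrite mulnS addnC (@big_cat_nat _ _ _ (D * k).+1) //= ?ltnS ?leq_addr // IH.
rewrite [in RHS]big_nat_recr //= mulrDr; congr (_ + _).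
rewrite (@big_nat_recr _ _ _ (D * k + D)%N) /=; last by rewrite -addn1 leq_add2l.
rewrite big_nat_cond big1 ?add0r; last first.
  move=> n /andP[/andP[h1 h2] _]; rewrite (_ : (D %| n)%N = false) ?mul0r //.
  by apply/negP => /dvdnP[q qE]; move: h1 h2; rewrite qE; case: (leqP q k) => ?; nia.
have -> : (D * k + D = D * k.+1)%N by rewrite mulnS addnC.
by rewrite dvdn_mulr // mul1r natrM cpowM ?ltr0n.
Qed.

(** Every divisor d divides [N]: [E N = 0] kills the boundary term of the Abel summation, and delta
    N^(1-s) = sum mu(d) d^(-s) (N / d)^(1-s) makes the main terms of the partial sums cancel. *)
Lemma osc_identity M : (0 < M)%N ->
  let N := (Q * M)%N in
  \sum_(1 <= n < N) (E n)%:C * (cpow n%:R - cpow n.+1%:R) =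
  \sum_(J : {set I}) (-1) ^+ #|J| * (cpow (d J)%:R * zeta (N %/ d J)) - delta%:C * zeta N.
Proof.
move=> M0 N; pose gam : R[i] := ((1 - s0) -i* th)^-1.
have := @abel_sum _ (fun n => (E n)%:C) (fun n => cpow n%:R) N.
rewrite discrepancy0 rmorph0 => /(_ erefl).
rewrite {3}/N discrepancy_mulQ rmorph0 mul0r addr0 => <-.
transitivity (\sum_(1 <= n < N.+1) ((unsieved p n)%:R * cpow n%:R) - delta%:C * \sum_(1 <= n < N.+1) cpow n%:R).
  rewrite mulr_sumr -sumrB; apply: eq_big_nat => -[|n] // _ /=.
  by rewrite -mulrBl -rmorphB discrepancyS rmorphB rmorph_nat.
have unE n : (unsieved p n)%:R = \sum_(J : {set I}) (-1) ^+ #|J| * (d J %| n)%:R :> R[i].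
  rewrite -(rmorph_nat (@real_complex R)) unsieved_sum // rmorph_sum /=.
  by apply: eq_bigr => J _; rewrite rmorphM rmorphXn rmorphN1 rmorph_nat.
have -> : \sum_(1 <= n < N.+1) ((unsieved p n)%:R * cpow n%:R) =
   \sum_(J : {set I}) (-1) ^+ #|J| * (cpow (d J)%:R * \sum_(1 <= m < (N %/ d J).+1) cpow m%:R).
  under eq_bigr do rewrite unE mulr_suml.
  rewrite exchange_big /=; apply: eq_bigr => J _.
  under eq_bigr do rewrite -mulrA.
  rewrite -mulr_sumr -sum_dvd_cpow ?dprod_gt0 //; congr (_ * \sum_(1 <= n < _.+1) _).
  by rewrite mulnC divnK // dvdn_mulr // dvdn_Q.
have dE : delta%:C * (N%:R * cpow N%:R * gam) = \sum_(J : {set I}) (-1) ^+ #|J| * (cpow (d J)%:R * ((N %/ d J)%:R * cpow (N %/ d J)%:R * gam)).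
  rewrite density_sum // rmorph_sum mulr_suml; apply: eq_bigr => J _.
  have dN : (d J %| N)%N by rewrite dvdn_mulr // dvdn_Q.
  have dJ0 := dprod_gt0 p_prime J.
  have NE : N = (N %/ d J * d J)%N by rewrite divnK.
  have k0' : (0 < N %/ d J)%N by rewrite divn_gt0 // dvdn_leq // muln_gt0 Q_gt0.
  rewrite {1 2}NE !natrM cpowM ?ltr0n // rmorphM rmorphXn rmorphN1 fmorphV rmorph_nat.
  have d0 : (d J)%:R != 0 :> R[i] by rewrite pnatr_eq0 -lt0n.
  by field.
rewrite /zeta_sum -/gam (mulrBr delta%:C) dE.
have -> : \sum_(J : {set I}) (-1) ^+ #|J| * (cpow (d J)%:R *
      (\sum_(1 <= m < (N %/ d J).+1) cpow m%:R - (N %/ d J)%:R * cpow (N %/ d J)%:R * gam)) =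
    \sum_(J : {set I}) (-1) ^+ #|J| * (cpow (d J)%:R * \sum_(1 <= m < (N %/ d J).+1) cpow m%:R) -
    \sum_(J : {set I}) (-1) ^+ #|J| * (cpow (d J)%:R * ((N %/ d J)%:R * cpow (N %/ d J)%:R * gam)).
  by rewrite -sumrB; apply: eq_bigr => J _; ring.
ring.
Qed.

(** All the N / d are at least [M], and beyond [M] the partial sums of zeta vary by at most k0
    M^(-s0); summed over the 2^#|I| divisors this still vanishes as [M] grows. *)
Lemma osc_sum_near M N : (0 < M)%N -> N = (Q * M)%N ->
  normc (\sum_(1 <= n < N) (E n)%:C * (cpow n%:R - cpow n.+1%:R)
         - (eulerF - delta%:C) * zeta N) <= 2 ^+ #|I| * k0 * ex M%:R.
Proof.
move=> M0 NE; rewrite {1}NE osc_identity // -NE eulerF_sum mulrBl mulr_suml.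
have subBB (a b c : R[i]) : a - b - (c - b) = a - c by ring.
rewrite subBB -sumrB; apply: le_trans (normc_sum _ _ _) _.
have -> : 2 ^+ #|I| * k0 * ex M%:R = \sum_(J : {set I}) k0 * ex M%:R.
  rewrite sumr_const -[#|_|]cardsT -powersetT card_powerset cardsT.
  by rewrite -[RHS]mulr_natl natrX mulrA.
apply: ler_sum => J _.
have -> : (-1) ^+ #|J| * (cpow (d J)%:R * zeta (N %/ d J)) - (-1) ^+ #|J| * cpow (d J)%:R * zeta N =
  (-1) ^+ #|J| * (cpow (d J)%:R * - (zeta N - zeta (N %/ d J))) by ring.
rewrite !Normc.normcM normcN normc_cpow.
have -> : normc ((-1) ^+ #|J|) = 1.
  by rewrite -signr_odd; case: odd; rewrite ?normcN ?normc_1.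
have dJ0 := dprod_gt0 p_prime J.
have MN : (M <= N %/ d J)%N.
  by rewrite NE leq_divRL // mulnC leq_mul2r; apply/orP; right; apply: dvdn_leq (Q_gt0) (dvdn_Q J).
have k00 : 0 <= k0 by rewrite addr_ge0 // divr_ge0 // ltW.
have h : normc (zeta N - zeta (N %/ d J)) <= k0 * ex M%:R.
  apply: le_trans (zeta_cauchy s00 s01 th0 (leq_trans M0 MN) (leq_div _ _)) _.
  rewrite ler_wpM2l // ler_expR !mulNr lerN2 ler_wpM2l ?(ltW s00) //.
  by rewrite ler_ln ?posrE ?ltr0n ?ler_nat // (leq_trans M0).
rewrite mul1r; apply: le_trans h; rewrite -[leRHS]mul1r ler_wpM2r ?normc_ge0 //.
by rewrite -[leRHS]expR0 ler_expR mulNr oppr_le0 mulr_ge0 ?(ltW s00) ?ln_ge0 ?ler1n //.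
Qed.

End EulerProductIdentity.

(** * Elementary inequalities and sums of powers *)

Lemma expR_Nln_small (R : realType) (s0 B : R) : 0 < s0 -> 0 < B ->
  exists M : nat, (0 < M)%N /\ B * expR (- s0 * ln M%:R) <= 1.
Proof.
move=> s00 B0; pose x := expR (ln B / s0); exists (Num.truncn x).+1; split => //.
have xM : x <= (Num.truncn x).+1%:R by rewrite ltW // truncnS_gt.
rewrite -[X in X * _](lnK (x := B)) ?posrE // -expRD -[leRHS]expR0 ler_expR.
have : ln B / s0 <= ln ((Num.truncn x).+1%:R : R).
  by rewrite -[leLHS]expRK ler_ln ?posrE ?expR_gt0 ?ltr0n.
rewrite ler_pdivrMr // => h; lra.
Qed.

Section RealEstimates.
Variable R : realType.
Implicit Types (x y b t : R) (n N : nat).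

Lemma sin_le x : 0 <= x -> sin x <= x.
Proof.
move=> x0; rewrite -subr_ge0 -[leLHS](_ : 0 - sin 0 = 0 :> R); last by rewrite sin0 subr0.
apply: (@is_derive_le R (fun y => y - sin y) (fun y => 1 - cos y) 0 x x0) => y _.
by rewrite subr_ge0 cos_le1.
Qed.

Lemma cos_ge_quadratic x : 1 - x ^+ 2 / 2 <= cos x.
Proof.
rewrite -cos_norm -real_normK ?num_real //; set y := `|x|.
have y0 : 0 <= y by exact: normr_ge0.
have -> : cos y = 1 - 2 * sin (y / 2) ^+ 2.
  rewrite {1}(_ : y = (y / 2) *+ 2); last by rewrite mulr2n; field.
  by rewrite cos_mulr2n cos2sin2 mulr2n; ring.
have h1 : sin (y / 2) <= y / 2 by apply: sin_le; rewrite divr_ge0.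
have h2 : - (y / 2) <= sin (y / 2).
  have [y2|y2] := leP (y / 2) pi.
    by apply: le_trans (sin_ge0_pi _); rewrite ?oppr_le0 divr_ge0.
  apply: le_trans (sin_geN1 _); have := pi_ge2 R; lra.
nra.
Qed.

Lemma expR_le_quadratic x : 0 <= x -> x <= 1 -> expR x <= 1 + x + x ^+ 2.
Proof.
move=> x0 x1; pose f y := (1 + y + y ^+ 2) * expR (- y).
have : f 0 <= f x.
  apply: (@is_derive_le R f (fun y => (y - y ^+ 2) * expR (- y))) => // y /andP[y0 yx].
    by rewrite /f; apply: is_derive_eq; rewrite /GRing.scale /=; ring.
  rewrite mulr_ge0 ?expR_ge0 // subr_ge0 expr2 -[leRHS]mulr1 ler_wpM2l //.
  exact: le_trans yx _.
rewrite /f oppr0 expR0 mulr1 expr0n /= !addr0 expRN => h.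
by rewrite -[leLHS]mul1r -ler_pdivlMr ?expR_gt0.
Qed.

Lemma expRN_le_quadratic x : 0 <= x -> expR (- x) <= 1 - x + x ^+ 2 / 2.
Proof.
move=> x0; pose f y := 1 - y + y ^+ 2 / 2 - expR (- y).
suff : f 0 <= f x.
  by rewrite /f oppr0 expR0 expr0n /= mul0r !addr0 subrr subr_ge0.
apply: (@is_derive_le R f (fun y => - 1 + y + expR (- y))) => // y /andP[y0 yx].
  by rewrite /f; apply: is_derive_eq; rewrite /GRing.scale /=; field.
have := expR_ge1Dx (- y); lra.
Qed.

Lemma expR_1D_ge y : 0 <= y -> expR (y * (1 - y)) <= 1 + y.
Proof.
move=> y0; have y1 : 0 < 1 + y by lra.
have : 1 - y / (1 + y) <= expR (- (y / (1 + y))) by have := expR_ge1Dx (- (y / (1 + y))).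
have -> : 1 - y / (1 + y) = (1 + y)^-1 by field; exact: lt0r_neq0.
rewrite expRN lef_pV2 ?posrE ?expR_gt0 // => h; apply: le_trans h.
rewrite ler_expR ler_pdivlMr //; nra.
Qed.

Lemma prodr_1D_le_expR (I : finType) (f : I -> R) : (forall i, 0 <= f i) ->
  \prod_i (1 + f i) <= expR (\sum_i f i).
Proof.
move=> f0; rewrite expR_sum; apply: ler_prod => i _.
by rewrite addr_ge0 //= expR_ge1Dx.
Qed.

Lemma ln_succ_ge n : (0 < n)%N -> ln (n%:R : R) + n.+1%:R^-1 <= ln n.+1%:R.
Proof.
move=> n0; have n1 : 0 < n.+1%:R :> R by rewrite ltr0n.
have n0R : 0 < n%:R :> R by rewrite ltr0n.
have : ln (n%:R / n.+1%:R : R) <= - n.+1%:R^-1.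
  have -> : n%:R / n.+1%:R = 1 + - n.+1%:R^-1 :> R.
    rewrite -natr1; field; rewrite natr1; exact: lt0r_neq0.
  by apply: le_ln1Dx; rewrite ltrN2 invf_lt1 // ltr1n ltnS.
by rewrite ln_div ?posrE //; move: (ln _) (ln _) (_^-1) => ? ? ?; lra.
Qed.

Lemma ln_succ_le n : (0 < n)%N -> ln (n.+1%:R : R) <= ln n%:R + n%:R^-1.
Proof.
move=> n0; have n1 : 0 < n.+1%:R :> R by rewrite ltr0n.
have n0R : 0 < n%:R :> R by rewrite ltr0n.
have : ln (n.+1%:R / n%:R : R) <= n%:R^-1.
  have -> : n.+1%:R / n%:R = 1 + n%:R^-1 :> R.
    by rewrite -natr1; field; exact: lt0r_neq0.
  by apply: le_ln1Dx; rewrite (lt_le_trans (y := 0)) ?ltrN10 // invr_ge0 ltW.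
by rewrite ln_div ?posrE //; move: (ln _) (ln _) (_^-1) => ? ? ?; lra.
Qed.

Lemma subr1_expRN_ge t : 0 <= t <= 1 -> t / 2 <= 1 - expR (- t).
Proof.
by move=> /andP[t0 t1]; have := expRN_le_quadratic t0; nra.
Qed.

(** Induction replaces the comparison with an integral; the factor 2 comes from 1 - e^(-t) >= t / 2.
    In [sum_powNB1_le] a further 2 comes from N + 1 <= 2 N. *)
Lemma sum_powB1_le b N : 0 < b <= 1 -> (0 < N)%N ->
  \sum_(1 <= n < N.+1) expR ((b - 1) * ln n%:R) <= 2 / b * expR (b * ln N%:R).
Proof.
move=> /andP[b0 b1]; elim: N => // N IH _; rewrite big_nat_recr //=.
case: N IH => [_|N /(_ isT) IH].
  by rewrite big_geq // add0r ln1 !mulr0 expR0 mulr1 ler_pdivlMr // mul1r; lra.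
apply: le_trans (lerD IH (lexx _)) _; set m := N.+1.
have m0 : 0 < m.+1%:R :> R by rewrite ltr0n.
have h1 := @ln_succ_ge m isT.
have -> : expR ((b - 1) * ln m.+1%:R) = expR (b * ln m.+1%:R) / m.+1%:R.
  by rewrite mulrBl mul1r expRB lnK ?posrE.
have h2 : expR (b * ln m%:R) <= expR (b * ln m.+1%:R) * expR (- (b / m.+1%:R)).
  by rewrite -expRD ler_expR -mulrN -mulrDr ler_wpM2l ?(ltW b0) // lerBrDr.
have h3 : b / m.+1%:R / 2 <= 1 - expR (- (b / m.+1%:R)).
  apply: subr1_expRN_ge; rewrite divr_ge0 ?(ltW b0) //= ler_pdivrMr // mul1r.
  by apply: le_trans b1 _; rewrite ler1n.
have e0 := expR_ge0 (b * ln (m.+1%:R : R)).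
have h4 : expR (b * ln m%:R) <= expR (b * ln m.+1%:R) * (1 - b / m.+1%:R / 2).
  by apply: le_trans h2 _; rewrite ler_wpM2l // lerBrDr -lerBrDl.
have -> : 2 / b * expR (b * ln m.+1%:R) = 2 / b * (expR (b * ln m.+1%:R) * (1 - b / m.+1%:R / 2)) + expR (b * ln m.+1%:R) / m.+1%:R.
  by field; rewrite !gt_eqF.
by rewrite lerD2r ler_wpM2l // divr_ge0 // ltW.
Qed.

Lemma sum_powNB1_le b n0 N : 0 < b <= 1 -> (0 < n0)%N ->
  \sum_(n0 <= n < N) expR ((- b - 1) * ln n%:R) <= 4 / b * expR (- b * ln n0%:R).
Proof.
move=> /andP[b0 b1] n00.
suff : (n0 <= N)%N -> \sum_(n0 <= n < N) expR ((- b - 1) * ln n%:R) <=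
    4 / b * (expR (- b * ln n0%:R) - expR (- b * ln N%:R)).
  have [nN /(_ isT) h|nN _] := leqP n0 N; last first.
    by rewrite big_geq ?(ltnW nN) // mulr_ge0 ?expR_ge0 // divr_ge0 // ltW.
  apply: le_trans h _; rewrite ler_wpM2l ?divr_ge0 ?(ltW b0) //.
  by rewrite gerBl expR_ge0.
elim: N => [|N IH]; first by rewrite leqn0 => /eqP E; rewrite E in n00.
rewrite leq_eqVlt => /predU1P[<-|]; first by rewrite big_geq // subrr mulr0.
rewrite ltnS => nN; rewrite big_nat_recr //=.
apply: le_trans (lerD (IH nN) (lexx _)) _.
have N0 : (0 < N)%N by exact: leq_trans n00 nN.
have N0R : 0 < N%:R :> R by rewrite ltr0n.
have N1R : 0 < N.+1%:R :> R by rewrite ltr0n.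
have -> : expR ((- b - 1) * ln N%:R) = expR (- b * ln N%:R) / N%:R.
  by rewrite mulrBl mul1r expRB lnK ?posrE.
have h1 := ln_succ_ge N0.
have h2 : expR (- b * ln N.+1%:R) <= expR (- b * ln N%:R) * expR (- (b / N.+1%:R)).
  by rewrite -expRD ler_expR !mulNr -opprD lerN2 -mulrDr ler_wpM2l ?(ltW b0) //.
have h3 : b / N.+1%:R / 2 <= 1 - expR (- (b / N.+1%:R)).
  apply: subr1_expRN_ge; rewrite divr_ge0 ?(ltW b0) //= ler_pdivrMr // mul1r.
  by apply: le_trans b1 _; rewrite ler1n.
have h5 : b / N%:R / 4 <= b / N.+1%:R / 2.
  have -> : b / N.+1%:R / 2 = b / (2 * N.+1%:R) by field; rewrite gt_eqF.
  have -> : b / N%:R / 4 = b / (4 * N%:R) by field; rewrite gt_eqF.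
  rewrite ler_wpM2l ?(ltW b0) // lef_pV2 ?posrE ?mulr_gt0 // -[N.+1%:R]natr1.
  have : 1 <= N%:R :> R by rewrite ler1n.
  by lra.
have e0 := expR_ge0 (- b * ln (N%:R : R)).
have h4 : expR (- b * ln N.+1%:R) <= expR (- b * ln N%:R) * (1 - b / N%:R / 4).
  by apply: le_trans h2 _; rewrite ler_wpM2l // lerBrDr -lerBrDl (le_trans h5).
have : 4 / b * expR (- b * ln N.+1%:R) <= 4 / b * (expR (- b * ln N%:R) * (1 - b / N%:R / 4)).
  by rewrite ler_wpM2l // divr_ge0 // ltW.
have -> : 4 / b * (expR (- b * ln N%:R) * (1 - b / N%:R / 4)) = 4 / b * expR (- b * ln N%:R) - expR (- b * ln N%:R) / N%:R.
  by field; rewrite !gt_eqF.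
rewrite !mulrBr; lra.
Qed.

End RealEstimates.

(** * Rankin's bound for the discrepancy *)

Section Rankin.
Variables (R : realType) (I : finType) (p : I -> nat).
Hypothesis p_prime : forall i, prime (p i).

Lemma ln_dprod (J : {set I}) : ln (dprod p J)%:R = \sum_(i in J) ln (p i)%:R :> R.
Proof.
suff: ln (dprod p J)%:R = \sum_(i in J) ln (p i)%:R :> R /\ (0 < dprod p J)%N by case.
rewrite /dprod; elim/big_rec2: _ => [|i c n _ [cE n0]]; first by rewrite ln1.
have pi0 := prime_gt0 (p_prime i); split; last by rewrite muln_gt0 pi0.
by rewrite natrM lnM ?posrE ?ltr0n // cE.
Qed.

Lemma sum_expR_dprod (y : R) :
  \sum_(J : {set I}) expR (y * ln (dprod p J)%:R) = \prod_i (1 + expR (y * ln (p i)%:R)).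
Proof.
by rewrite prodr_1D; apply: eq_bigr => J _; rewrite ln_dprod mulr_sumr expR_sum.
Qed.

(** The fractional part of q = n / d is at most min(1, q), hence at most q^y for any [y] between 0
    and 1. *)
Lemma discrepancy_rankin (y : R) n : 0 <= y <= 1 -> (0 < n)%N ->
  `|discrepancy R p n| <= expR (y * ln n%:R) * \prod_i (1 + expR (- y * ln (p i)%:R)).
Proof.
move=> /andP[y0 y1] n0; rewrite -sum_expR_dprod mulr_sumr.
apply: le_trans (ler_norm_sum _ _ _) _; apply: ler_sum => J _.
rewrite normrM normrX normrN1 expr1n mul1r.
have d0 := dprod_gt0 p_prime J.
have d0R : 0 < (dprod p J)%:R :> R by rewrite ltr0n.
have n0R : 0 < n%:R :> R by rewrite ltr0n.
rewrite mulNr -expRD -mulrBr -ln_div ?posrE //.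
set q := n%:R / _ : R.
have q0 : 0 < q by rewrite divr_gt0.
have h1 : (n %/ dprod p J)%:R <= q.
  by rewrite ler_pdivlMr // -natrM ler_nat leq_divM.
have h2 : q < (n %/ dprod p J)%:R + 1.
  by rewrite ltr_pdivrMr // natr1 -natrM ltr_nat ltn_ceil.
rewrite ler0_norm ?subr_le0 // opprB.
have [q1|q1] := leP q 1.
  apply: (@le_trans _ _ q); first by rewrite gerBl.
  have lq : ln q <= 0 by rewrite ln_le0.
  by rewrite -[leLHS](lnK (x := q)) ?posrE // ler_expR -[leLHS]mul1r; nra.
apply: (@le_trans _ _ 1); first lra.
by rewrite -[leLHS]expR0 ler_expR mulr_ge0 // ln_ge0 // ltW.
Qed.

End Rankin.

(** * Large discrepancies of both signs inside the window *)

Lemma ler_sum_nat_sub (R : realType) (P : pred nat) (F : nat -> R) (a N a' N' : nat) :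
  (forall n, 0 <= F n) ->
  (forall n, (a <= n < N)%N -> P n -> (a' <= n < N')%N) ->
  \sum_(a <= n < N | P n) F n <= \sum_(a' <= n < N') F n.
Proof.
move=> F0 H; rewrite !big_geq_mkord.
rewrite (big_ord_widen_cond (maxn N N') (fun i => P i && (a <= i)%N) F (leq_maxl _ _)).
rewrite (big_ord_widen_cond (maxn N N') (fun i => true && (a' <= i)%N) F (leq_maxr _ _)).
rewrite big_mkcond [leRHS]big_mkcond; apply: ler_sum => i _.
case: ifP => [/andP[/andP[Pi ai] iN]|_]; last by case: ifP => _.
by have /andP[-> ->] := H i (introT andP (conj ai iN)) Pi.
Qed.

Section LargeDiscrepancy.
Import complex.
Local Open Scope complex_scope.
Variables (R : realType) (I : finType) (p : I -> nat).
Hypothesis p_prime : forall i, prime (p i).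
Hypothesis p_inj : injective p.
Variables (l xi lam u : R).
Local Notation normc := (@Normc.normc R).
Local Notation E := (discrepancy R p).
Local Notation delta := (density R p).
Local Notation lnp i := (ln (p i)%:R).
Let th : R := pi / l.
Let s0 := 1 - xi / l.
Let bet := xi / l.
Let b := lam / l.
Let k0 := 1 + th / s0.
Let a := \sum_i expR (- s0 * lnp i).
Let V := u * (1 + 3 * lam).
Let M := expR (a - u * lam ^+ 2 / 8).
Let ex n := expR (- s0 * ln (n%:R : R)).

Hypothesis l_ge : 400 <= l.
Hypothesis xi_ge : 4 <= xi.
Hypothesis xi_le : xi <= 11 / 20 * l.
Hypothesis lam_gt0 : 0 < lam.
Hypothesis lam_le : lam <= 1 / 4.
Hypothesis ulam_ge : 4 <= u * lam.
Hypothesis p_le : forall i, lnp i <= l.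
Hypothesis p_ge : forall i, (1 - lam / 16) * l <= lnp i.
Hypothesis x_le : forall i, expR (- s0 * lnp i) <= lam ^+ 2 / 32.
Hypothesis a_ge : u * (1 + lam) <= a.
Hypothesis a_le : a <= u * (1 + lam) + 1.
(** The Rankin tails are smaller than [M] by e^(-u lam^2 / 8), and this gain must beat the ratio bet
    / b = xi / lam. *)
Hypothesis growth : 768 * xi / lam <= expR (u * lam ^+ 2 / 8).
Hypothesis M_ge : 200 <= M.

Let l0 : 0 < l. Proof. by apply: lt_le_trans l_ge; rewrite ltr0n. Qed.
Let u_ge : 16 <= u.
Proof. by have := ulam_ge; have := lam_le; have := lam_gt0; nra. Qed.
Let bet_le : bet <= 11 / 20. Proof. by rewrite /bet ler_pdivrMr. Qed.
Let bet_gt0 : 0 < bet. Proof. by rewrite divr_gt0 // (lt_le_trans _ xi_ge). Qed.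
Let s0_ge : 9 / 20 <= s0. Proof. by have := bet_le; rewrite /s0 /bet; lra. Qed.
Let s0_gt0 : 0 < s0. Proof. by have := s0_ge; lra. Qed.
Let s0_lt1 : s0 < 1. Proof. by have := bet_gt0; rewrite /s0 /bet; lra. Qed.
Let b_gt0 : 0 < b. Proof. by rewrite divr_gt0. Qed.
Let b_le : b <= 1 / 1600.
Proof. by rewrite ler_pdivrMr //; have := lam_le; have := l_ge; lra. Qed.
Let b_le_bet : b <= bet.
Proof. by rewrite ler_pM2r ?invr_gt0 //; have := lam_le; have := xi_ge; lra. Qed.
Let th_ge0 : 0 <= th. Proof. by rewrite divr_ge0 ?pi_ge0 // ltW. Qed.
Let pi_lt4 : pi < 4 :> R. Proof. by have := pihalf_lt2 R; lra. Qed.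
Let th_le : th <= 1 / 100.
Proof. by rewrite ler_pdivrMr //; have := pi_lt4; have := l_ge; lra. Qed.
Let th_le_bet : th <= bet.
Proof. by rewrite ler_pM2r ?invr_gt0 //; have := pi_lt4; have := xi_ge; lra. Qed.
Let k0_ge1 : 1 <= k0. Proof. by rewrite lerDl divr_ge0 // ltW. Qed.
Let k0_le : k0 <= 103 / 100.
Proof.
suff : th / s0 <= 3 / 100 by rewrite /k0; lra.
by rewrite ler_pdivrMr //; have := s0_ge; have := th_le; lra.
Qed.
Let x_ge0 i : 0 <= expR (- s0 * lnp i). Proof. exact: expR_ge0. Qed.

(** The angles th ln p lie within lam / 4 of pi, so with x = p^(-s0) each factor is at least 1 + x
    (1 - lam^2 / 32), and [x_le] allows passing to e^(x (1 - lam^2 / 16)). The total loss in the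
    exponent is at most u lam^2 / 8 since a <= 2 u. *)
Lemma eulerF_lower : M <= normc (eulerF p s0 th).
Proof.
rewrite /eulerF normc_prod.
apply: (@le_trans _ _ (\prod_i expR (expR (- s0 * lnp i) * (1 - lam ^+ 2 / 16)))).
  rewrite -expR_sum ler_expR -mulr_suml -/a.
  have : a * (lam ^+ 2 / 16) <= 2 * u * (lam ^+ 2 / 16).
    rewrite ler_wpM2r ?divr_ge0 ?sqr_ge0 //.
    apply: le_trans a_le _; have := lam_le; have := u_ge; nra.
  lra.
apply: ler_prod => i _; rewrite expR_ge0 /=.
apply: (@le_trans _ _ (complex.Re (1 - cpower s0 th (p i)%:R))); last exact: Re_le_normc.
set x := expR (- s0 * lnp i).
have -> : complex.Re (1 - cpower s0 th (p i)%:R) = 1 - x * cos (th * lnp i).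
  have ReB (w : R[i]) : complex.Re (1 - w) = 1 - complex.Re w by case: w.
  by rewrite ReB.
pose y := pi - th * lnp i.
have -> : cos (th * lnp i) = - cos y.
  rewrite /y cosB cospi sinpi; ring.
have y0 : 0 <= y.
  rewrite /y subr_ge0 /th mulrAC ler_pdivrMr // ler_wpM2l ?pi_ge0 //; exact: p_le.
have y1 : y <= lam / 4.
  have h : th * ((1 - lam / 16) * l) <= th * lnp i by apply: ler_wpM2l.
  have h2 : th * ((1 - lam / 16) * l) = pi * (1 - lam / 16) by rewrite /th; field; rewrite gt_eqF.
  rewrite /y; have := lam_gt0; have := pi_lt4; nra.
have hc := cos_ge_quadratic y.
have y2 : y ^+ 2 <= lam ^+ 2 / 16 by have := lam_gt0; nra.
have hc2 : 1 - lam ^+ 2 / 32 <= cos y by lra.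
have l2 : lam ^+ 2 <= 1 / 16 by have := lam_gt0; have := lam_le; nra.
have l20 := sqr_ge0 lam.
have x0 : 0 <= x by exact: expR_ge0.
have xl : x <= lam ^+ 2 / 32 by exact: x_le.
pose w := x * (1 - lam ^+ 2 / 32).
have w0 : 0 <= w by rewrite mulr_ge0 //; lra.
apply: (@le_trans _ _ (1 + w)).
  apply: le_trans (expR_1D_ge w0); rewrite ler_expR /w.
  have wx : w <= lam ^+ 2 / 32 by rewrite /w; nra.
  rewrite -mulrA ler_wpM2l // -/w; nra.
rewrite /w mulrN opprK lerD2l ler_wpM2l //.
Qed.

(** Raising the exponent by [b] multiplies each term by at most e^(-w). Since a >= u (1 + lam), the
    bulk of the divisors lies beyond z^u, and the saving exceeds lam u by u lam^2 / 4. *)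
Lemma rankin_low_prod :
  \prod_i (1 + expR (- (s0 + b) * lnp i)) <= expR (- lam * u) * (M * expR (- (u * lam ^+ 2 / 8))).
Proof.
apply: le_trans (prodr_1D_le_expR _) _; first by move=> i; exact: expR_ge0.
pose w := lam * (1 - lam / 16).
have h : \sum_i expR (- (s0 + b) * lnp i) <= a * expR (- w).
  rewrite /a mulr_suml; apply: ler_sum => i _.
  rewrite -expRD ler_expR mulNr mulrDl opprD mulNr lerD2l lerN2 /w /b.
  have -> : lam * (1 - lam / 16) = lam / l * ((1 - lam / 16) * l) by field; rewrite gt_eqF.
  by rewrite ler_wpM2l // ltW.
rewrite /M -!expRD ler_expR; apply: le_trans h _.
have w0 : 0 <= w by rewrite /w; have := lam_gt0; have := lam_le; nra.
have hw := expRN_le_quadratic w0.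
have a0 : 0 <= a by apply: sumr_ge0 => i _; exact: expR_ge0.
have h1 : a * expR (- w) <= a * (1 - w + w ^+ 2 / 2) by rewrite ler_wpM2l.
have w1 : w <= lam by rewrite /w; have := lam_gt0; nra.
have h2 : lam - 9 / 16 * lam ^+ 2 <= w - w ^+ 2 / 2.
  have : w ^+ 2 <= lam ^+ 2 by rewrite ler_pXn2r // nnegrE // ltW.
  have -> : w = lam - lam ^+ 2 / 16 by rewrite /w; field.
  lra.
have h3 : u * (1 + lam) * (lam - 9 / 16 * lam ^+ 2) <= a * (w - w ^+ 2 / 2).
  have l1 := lam_le; have l2 := lam_gt0; have u1 := u_ge.
  apply: ler_pM => //; first by rewrite mulr_ge0 //; lra.
  have -> : lam - 9 / 16 * lam ^+ 2 = lam * (1 - 9 / 16 * lam) by ring.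
  by rewrite mulr_ge0 //; lra.
have h4 : u * lam + u * lam ^+ 2 / 4 <= u * (1 + lam) * (lam - 9 / 16 * lam ^+ 2).
  have -> : u * (1 + lam) * (lam - 9 / 16 * lam ^+ 2) = u * lam + u * lam ^+ 2 * (7 / 16 - 9 / 16 * lam) by field.
  have : 0 <= u * lam ^+ 2 * (3 / 16 - 9 / 16 * lam).
    have l1 := lam_le; have u1 := u_ge.
    by rewrite !mulr_ge0 ?sqr_ge0 //; lra.
  lra.
lra.
Qed.

(** Lowering the exponent by [b] costs at most a (lam + lam^2). As a <= u (1 + lam) + 1, the end V =
    u (1 + 3 lam) of the window lies far enough beyond the bulk; [ulam_ge] absorbs the 1. *)
Lemma rankin_high_prod :
  \prod_i (1 + expR (- (s0 - b) * lnp i)) <= expR (lam * V) * (M * expR (- (u * lam ^+ 2 / 8))).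
Proof.
apply: le_trans (prodr_1D_le_expR _) _; first by move=> i; exact: expR_ge0.
have h : \sum_i expR (- (s0 - b) * lnp i) <= a * expR lam.
  rewrite /a mulr_suml; apply: ler_sum => i _.
  rewrite -expRD ler_expR opprB mulrDl addrC lerD2l /b.
  have {2}-> : lam = lam / l * l by field; rewrite gt_eqF.
  by rewrite ler_wpM2l // ltW.
rewrite /M -!expRD ler_expR; apply: le_trans h _.
have lam1 : lam <= 1 by have := lam_le; lra.
have hw := expR_le_quadratic (ltW lam_gt0) lam1.
have a0 : 0 <= a by apply: sumr_ge0 => i _; exact: expR_ge0.
have h1 : a * expR lam <= a * (1 + lam + lam ^+ 2) by rewrite ler_wpM2l.
have h2 : a * (lam + lam ^+ 2) <= (u * (1 + lam) + 1) * (lam + lam ^+ 2).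
  by rewrite ler_wpM2r // addr_ge0 ?sqr_ge0 // ltW.
have h3 : (u * (1 + lam) + 1) * (lam + lam ^+ 2) + u * lam ^+ 2 / 4 <= lam * V.
  rewrite /V.
  have -> : lam * (u * (1 + 3 * lam)) = (u * (1 + lam) + 1) * (lam + lam ^+ 2) + u * lam ^+ 2 / 4 + lam * ((u * lam) * (3 / 4 - lam) - (1 + lam)) by field.
  rewrite lerDl mulr_ge0 ?(ltW lam_gt0) //.
  have := ulam_ge; have := lam_le; nra.
lra.
Qed.

(** The pole has modulus at least 1 / (bet + th), which is at least 100 / 56 and at least 1 / (2
    bet); the remainder 1 / 2 + k0 / 2 takes away less than two thirds of it. This is where xi <= 11
    / 20 l enters. *)
Lemma zeta_lower N : (0 < N)%N -> (6 * bet)^-1 <= normc (zeta_sum s0 th N).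
Proof.
move=> N0; have h := zeta_near s0_gt0 s0_lt1 th_ge0 N0.
set gam := (_ -i* _)^-1 in h.
have bt0 : 0 < bet + th by rewrite (lt_le_trans bet_gt0) // lerDl.
have g0 : (bet + th)^-1 <= normc gam.
  have s0n : 0 < normc ((1 - s0) -i* th).
    rewrite lt_neqAle normc_ge0 andbT eq_sym; apply/eqP => /Normc.eq0_normc /eqP.
    by apply/negP; exact: onems_neq0.
  rewrite /gam Normc.normcV lef_pV2 ?posrE //.
  have -> : (1 - s0) -i* th = bet%:C + (0 -i* th) by rewrite /s0 -/bet; simpc; congr (_ +i* _); ring.
  apply: le_trans (le_normcD _ _) _; rewrite normc_real (gtr0_norm bet_gt0) lerD2l.
  by rewrite /= expr0n /= add0r sqrtr_sqr normrN ger0_norm.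
have h12 : normc (1 / 2 : R[i]) = 1 / 2 by rewrite normc_half normc_1.
have e1 : normc gam - normc (1 / 2 : R[i]) <= normc (1 / 2 - gam).
  by rewrite -[X in _ <= X]normcN opprB normcB_ge.
have e2 : normc (1 / 2 - gam) - normc (zeta_sum s0 th N - (1 / 2 - gam)) <= normc (zeta_sum s0 th N).
  rewrite -[X in _ - X <= _]normcN -[X in _ <= X]opprK -{2}[zeta_sum s0 th N]opprK.
  have -> : - - normc (- - zeta_sum s0 th N) = normc ((1 / 2 - gam) - - (zeta_sum s0 th N - (1 / 2 - gam))).
    by rewrite !opprK; congr (normc _); ring.
  exact: normcB_ge.
have g1 : 100 / 56 <= (bet + th)^-1.
  rewrite -[100 / 56]invrK lef_pV2 ?posrE ?invr_gt0 ?divr_gt0 //.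
  have -> : (100 / 56)^-1 = 56 / 100 :> R by rewrite invf_div.
  have := bet_le; have := th_le; lra.
have g2 : (2 * bet)^-1 <= (bet + th)^-1.
  have b20 : 0 < 2 * bet by have := bet_gt0; lra.
  by rewrite lef_pV2 ?posrE //; have := th_le_bet; lra.
have h6 : (6 * bet)^-1 = (2 * bet)^-1 / 3 by field; rewrite gt_eqF.
rewrite -/k0 in h; have := k0_le; lra.
Qed.

Lemma zeta_real_upper N : (0 < N)%N -> normc (zeta_sum s0 0 N) <= bet^-1 + 1.
Proof.
move=> N0; have h := zeta_near s0_gt0 s0_lt1 (lexx 0) N0.
rewrite mul0r addr0 in h; set gam := (_ -i* _)^-1 in h.
have g0 : normc gam = bet^-1.
  rewrite /gam Normc.normcV; congr (_^-1); rewrite /= oppr0 expr0n /= addr0 sqrtr_sqr.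
  by rewrite /s0 opprB addrC subrK ger0_norm // ltW.
have -> : zeta_sum s0 0 N = (zeta_sum s0 0 N - (1 / 2 - gam)) + (1 / 2 - gam) by rewrite subrK.
apply: le_trans (le_normcD _ _) _.
have : normc (1 / 2 - gam) <= 1 / 2 + bet^-1.
  by apply: le_trans (le_normcD _ _) _; rewrite normcN g0 normc_half normc_1.
lra.
Qed.

Let w0 n := expR (- s0 * ln (n%:R : R)) - expR (- s0 * ln n.+1%:R).

Lemma w0_ge0 n : (0 < n)%N -> 0 <= w0 n.
Proof.
move=> n0; rewrite subr_ge0 ler_expR !mulNr lerN2 ler_wpM2l ?(ltW s0_gt0) //.
by rewrite ler_ln ?posrE ?ltr0n // ler_nat.
Qed.

Lemma w0_le n : (0 < n)%N -> w0 n <= expR ((- s0 - 1) * ln n%:R).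
Proof.
move=> n0; have nR : 0 < n%:R :> R by rewrite ltr0n.
have h := @ln_succ_le R n n0.
have h1 : expR (- s0 * ln n%:R) * (1 - n%:R^-1) <= expR (- s0 * ln n.+1%:R).
  apply: (@le_trans _ _ (expR (- s0 * ln n%:R) * expR (- (s0 * n%:R^-1)))).
    rewrite ler_wpM2l ?expR_ge0 //.
    apply: (@le_trans _ _ (1 + - (s0 * n%:R^-1))); last exact: expR_ge1Dx.
    rewrite lerD2l lerN2 -[leRHS]mul1r ler_wpM2r ?invr_ge0 ?(ltW nR) //.
    exact: ltW.
  by rewrite -expRD ler_expR !mulNr -opprD lerN2 -mulrDr ler_wpM2l ?(ltW s0_gt0).
rewrite /w0 mulrBl mul1r expRB lnK ?posrE //.
by move: h1; rewrite mulrBr mulr1; lra.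
Qed.

(** At th = 0 every factor 1 - p^(-s0) lies in [0, 1], so the Euler product is at most 1 and the sum
    against the real weights [w0] is O(1 / bet). Adding a multiple of [w0] is therefore cheap
    compared with M / bet. *)
Lemma real_osc_sum (N : nat) : (0 < N)%N ->
  normc (\sum_(1 <= n < N) (E n)%:C * (cpower s0 0 n%:R - cpower s0 0 n.+1%:R)
         - (eulerF p s0 0 - delta%:C) * zeta_sum s0 0 N) <= 1 ->
  `|\sum_(1 <= n < N) E n * w0 n| <= bet^-1 + 2.
Proof.
move=> N0 h.
have c0 x : cpower s0 0 x = (expR (- s0 * ln x))%:C.
  by rewrite /cpower !mul0r cos0 sin0 mulr1 mulr0 oppr0.
have SE : \sum_(1 <= n < N) (E n)%:C * (cpower s0 0 n%:R - cpower s0 0 n.+1%:R)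
    = (\sum_(1 <= n < N) E n * w0 n)%:C.
  rewrite rmorph_sum; apply: eq_bigr => n _.
  by rewrite !c0 rmorphM rmorphB.
have FE : eulerF p s0 0 = (\prod_i (1 - expR (- s0 * lnp i)))%:C.
  rewrite rmorph_prod; apply: eq_bigr => i _.
  by rewrite c0 rmorphB.
rewrite SE FE in h; set F := \prod_i _ in h.
have F01 : 0 <= F <= 1.
  have x1 i : expR (- s0 * lnp i) <= 1.
    apply: le_trans (x_le i) _; have := lam_gt0; have := lam_le; nra.
  apply/andP; split; first by apply: prodr_ge0 => i _; rewrite subr_ge0.
  by apply: prodr_ile1 => i _; rewrite subr_ge0 x1 /= gerBl expR_ge0.
have d01 : 0 <= delta <= 1 by rewrite (ltW (density_gt0 _ p_prime)) density_le1.
rewrite -normc_real.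
set S := (\sum_(1 <= n < N) E n * w0 n)%:C.
have -> : S = (S - (F%:C - delta%:C) * zeta_sum s0 0 N) + (F%:C - delta%:C) * zeta_sum s0 0 N by rewrite subrK.
apply: le_trans (le_normcD _ _) _.
have h2 : normc ((F%:C - delta%:C) * zeta_sum s0 0 N) <= bet^-1 + 1.
  rewrite Normc.normcM -rmorphB normc_real.
  have hz := zeta_real_upper N0.
  apply: le_trans (_ : 1 * normc (zeta_sum s0 0 N) <= _); last by rewrite mul1r.
  rewrite ler_wpM2r ?normc_ge0 // ler_norml; move/andP: F01 => [? ?]; move/andP: d01 => [? ?].
  by apply/andP; split; lra.
have : normc (S - (F%:C - delta%:C) * zeta_sum s0 0 N) <= 1 by [].
lra.
Qed.

Lemma cpow_diff_w0 n : (0 < n)%N ->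
  normc (cpower s0 th n%:R - cpower s0 th n.+1%:R) <= k0 * w0 n.
Proof.
move=> n0; apply: cpow_diff_le => //; rewrite ?ltr0n ?ler_nat //.
Qed.

Definition low n := ln (n%:R : R) < u * l.
Definition high n := V * l < ln (n%:R : R).

Lemma low_sum N : \sum_(1 <= n < N | low n) expR ((b - 1) * ln n%:R) <= 2 / b * expR (lam * u).
Proof.
pose K := Num.truncn (expR (u * l)).
have ul0 : 0 <= u * l by rewrite mulr_ge0 ?(ltW l0) //; have := u_ge; lra.
have K0 : (0 < K)%N by rewrite truncn_gt0 -[leLHS]expR0 ler_expR.
apply: (@le_trans _ _ (\sum_(1 <= n < K.+1) expR ((b - 1) * ln n%:R))).
  apply: ler_sum_nat_sub => [n|n /andP[n1 nN] lown]; first exact: expR_ge0.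
  rewrite n1 ltnS /= truncn_ge_nat ?expR_ge0 //.
  by rewrite -[leLHS]lnK ?posrE ?ltr0n // ler_expR ltW.
have b1 : b <= 1 by have := b_le; lra.
apply: le_trans (@sum_powB1_le R b K _ K0) _; first by rewrite b_gt0.
apply: ler_wpM2l; first by apply: divr_ge0 => //; exact: ltW.
rewrite ler_expR.
have -> : lam * u = b * (u * l) by rewrite /b; field; rewrite gt_eqF.
apply: ler_wpM2l; first exact: ltW.
rewrite -[leRHS]expRK ler_ln ?posrE ?ltr0n ?expR_gt0 //.
by rewrite truncn_le expR_ge0.
Qed.

Lemma mid_sum N : \sum_(1 <= n < N | ~~ high n) expR ((bet - 1) * ln n%:R) <= 2 / bet * expR (xi * V).
Proof.
pose K := Num.truncn (expR (V * l)).
have V0 : 0 <= V by rewrite mulr_ge0 //; have := u_ge; have := lam_gt0; lra.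
have K0 : (0 < K)%N by rewrite truncn_gt0 -[leLHS]expR0 ler_expR mulr_ge0 // ltW.
apply: (@le_trans _ _ (\sum_(1 <= n < K.+1) expR ((bet - 1) * ln n%:R))).
  apply: ler_sum_nat_sub => [n|n /andP[n1 nN]]; first exact: expR_ge0.
  rewrite /high -leNgt => hn.
  rewrite n1 ltnS /= truncn_ge_nat ?expR_ge0 //.
  by rewrite -[leLHS]lnK ?posrE ?ltr0n // ler_expR.
have b1 : bet <= 1 by have := bet_le; lra.
apply: le_trans (@sum_powB1_le R bet K _ K0) _; first by rewrite bet_gt0.
apply: ler_wpM2l; first by apply: divr_ge0 => //; exact: ltW.
rewrite ler_expR.
have -> : xi * V = bet * (V * l) by rewrite /bet; field; rewrite gt_eqF.
apply: ler_wpM2l; first exact: ltW.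
rewrite -[leRHS]expRK ler_ln ?posrE ?ltr0n ?expR_gt0 //.
by rewrite truncn_le expR_ge0.
Qed.

Lemma high_sum N : \sum_(1 <= n < N | high n) expR ((- b - 1) * ln n%:R) <= 4 / b * expR (- lam * V).
Proof.
pose K := Num.truncn (expR (V * l)).
apply: (@le_trans _ _ (\sum_(K.+1 <= n < N) expR ((- b - 1) * ln n%:R))).
  apply: ler_sum_nat_sub => [n|n /andP[n1 nN] hn]; first exact: expR_ge0.
  rewrite nN andbT truncn_lt_nat ?expR_ge0 //.
  by rewrite -[ltRHS]lnK ?posrE ?ltr0n // ltr_expR.
have b1 : b <= 1 by have := b_le; lra.
apply: le_trans (@sum_powNB1_le R b K.+1 N _ _) _ => //; first by rewrite b_gt0.
apply: ler_wpM2l; first by apply: divr_ge0 => //; exact: ltW.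
rewrite ler_expR !mulNr lerN2.
have -> : lam * V = b * (V * l) by rewrite /b; field; rewrite gt_eqF.
apply: ler_wpM2l; first exact: ltW.
rewrite -[leLHS]expRK ler_ln ?posrE ?ltr0n ?expR_gt0 //.
by rewrite ltW // truncnS_gt.
Qed.

Let Pl := \prod_i (1 + expR (- (s0 + b) * lnp i)).
Let Pr := \prod_i (1 + expR (- (s0 - b) * lnp i)).

(** Rankin's exponent is s0 + b below the window and s0 - b above it: against weights of size n^(-s0
    - 1) there remain n^(b - 1) and n^(-b - 1), whose sums are governed by the ends of the
    window. *)
Lemma upper_sum (w : nat -> R) (eps : R) N : `|eps| = 1 ->
  (forall n, (0 < n)%N -> 0 <= w n <= 4 * expR ((- s0 - 1) * ln n%:R)) ->
  (forall n, (0 < n)%N -> ~~ low n -> ~~ high n ->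
     eps * E n <= expR (- (xi * V)) * n%:R) ->
  \sum_(1 <= n < N) eps * E n * w n <=
    4 * Pl * (2 / b * expR (lam * u)) + 4 * expR (- (xi * V)) * (2 / bet * expR (xi * V))
    + 4 * Pr * (4 / b * expR (- lam * V)).
Proof.
move=> eps1 w4 H.
have Pl0 : 0 <= Pl by apply: prodr_ge0 => i _; rewrite addr_ge0 // expR_ge0.
have Pr0 : 0 <= Pr by apply: prodr_ge0 => i _; rewrite addr_ge0 // expR_ge0.
have e0 := expR_ge0 (- (xi * V)).
apply: (@le_trans _ _ (\sum_(1 <= n < N) (if low n then 4 * Pl * expR ((b - 1) * ln n%:R) else 0) +
   \sum_(1 <= n < N) (if ~~ high n then 4 * expR (- (xi * V)) * expR ((bet - 1) * ln n%:R) else 0) +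
   \sum_(1 <= n < N) (if high n then 4 * Pr * expR ((- b - 1) * ln n%:R) else 0))); last first.
  rewrite -!big_mkcond -!mulr_sumr; apply: lerD; first apply: lerD.
  - by apply: ler_wpM2l; [rewrite mulr_ge0|exact: low_sum].
  - by apply: ler_wpM2l; [rewrite mulr_ge0|exact: mid_sum].
  - by apply: ler_wpM2l; [rewrite mulr_ge0|exact: high_sum].
rewrite -!big_split /=.
apply: ler_sum_nat => n /andP[n0 _].
have nR : 0 < n%:R :> R by rewrite ltr0n.
have /andP[wn0 wn4] := w4 n n0.
have tE (y : R) (P : R) : 0 <= y <= 1 -> P = \prod_i (1 + expR (- y * lnp i)) ->
    eps * E n * w n <= 4 * P * expR ((y - s0 - 1) * ln n%:R).
  move=> y01 ->; have := discrepancy_rankin p_prime y01 n0; set Py := \prod_i _ => h.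
  apply: (@le_trans _ _ (`|E n| * w n)).
    by rewrite ler_wpM2r // (le_trans (ler_norm _)) // normrM eps1 mul1r.
  have -> : 4 * Py * expR ((y - s0 - 1) * ln n%:R) =
     expR (y * ln n%:R) * Py * (4 * expR ((- s0 - 1) * ln n%:R)).
    by rewrite [in LHS](_ : (y - s0 - 1) * ln n%:R = y * ln n%:R + (- s0 - 1) * ln n%:R) ?expRD; ring.
  by apply: ler_pM.
have T0 (c e : R) : 0 <= c -> 0 <= 4 * c * expR e.
  by move=> c0; rewrite mulr_ge0 ?expR_ge0 ?mulr_ge0.
case: (boolP (low n)) => [lown|nlow].
  have h : eps * E n * w n <= 4 * Pl * expR ((b - 1) * ln n%:R).
    have -> : b - 1 = (s0 + b) - s0 - 1 by ring.
    apply: tE => //; rewrite addr_ge0 ?(ltW s0_gt0) ?(ltW b_gt0) //=.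
    by have := b_le_bet; rewrite /s0 /bet /b; lra.
  by apply: le_trans h _; rewrite -addrA lerDl addr_ge0 //; case: ifP => // _; exact: T0.
rewrite add0r; case: (boolP (high n)) => [hn|nhigh] /=.
  rewrite add0r.
  have -> : - b - 1 = (s0 - b) - s0 - 1 by ring.
  apply: tE => //; have := b_le; have := s0_ge; have := s0_lt1; have := b_gt0 => *; apply/andP; split; lra.
rewrite addr0; apply: (@le_trans _ _ (expR (- (xi * V)) * n%:R * w n)).
  by rewrite ler_wpM2r // H.
have -> : 4 * expR (- (xi * V)) * expR ((bet - 1) * ln n%:R) =
   expR (- (xi * V)) * n%:R * (4 * expR ((- s0 - 1) * ln n%:R)).
  have -> : bet - 1 = - s0 by rewrite /s0 /bet; ring.
  rewrite [in RHS]mulrBl mul1r expRB lnK ?posrE //; field; exact: lt0r_neq0.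
by rewrite ler_wpM2l // mulr_ge0 // ltW.
Qed.

(** The two tails amount to 24 copies of D / b, each at most M / (768 bet) by [growth]; inside the
    window the powers of e^(xi V) cancel and leave 8 / bet. *)
Lemma upper_bound_small :
  4 * Pl * (2 / b * expR (lam * u)) + 4 * expR (- (xi * V)) * (2 / bet * expR (xi * V))
    + 4 * Pr * (4 / b * expR (- lam * V)) <= bet^-1 * (M / 32 + 8).
Proof.
set D := M * expR (- (u * lam ^+ 2 / 8)).
have h1 : Pl * expR (lam * u) <= D.
  apply: (@le_trans _ _ (expR (- lam * u) * D * expR (lam * u))).
    by rewrite ler_wpM2r ?expR_ge0 // rankin_low_prod.
  by rewrite mulrAC -expRD mulNr addNr expR0 mul1r.
have h2 : Pr * expR (- lam * V) <= D.
  apply: (@le_trans _ _ (expR (lam * V) * D * expR (- lam * V))).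
    by rewrite ler_wpM2r ?expR_ge0 // rankin_high_prod.
  by rewrite mulrAC -expRD mulNr addrN expR0 mul1r.
have h3 : b^-1 * D <= bet^-1 * M / 768.
  rewrite /D expRN mulrA.
  rewrite ler_pdivrMr ?expR_gt0 //.
  have -> : b^-1 * M = bet^-1 * M / 768 * (768 * xi / lam).
    rewrite /b /bet; field; rewrite !gt_eqF // (lt_le_trans _ xi_ge) //.
  apply: ler_wpM2l; last exact: growth.
  have M0 : 0 <= M by exact: expR_ge0.
  have B0 : 0 <= bet^-1 by rewrite invr_ge0 ltW.
  by apply: divr_ge0; [exact: mulr_ge0|exact: ler0n].
have bi : 0 < b^-1 by rewrite invr_gt0.
have -> : 4 * Pl * (2 / b * expR (lam * u)) = 8 * (b^-1 * (Pl * expR (lam * u))) by ring.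
have -> : 4 * Pr * (4 / b * expR (- lam * V)) = 16 * (b^-1 * (Pr * expR (- lam * V))) by ring.
have -> : 4 * expR (- (xi * V)) * (2 / bet * expR (xi * V)) = 8 / bet.
  rewrite expRN; field; rewrite !gt_eqF // expR_gt0 //.
have h4 : b^-1 * (Pl * expR (lam * u)) <= b^-1 * D by rewrite ler_wpM2l // ltW.
have h5 : b^-1 * (Pr * expR (- lam * V)) <= b^-1 * D by rewrite ler_wpM2l // ltW.
move: h3 h4 h5; move: (b^-1 * _) (b^-1 * _) (b^-1 * _) => A B D'.
by move: (bet^-1) => ?; lra.
Qed.

Lemma large_discrepancy (eps : R) : eps = 1 \/ eps = -1 ->
  exists n, [/\ (0 < n)%N, u * l <= ln n%:R <= V * l &
    expR (- (xi * V)) * n%:R <= eps * E n].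
Proof.
move=> eps1; case: (pselect (exists n, [/\ (0 < n)%N, u * l <= ln n%:R <= V * l &
    expR (- (xi * V)) * n%:R <= eps * E n])) => // H; exfalso.
have {}H n : (0 < n)%N -> ~~ low n -> ~~ high n -> eps * E n <= expR (- (xi * V)) * n%:R.
  rewrite /low /high -!leNgt => n0 h1 h2; rewrite leNgt; apply/negP => h3; apply: H.
  by exists n; split => //; [rewrite h1 h2|exact: ltW].
have epsn : `|eps| = 1 by case: eps1 => ->; rewrite ?normrN normr1.
have eps2 : eps * eps = 1 by case: eps1 => ->; ring.
have k00 : 0 < k0 by have := k0_ge1; lra.
have [||M1 [M10 hM1]] := @expR_Nln_small R s0 (2 ^+ #|I| * k0).
- exact: s0_gt0.
- by rewrite mulr_gt0 // exprn_gt0.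
set N := (dprod p [set: I] * M1)%N.
have N0 : (0 < N)%N by rewrite muln_gt0 M10 dprod_gt0.
have hS := osc_sum_near p_prime p_inj s0_gt0 s0_lt1 th_ge0 M10 (erefl N).
have hS0 := osc_sum_near p_prime p_inj s0_gt0 s0_lt1 (lexx 0) M10 (erefl N).
have {}hS := le_trans hS hM1.
have {}hS0 := real_osc_sum N0 (le_trans hS0 (le_trans _ hM1)).
have {}hS0 : `|\sum_(1 <= n < N) E n * w0 n| <= bet^-1 + 2.
  apply: hS0; rewrite ler_wpM2r ?expR_ge0 // ler_wpM2l ?exprn_ge0 //.
  by rewrite mul0r addr0.
set S := \sum_(1 <= n < N) _ in hS; set S0 := \sum_(1 <= n < N) _ in hS0.
(* [c] rotates the sum so that its real part is |S|. Then |r n| <= k0 w0 n makes [w] nonnegative,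
   and eps^2 = 1 lets [r] contribute |S| for either sign. *)
have [c [c1 cS]] := exists_conj_dir S.
pose r n := complex.Re (c * (cpower s0 th n%:R - cpower s0 th n.+1%:R)).
pose w n := k0 * w0 n + eps * r n.
have rb n : (0 < n)%N -> `|r n| <= k0 * w0 n.
  move=> n0; have hc := cpow_diff_w0 n0; set D := _ - _ in hc.
  have hcD : normc (c * D) <= k0 * w0 n.
    rewrite Normc.normcM; apply: le_trans hc.
    by rewrite -[leRHS]mul1r ler_wpM2r // normc_ge0.
  rewrite ler_norml; apply/andP; split; last exact: le_trans (Re_le_normc _) hcD.
  rewrite lerNl; apply: le_trans hcD; rewrite /r -/D.
  have -> : - complex.Re (c * D) = complex.Re (- (c * D)) by case: (c * D).
  by rewrite -normcN Re_le_normc.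
have w4 n : (0 < n)%N -> 0 <= w n <= 4 * expR ((- s0 - 1) * ln n%:R).
  move=> n0; have h := rb n n0; have h2 := w0_le n0; have h3 := w0_ge0 n0.
  have : `|eps * r n| <= k0 * w0 n by rewrite normrM epsn mul1r.
  rewrite ler_norml => /andP[h4 h5]; rewrite /w; apply/andP; split; first lra.
  have h6 : k0 * w0 n <= 2 * w0 n by apply: ler_wpM2r => //; have := k0_le; lra.
  lra.
have hU := le_trans (upper_sum N epsn w4 H) upper_bound_small.
have SE : \sum_(1 <= n < N) eps * E n * w n = eps * k0 * S0 + normc S.
  rewrite -cS /S0 mulr_sumr /S mulr_sumr.
  have ReS : complex.Re (\sum_(1 <= n < N) c * ((E n)%:C * (cpower s0 th n%:R - cpower s0 th n.+1%:R))) =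
     \sum_(1 <= n < N) E n * r n.
    elim/big_rec2: _ => // n y x _ <-; rewrite /r.
    have -> : forall A B : R[i], complex.Re (A + B) = complex.Re A + complex.Re B by move=> [? ?] [? ?].
    by congr (_ + _); rewrite mulrCA; case: (c * _) => A B; simpc.
  rewrite ReS -big_split /=; apply: eq_bigr => n _; rewrite /w.
  have -> : eps * E n * (k0 * w0 n + eps * r n) = eps * k0 * (E n * w0 n) + (eps * eps) * (E n * r n) by ring.
  by rewrite eps2 mul1r.
have hS0' : - (k0 * (bet^-1 + 2)) <= eps * k0 * S0.
  rewrite lerNl; apply: le_trans (ler_norm _) _.
  by rewrite normrN !normrM epsn mul1r (gtr0_norm k00) ler_wpM2l // ltW.
have hF : (M - 1) * (6 * bet)^-1 - 1 <= normc S.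
  set G := (eulerF p s0 th - delta%:C) in hS.
  have hG : M - 1 <= normc G.
    apply: le_trans (normcB_ge _ _); rewrite normc_real.
    have d0 := density_gt0 R p_prime; have d1 := density_le1 R p_prime.
    by rewrite gtr0_norm //; have := eulerF_lower; lra.
  have hz := zeta_lower N0.
  have M1' : 0 <= M - 1 by have := M_ge; lra.
  have b6 : 0 <= (6 * bet)^-1 by rewrite invr_ge0 mulr_ge0 // ltW.
  have h := ler_pM M1' b6 hG hz; rewrite -Normc.normcM in h.
  have := normcB_ge (G * zeta_sum s0 th N) (G * zeta_sum s0 th N - S).
  have -> : G * zeta_sum s0 th N - (G * zeta_sum s0 th N - S) = S by ring.
  have -> : normc (G * zeta_sum s0 th N - S) = normc (S - G * zeta_sum s0 th N).
    by rewrite -normcN opprB.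
  lra.
rewrite SE in hU.
have b1 : 1 <= bet^-1 by rewrite invf_ge1 //; have := bet_le; lra.
have h6 : (6 * bet)^-1 = bet^-1 / 6 by field; rewrite gt_eqF.
have hk : k0 * (bet^-1 + 2) <= 2 * (bet^-1 + 2).
  by rewrite ler_wpM2r //; [lra|have := k0_le; lra].
rewrite h6 in hF.
(* M >= 200 lets (M - 1) / (6 bet) outweigh (M / 32 + 8) / bet together with the bounded terms. *)
have Mg := M_ge.
have : 0 <= bet^-1 * (M - 200) by apply: mulr_ge0; lra.
move: hU hF hS0' hk b1; move: (bet^-1) (k0 * _) (normc S) (eps * k0 * S0) => A B D F.
move=> *; nra.
Qed.

End LargeDiscrepancy.

(** * Tail sums and their logarithmic primitives *)

Section TailSums.
Variables (R : realType) (T : finType) (c del : T -> R).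
Implicit Types x y B : R.

Definition tailsum x := \sum_(j | x < del j) c j.
Definition logtail x := \sum_(j | x < del j) c j * ln (del j / x).

(* As a function of [ln x], [logtail] has slope [- tailsum]. *)
Lemma logtail_diff_le x y B : 0 < x -> x <= y ->
  (forall w, x <= w < y -> tailsum w <= B) ->
  logtail x - logtail y <= B * ln (y / x).
Proof.
move: {2}#|[set j | x < del j < y]%SET| (leqnn #|[set j | x < del j < y]%SET|) => k.
elim: k x y => [|k IH] x y hk x0 xy HB.
  have y0 := lt_le_trans x0 xy.
  have no j : ~~ (x < del j < y).
    apply/negP => hj; move: hk; rewrite leqn0 cards_eq0 => /eqP/setP/(_ j).
    by rewrite inE hj inE.
  have -> : logtail x - logtail y = tailsum x * ln (y / x).
    rewrite /logtail /tailsum mulr_suml.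
    rewrite [X in _ - X]big_mkcond [X in X - _]big_mkcond [RHS]big_mkcond -sumrB.
    apply: eq_bigr => j _; have := no j; case: (ltP x (del j)) => hx /=.
      rewrite -leNgt => hy; have dj0 := lt_trans x0 hx.
      rewrite le_eqVlt in hy; case/predU1P: hy => [E|hy].
        by rewrite -E ltxx subr0.
      by rewrite hy !ln_div ?posrE //; ring.
    by rewrite ltNge (le_trans hx xy) subr0.
  move: xy; rewrite le_eqVlt => /predU1P[->|xy].
    by rewrite divff ?gt_eqF // ln1 !mulr0.
  have hy : 0 <= ln (y / x) by rewrite ln_ge0 // ler_pdivlMr // mul1r ltW.
  by rewrite ler_wpM2r // HB // lexx.
have [/eqP h0|[j]] := set_0Vmem [set j | x < del j < y]%SET.
  by apply: IH => //; rewrite (eqP h0) cards0.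
rewrite inE => /andP[xj jy]; have j0 := lt_trans x0 xj.
have sub1 : [set i | x < del i < del j]%SET \subset [set i | x < del i < y]%SET :\ j.
  apply/fintype.subsetP => i; rewrite !inE => /andP[xi ij].
  by rewrite xi (lt_trans ij jy) !andbT; apply: contraTneq ij => ->; rewrite ltxx.
have sub2 : [set i | del j < del i < y]%SET \subset [set i | x < del i < y]%SET :\ j.
  apply/fintype.subsetP => i; rewrite !inE => /andP[xi ij].
  by rewrite ij (lt_trans xj xi) !andbT; apply: contraTneq xi => ->; rewrite ltxx.
have cj : (#|[set i | (x < del i < y)%R]%SET :\ j| <= k)%N.
  by move: hk; rewrite (cardsD1 j) inE xj jy.
have h1 : logtail x - logtail (del j) <= B * ln (del j / x).
  apply: IH => //; [exact: leq_trans (subset_leq_card sub1) cj|exact: ltW|].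
  by move=> w /andP[xw wj]; apply: HB; rewrite xw (lt_trans wj jy).
have h2 : logtail (del j) - logtail y <= B * ln (y / del j).
  apply: IH => //; [exact: leq_trans (subset_leq_card sub2) cj|exact: ltW|].
  by move=> w /andP[xw wj]; apply: HB; rewrite wj (le_trans (ltW xj) xw).
have y0 := lt_trans j0 jy.
rewrite ln_div ?posrE // in h1; rewrite ln_div ?posrE // in h2; rewrite ln_div ?posrE //.
lra.
Qed.

End TailSums.

Lemma tailsumN (R : realType) (T : finType) (c del : T -> R) x :
  tailsum (fun j => - c j) del x = - tailsum c del x.
Proof. by rewrite /tailsum sumrN. Qed.

Lemma logtailN (R : realType) (T : finType) (c del : T -> R) x :
  logtail (fun j => - c j) del x = - logtail c del x.
Proof. by rewrite /logtail -sumrN; apply: eq_bigr => j _; rewrite mulNr. Qed.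

Lemma logtail_diff_norm (R : realType) (T : finType) (c del : T -> R) x y B :
  0 < x -> x <= y -> (forall w, x <= w < y -> `|tailsum c del w| <= B) ->
  `|logtail c del x - logtail c del y| <= B * ln (y / x).
Proof.
move=> x0 xy H; rewrite ler_norml; apply/andP; split; last first.
  by apply: logtail_diff_le => // w /H; apply: le_trans; exact: ler_norm.
rewrite lerNl; have := @logtail_diff_le R T (fun j => - c j) del x y B x0 xy.
rewrite !logtailN => h; rewrite opprB; apply: le_trans (h _); first by rewrite opprK addrC.
by move=> w /H; rewrite tailsumN; apply: le_trans; rewrite -normrN ler_norm.
Qed.

(** * Tails of the Moebius sum over divisors *)

Section MobiusTail.
Variables (R : realType) (I : finType) (p : I -> nat).
Hypothesis p_prime : forall i, prime (p i).
Hypothesis p_inj : injective p.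
Local Notation d J := ((dprod p J)%:R : R).
Local Notation lnp i := (ln (p i)%:R : R).
Local Notation mu J := ((-1) ^+ #|J : {set I}| / d J).

(** [mtail] and [mlogtail] are L and R of the overview; [mtail_off i] keeps only the divisors prime
    to [p i], which appear when that prime is split off. *)
Definition mtail (x : R) := tailsum (fun J : {set I} => mu J) (fun J => d J) x.
Definition mlogtail (x : R) := logtail (fun J : {set I} => mu J) (fun J => d J) x.
Definition mtail_off (i : I) (x : R) := \sum_(J : {set I} | (i \notin J) && (x < d J)) mu J.
Let sig : R := \sum_i (p i)%:R^-1.

Let pR i : 0 < (p i)%:R :> R. Proof. by rewrite ltr0n prime_gt0. Qed.
Let dR J : 0 < d J. Proof. exact: dprodR_gt0. Qed.

Lemma sum_inv_dprod : \sum_(J : {set I}) (d J)^-1 <= expR sig.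
Proof.
apply: le_trans (@prodr_1D_le_expR R I (fun i => (p i)%:R^-1) _); last by move=> i; rewrite invr_ge0 ltW.
by rewrite prodr_1D; apply: ler_sum => J _; rewrite dprodV.
Qed.

Lemma norm_mu J : `|mu J| = (d J)^-1.
Proof. by rewrite normrM normrX normrN1 expr1n mul1r gtr0_norm // invr_gt0. Qed.

Lemma mtail_off_le i x : `|mtail_off i x| <= expR sig.
Proof.
apply: le_trans (ler_norm_sum _ _ _) _; apply: le_trans sum_inv_dprod.
rewrite big_mkcond; apply: ler_sum => J _; case: ifP => _; first by rewrite norm_mu.
by rewrite invr_ge0 ltW.
Qed.

Lemma mtailE i x : mtail x = mtail_off i x - (p i)%:R^-1 * mtail_off i (x / (p i)%:R).
Proof.
rewrite /mtail /tailsum (bigID (fun J : {set I} => i \notin J)) /=; congr (_ + _).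
  by apply: eq_bigl => J; rewrite andbC.
rewrite /mtail_off mulr_sumr -sumrN.
rewrite (reindex_onto (fun J : {set I} => i |: J) (fun J => J :\ i)) /=; last first.
  by move=> J /andP[_]; rewrite negbK => iJ; rewrite finset.setD1K.
apply: eq_big => [J|J].
  rewrite finset.setU11 /= andbT.
  have -> : ((i |: J) :\ i == J) = (i \notin J).
    by apply/eqP/idP => [<-|iJ]; [rewrite !inE eqxx|rewrite finset.setU1K].
  rewrite andbC; case: (boolP (i \notin J)) => //= iJ.
  by rewrite dprod_setU1 // natrM ltr_pdivrMr // mulrC.
move=> /andP[_ /eqP E]; have iJ : i \notin J by rewrite -E !inE eqxx.
rewrite dprod_setU1 // cardsU1 iJ exprS natrM; field.
by rewrite !gt_eqF.
Qed.

(** On squarefree d, mu(d) ln d is minus the sum of ln p mu(d / p) over the primes p dividing d. *)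
Lemma mtail_identity x : 0 < x -> ln x * mtail x + mlogtail x =
  - \sum_i lnp i / (p i)%:R * mtail_off i (x / (p i)%:R).
Proof.
move=> x0.
transitivity (\sum_(J : {set I} | x < d J) mu J * ln (d J)).
  rewrite /mtail /mlogtail /tailsum /logtail mulr_sumr -big_split /=.
  by apply: eq_bigr => J _; rewrite ln_div ?posrE //; ring.
rewrite big_mkcond /=.
transitivity (\sum_(J : {set I}) \sum_(i in J)
   (- (lnp i / (p i)%:R) * (if x / (p i)%:R < d (J :\ i) then mu (J :\ i) else 0))).
  apply: eq_bigr => J _.
  have E i : i \in J -> - (lnp i / (p i)%:R) * (if x / (p i)%:R < d (J :\ i) then mu (J :\ i) else 0) =
     (if x < d J then mu J else 0) * lnp i.
    move=> iJ; rewrite (dprod_setD1 p iJ) natrM ltr_pdivrMr // [_ * (p i)%:R]mulrC.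
    case: ifP => _; last by rewrite mulr0 mul0r.
    by rewrite [in RHS](cardsD1 i J) iJ exprS; field; rewrite !gt_eqF.
  rewrite (eq_bigr _ E) -mulr_sumr -ln_dprod //.
  by case: ifP => _; rewrite ?mul0r.
rewrite (exchange_setD1 (fun i J => - (lnp i / (p i)%:R) * (if x / (p i)%:R < d J then mu J else 0))).
rewrite (exchange_big_dep predT) //= -sumrN; apply: eq_bigr => i _.
by rewrite -mulr_sumr mulNr /mtail_off -big_mkcondr.
Qed.

(** Rankin's device again: ln (d / y) <= (d / y)^b / b for d > y, after which d may run over all
    divisors. *)
Lemma mlogtail_far (b y : R) : 0 < b -> 0 < y ->
  `|mlogtail y| <= b^-1 * expR (- b * ln y) * \prod_i (1 + expR (- (1 - b) * lnp i)).
Proof.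
move=> b0 y0; rewrite -sum_expR_dprod // mulr_sumr.
apply: le_trans (ler_norm_sum _ _ _) _; rewrite big_mkcond; apply: ler_sum => J _.
case: ifP => [hJ|_]; last by rewrite !mulr_ge0 ?invr_ge0 ?expR_ge0 // ltW.
rewrite normrM norm_mu ln_div ?posrE //.
have h : 0 <= ln (d J) - ln y by rewrite subr_ge0 ler_ln ?posrE // ltW.
rewrite ger0_norm //.
have -> : b^-1 * expR (- b * ln y) * expR (- (1 - b) * ln (d J)) =
   (d J)^-1 * (b^-1 * expR (b * (ln (d J) - ln y))).
  have -> : - (1 - b) * ln (d J) = b * ln (d J) - ln (d J) by ring.
  rewrite expRB lnK ?posrE // mulrBr expRD mulNr; ring.
rewrite ler_wpM2l ?invr_ge0 ?(ltW (dR J)) //.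
rewrite mulrC ler_pdivlMr //.
by apply: le_trans (expR_ge1Dx _); rewrite mulrC lerDr.
Qed.

(** A divisor beyond [h] contributes through [mtail] only, as the floor of h / d vanishes; each of
    the others leaves a rounding error of at most 1. *)
Lemma ncount_mtail (h : R) : 0 < h ->
  `|(ncount p (Num.truncn h))%:R - h * density R p + h * mtail h| <=
  #|[set J : {set I} | d J <= h]%SET|%:R.
Proof.
move=> h0; set m := Num.truncn h.
have mh : m%:R <= h by rewrite truncn_le ltW.
have hm : h < m.+1%:R by exact: truncnS_gt.
rewrite ncountE // density_sum // /discrepancy /mtail /tailsum !mulr_sumr.
rewrite [X in _ + X]big_mkcond -big_split /= -sumrB -big_split /=.
apply: le_trans (ler_norm_sum _ _ _) _.
rewrite -sum1_card natr_sum [leRHS]big_mkcond /=; apply: ler_sum => J _; rewrite inE.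
have -> : m%:R * mu J + (-1) ^+ #|J| * ((m %/ dprod p J)%:R - m%:R / d J) - h * mu J =
   (-1) ^+ #|J| * ((m %/ dprod p J)%:R - h / d J) by ring.
case: (ltP h (d J)) => hJ.
  rewrite divn_small; last by rewrite -(ltr_nat R) (le_lt_trans mh).
  by rewrite sub0r (_ : _ + _ = 0) ?normr0 //; ring.
rewrite addr0 normrM normrX normrN1 expr1n mul1r.
have h1 : (m %/ dprod p J)%:R <= h / d J.
  rewrite ler_pdivlMr // -natrM; apply: le_trans mh; rewrite ler_nat leq_divM //.
have h2 : h / d J <= (m %/ dprod p J)%:R + 1.
  rewrite ler_pdivrMr // natr1 -natrM; apply: le_trans (ltW hm) _.
  by rewrite ler_nat; apply: ltn_ceil; exact: dprod_gt0.
by rewrite ler0_norm ?subr_le0 // opprB lerBlDl.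
Qed.

(** A divisor other than 1 is p d' with p <= h / d', so a linear bound for the primes suffices.
    Later [K] is 24 / ln z, which makes the total error O(h / ln z) rather than O(h). *)
Lemma card_dprod_le (K h : R) : 0 < h -> 0 <= K ->
  (forall y : R, 0 < y -> #|[set i | (p i)%:R <= y]%SET|%:R <= K * y) ->
  #|[set J : {set I} | d J <= h]%SET|%:R <= 1 + K * h * expR sig.
Proof.
move=> h0 K0 HK.
apply: (@le_trans _ _ (\sum_(J : {set I}) (1 *+ (J == finset.set0) + \sum_(i in J) (if (p i)%:R * d (J :\ i) <= h then 1 else 0)))).
  rewrite -sum1_card natr_sum [leLHS]big_mkcond /=; apply: ler_sum => J _; rewrite inE.
  case: (ifP (d J <= h)) => hJ; last first.
    by rewrite addr_ge0 ?mulrn_wge0 // sumr_ge0 // => i _; case: ifP.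
  have [->|[i iJ]] := set_0Vmem J.
    by rewrite eqxx big_set0 addr0.
  rewrite (bigD1 i) //= -natrM -dprod_setD1 // hJ addrCA lerDl.
  by rewrite addr_ge0 ?mulrn_wge0 // sumr_ge0 // => k _; case: ifP.
rewrite big_split /=; apply: lerD.
  rewrite (bigD1 finset.set0) //= eqxx big1 ?addr0 // => J /negbTE ->//.
rewrite (exchange_setD1 (fun i J => if (p i)%:R * d J <= h then 1 else 0)).
apply: (@le_trans _ _ (\sum_(J : {set I}) K * h * (d J)^-1)); last first.
  by rewrite -mulr_sumr ler_wpM2l ?mulr_ge0 ?(ltW h0) // sum_inv_dprod.
apply: ler_sum => J _; rewrite -mulrA.
apply: le_trans (HK _ _); last by rewrite divr_gt0.
rewrite -sum1_card natr_sum.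
rewrite big_mkcond [leRHS]big_mkcond /=; apply: ler_sum => i _.
rewrite inE ler_pdivlMr //; case: ifP => _; case: ifP => //.
Qed.

End MobiusTail.

(** * Propagation of a large tail to both signs *)

Section Propagation.
Variables (R : realType) (I : finType) (p : I -> nat).
Hypothesis p_prime : forall i, prime (p i).
Local Notation d J := ((dprod p J)%:R : R).
Local Notation lnp i := (ln (p i)%:R : R).
Variables (l u V eta : R).
Hypothesis l_gt0 : 0 < l.
Hypothesis u_ge : 8 <= u.
Hypothesis eta_gt0 : 0 < eta.
Hypothesis V_le : V - (u + 1) <= u / 4.
Hypothesis p_le : forall i, lnp i <= l.
Hypothesis sig_le : \sum_i (p i)%:R^-1 <= 1 :> R.
Hypothesis p_ge : forall i, 3 / (p i)%:R <= eta.
Hypothesis far : forall y, expR (V * l) <= y -> `|mlogtail p y| <= l * eta.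

(** The tail at x depends only on the set of divisors exceeding x, so it takes finitely many
    values. *)
Lemma exists_max_mtail (X : R) : exists2 x, X <= x &
  forall y, X <= y -> `|mtail p y| <= `|mtail p x|.
Proof.
pose S x := [set J : {set I} | x < d J]%SET.
pose Pr (A : {set {set I}}) : bool := `[< exists2 x, X <= x & A = S x >].
pose f (A : {set {set I}}) : R := `|\sum_(J in A) (-1) ^+ #|J| / d J|.
have P0 : Pr (S X) by apply/asboolP; exists X.
have fE x : f (S x) = `|mtail p x|.
  by rewrite /f /mtail /tailsum; congr (`| _ |); apply: eq_bigl => J; rewrite inE.
have [A /asboolP[x Xx AE] Amax] := arg_maxP f P0.
exists x => // y Xy; rewrite -!fE -AE; apply: Amax.
by apply/asboolP; exists y.
Qed.

Let pR i : 0 < (p i)%:R :> R. Proof. by rewrite ltr0n prime_gt0. Qed.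
Let lnp_ge0 i : 0 <= lnp i.
Proof. by rewrite ln_ge0 // ler1n prime_gt0. Qed.

Lemma expR1_le3 : expR 1 <= 3 :> R.
Proof. by have := @expR_le_quadratic R 1 ler01 (lexx 1); rewrite expr1n; lra. Qed.

Lemma mtail_off_near i x : `|mtail_off p i x - mtail p x| <= eta.
Proof.
rewrite (mtailE p_prime i) opprB addrC subrK normrM gtr0_norm ?invr_gt0 //.
apply: le_trans (p_ge i); rewrite mulrC ler_wpM2r ?invr_ge0 ?(ltW (pR i)) //.
apply: le_trans (mtail_off_le p_prime i _) _; apply: le_trans expR1_le3.
by rewrite ler_expR.
Qed.

Lemma propagation : (exists2 x, expR ((u + 1) * l) <= x & eta <= `|mtail p x|) ->
  forall s : R, s = 1 \/ s = -1 ->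
  exists h, expR (u * l) <= h <= expR ((u + 2) * l) /\ eta <= s * mtail p h.
Proof.
move=> [x1 Xx1 hx1].
have [x Xx xmax] := exists_max_mtail (expR ((u + 1) * l)).
set B := `|mtail p x| in xmax.
have etaB : eta <= B by apply: le_trans hx1 (xmax _ Xx1).
have B0 : 0 < B by apply: lt_le_trans etaB.
have x0 : 0 < x by apply: lt_le_trans Xx; exact: expR_gt0.
have lnx : (u + 1) * l <= ln x by rewrite -[leLHS]expRK ler_ln ?posrE ?expR_gt0.
pose s0 : R := if 0 <= mtail p x then 1 else -1.
have s0B : s0 * mtail p x = B.
  by rewrite /s0 /B; case: ifP => h; [rewrite mul1r ger0_norm|rewrite mulN1r ltr0_norm // ltNge h].
have s0n : `|s0| = 1 by rewrite /s0; case: ifP => _; rewrite ?normrN normr1.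
(* Up to z^V the slope of [mlogtail] in ln x is at most [B] by maximality, over a length at most u l
   / 4; from there on [far] applies. *)
have hR : `|mlogtail p x| <= B * (u / 4 * l) + l * eta.
  pose D := Num.max x (expR (V * l)).
  have xD : x <= D by rewrite le_max lexx.
  have D0 := lt_le_trans x0 xD.
  have h1 : `|mlogtail p x - mlogtail p D| <= B * ln (D / x).
    apply: logtail_diff_norm => // w /andP[xw _]; apply: xmax.
    exact: le_trans Xx xw.
  have h2 : `|mlogtail p D| <= l * eta by apply: far; rewrite le_max lexx orbT.
  have h3 : ln (D / x) <= u / 4 * l.
    rewrite ln_div ?posrE // /D; case: (leP x (expR (V * l))) => _.
      rewrite expRK; apply: (@le_trans _ _ ((V - (u + 1)) * l)); first lra.
      by rewrite ler_wpM2r // ltW.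
    by rewrite subrr mulr_ge0 ?(ltW l_gt0) //; have := u_ge; lra.
  have -> : mlogtail p x = (mlogtail p x - mlogtail p D) + mlogtail p D by rewrite subrK.
  apply: le_trans (ler_normD _ _) (lerD _ h2); apply: le_trans h1 _.
  by rewrite ler_wpM2l // ltW.
(* A larger tail of opposite sign can only occur below z^(u + 1); as p <= z, both points then lie
   between z^u and z^(u + 2). *)
have [[i hi]|Hno] := pselect (exists i, B < - (s0 * mtail p (x / (p i)%:R))).
  have xp_lt : x / (p i)%:R < expR ((u + 1) * l).
    rewrite ltNge; apply/negP => /xmax h; move: hi; rewrite ltNge.
    rewrite (le_trans _ h) //; apply: le_trans (ler_norm _) _.
    by rewrite normrN normrM s0n mul1r.
  have plel : (p i)%:R <= expR l by rewrite -[leLHS]lnK ?posrE // ler_expR.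
  have xp_ge : expR (u * l) <= x / (p i)%:R.
    rewrite ler_pdivlMr //; apply: le_trans Xx; rewrite mulrDl mul1r expRD.
    by rewrite ler_wpM2l ?expR_ge0.
  have x_le : x <= expR ((u + 2) * l).
    have -> : (u + 2) * l = (u + 1) * l + l by ring.
    rewrite expRD -ler_pdivrMr ?expR_gt0 //; apply: le_trans (ltW xp_lt).
    by rewrite ler_wpM2l ?(ltW x0) // lef_pV2 ?posrE ?expR_gt0.
  move=> s hs; have [E|E] : s = s0 \/ s = - s0.
    by rewrite /s0; case: ifP => _; case: hs => ->; rewrite ?opprK; auto.
    exists x; rewrite E s0B x_le andbT; split => //.
    by apply: le_trans Xx; rewrite ler_expR ler_wpM2r ?(ltW l_gt0) // lerDl.
  exists (x / (p i)%:R); rewrite E xp_ge mulNr; split; last by apply: le_trans etaB (ltW hi).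
  by rewrite (le_trans (ltW xp_lt)) // ler_expR ler_wpM2r ?(ltW l_gt0) // lerD2l; lra.
(* With no such prime the identity would give (u + 1) l B <= (3 + u / 4) l B, against u >= 8. *)
exfalso.
have {}Hno i : - (s0 * mtail p (x / (p i)%:R)) <= B.
  by rewrite leNgt; apply/negP => h; apply: Hno; exists i.
have hid := mtail_identity p_prime x0.
have : ln x * B <= l * (B + eta) + `|mlogtail p x|.
  have -> : ln x * B = s0 * (- \sum_i lnp i / (p i)%:R * mtail_off p i (x / (p i)%:R)) + - (s0 * mlogtail p x).
    by rewrite -hid -s0B; ring.
  apply: lerD; last by apply: le_trans (ler_norm _) _; rewrite normrN normrM s0n mul1r.
  apply: (@le_trans _ _ (\sum_i (p i)%:R^-1 * (l * (B + eta)))).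
    rewrite mulrN mulr_sumr -sumrN; apply: ler_sum => i _.
    have h1 := Hno i; have := mtail_off_near i (x / (p i)%:R).
    set A := mtail_off _ _ _; set A' := mtail _ _ in h1 *; move=> h2.
    have h3 : - (s0 * A) <= B + eta.
      have -> : - (s0 * A) = - (s0 * A') + - (s0 * (A - A')) by ring.
      apply: lerD h1 _; apply: le_trans (ler_norm _) _.
      by rewrite normrN normrM s0n mul1r.
    have -> : - (s0 * (lnp i / (p i)%:R * A)) = (p i)%:R^-1 * (lnp i * - (s0 * A)) by ring.
    rewrite ler_wpM2l ?invr_ge0 ?(ltW (pR i)) //.
    apply: (@le_trans _ _ (lnp i * (B + eta))); first by rewrite ler_wpM2l.
    by rewrite ler_wpM2r // addr_ge0 // ltW.
  rewrite -mulr_suml -[leRHS]mul1r ler_wpM2r //.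
  by rewrite mulr_ge0 ?addr_ge0 ?(ltW l_gt0) ?(ltW B0) ?(ltW eta_gt0).
have h1 : (u + 1) * l * B <= ln x * B by rewrite ler_wpM2r // ltW.
have h2 : l * eta <= l * B by rewrite ler_wpM2l // ltW.
have lB : 0 < l * B by rewrite mulr_gt0.
have h3 : 8 * (l * B) <= u * (l * B) by rewrite ler_wpM2r // ltW.
lra.
Qed.

End Propagation.

(** * Elementary symmetric sums of reciprocals of primes *)

Section ElementarySums.
Variables (R : realType) (I : finType) (p : I -> nat).
Hypothesis p_prime : forall i, prime (p i).
Local Notation d J := ((dprod p J)%:R : R).
Local Notation lnp i := (ln (p i)%:R : R).
Let sig : R := \sum_i (p i)%:R^-1.
Let pR i : 0 < (p i)%:R :> R. Proof. by rewrite ltr0n prime_gt0. Qed.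
Let dR J : 0 < d J. Proof. exact: dprodR_gt0. Qed.

(** The elementary symmetric polynomial of degree [j] in the 1 / p. *)
Definition esum (j : nat) : R := \sum_(J : {set I} | #|J| == j) (d J)^-1.
Definition esum_ge (j : nat) : R := \sum_(J : {set I} | (j <= #|J|)%N) (d J)^-1.

Lemma esum_ge0 j : 0 <= esum j.
Proof. by apply: sumr_ge0 => J _; rewrite invr_ge0 ltW. Qed.

Lemma esum_geS j : esum_ge j = esum j + esum_ge j.+1.
Proof.
rewrite /esum_ge (bigID (fun J : {set I} => #|J| == j)) /=; congr (_ + _); apply: eq_bigl => J.
  by case: eqP => [->|_]; rewrite ?leqnn ?andbF.
by rewrite ltn_neqAle andbC eq_sym.
Qed.

Lemma esumS j : j.+1%:R * esum j.+1 =
  \sum_(J : {set I} | #|J| == j) (d J)^-1 * \sum_(i | i \notin J) (p i)%:R^-1.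
Proof.
have := exchange_setD1 (fun i J => if #|J| == j then (p i)%:R^-1 * (d J)^-1 else 0).
rewrite [X in _ = X -> _](_ : _ = \sum_(J : {set I} | #|J| == j) (d J)^-1 * \sum_(i | i \notin J) (p i)%:R^-1).
  move=> <-; rewrite /esum mulr_sumr big_mkcond /=; apply: eq_bigr => J _.
  have E i : i \in J -> (if #|J :\ i| == j then (p i)%:R^-1 * (d (J :\ i))^-1 else 0) =
     if #|J| == j.+1 then (d J)^-1 else 0.
    move=> iJ; rewrite (cardsD1 i J) iJ add1n eqSS (dprod_setD1 p iJ) natrM invfM.
    by [].
  rewrite (eq_bigr _ E); case: eqP => [Jj|_]; last by rewrite big1.
  by rewrite sumr_const Jj mulr_natl.
rewrite [RHS]big_mkcond; apply: eq_bigr => J _; case: eqP => _; last by rewrite big1.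
by rewrite mulr_sumr; apply: eq_bigr => i _; rewrite mulrC.
Qed.

Hypothesis sig_le : sig <= 1 / 4.

Lemma esumS_le j : esum j.+1 <= esum j / 4.
Proof.
have s0 : 0 <= sig by apply: sumr_ge0 => i _; rewrite invr_ge0 ltW.
have : j.+1%:R * esum j.+1 <= esum j * sig.
  rewrite esumS /esum mulr_suml; apply: ler_sum => J _.
  rewrite ler_wpM2l ?invr_ge0 ?(ltW (dR J)) // big_mkcond; apply: ler_sum => i _.
  by case: ifP => // _; rewrite invr_ge0 ltW.
have h1 : esum j.+1 <= j.+1%:R * esum j.+1.
  by rewrite -[leLHS]mul1r ler_wpM2r ?esum_ge0 // ler1n.
have h2 : esum j * sig <= esum j * (1 / 4) by rewrite ler_wpM2l ?esum_ge0.
lra.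
Qed.

Lemma esum_tail_le j : esum_ge j.+1 <= esum j / 3.
Proof.
have [m] := ubnP (#|I| - j)%N; elim: m j => // m IH j hm.
have [jI|jI] := leqP #|I| j.
  rewrite /esum_ge big_pred0 ?divr_ge0 ?esum_ge0 // => J.
  by apply/negbTE; rewrite -leqNgt (leq_trans (max_card _)).
have {}IH := IH j.+1; rewrite esum_geS.
have hS := esumS_le j.
have : esum_ge j.+2 <= esum j.+1 / 3 by apply: IH; lia.
lra.
Qed.

Variable k : nat.
Hypothesis p_large : forall i, k%:R / (p i)%:R <= sig / 2.

(** The primes excluded by [J], at most [k] in number, take away at most half of [sig]. *)
Lemma esumS_ge j : (j <= k)%N -> esum j * (sig / 2) / j.+1%:R <= esum j.+1.
Proof.
move=> jk; have j0 : 0 < j.+1%:R :> R by rewrite ltr0n.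
rewrite ler_pdivrMr // [leRHS]mulrC esumS /esum mulr_suml; apply: ler_sum => J /eqP Jj.
rewrite ler_wpM2l ?invr_ge0 ?(ltW (dR J)) //.
have -> : sig / 2 = sig - sig / 2 by field.
have -> : \sum_(i | i \notin J) (p i)%:R^-1 = sig - \sum_(i in J) (p i)%:R^-1.
  by rewrite /sig [in RHS](bigID (mem J)) /= addrAC subrr add0r.
rewrite lerD2l lerN2.
have [->|[i0 i0J]] := set_0Vmem J.
  by rewrite big_set0 divr_ge0 // sumr_ge0 // => i _; rewrite invr_ge0 ltW.
have j1 : (0 < j)%N by rewrite -Jj; apply/card_gt0P; exists i0.
have k0 : 0 < k%:R :> R by rewrite ltr0n (leq_trans j1).
apply: (@le_trans _ _ (\sum_(i in J) sig / 2 / k%:R)).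
  apply: ler_sum => i _; rewrite ler_pdivlMr // mulrC; exact: p_large.
rewrite sumr_const Jj -[leLHS]mulr_natr mulrAC ler_pdivrMr //.
have s0 : 0 <= sig / 2 by rewrite divr_ge0 // sumr_ge0 // => i _; rewrite invr_ge0 ltW.
by rewrite ler_wpM2l // ler_nat.
Qed.

Lemma esum_lower j : (j <= k.+1)%N -> (sig / 2) ^+ j / (j`!)%:R <= esum j.
Proof.
have s0 : 0 <= sig / 2 by rewrite divr_ge0 // sumr_ge0 // => i _; rewrite invr_ge0 ltW.
elim: j => [|j IH jk].
  rewrite expr0 fact0 divr1 /esum (bigD1 finset.set0) ?cards0 //=.
  by rewrite /dprod big_set0 invr1 lerDl sumr_ge0 // => J _; rewrite invr_ge0 ltW.
apply: le_trans (esumS_ge jk).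
have j0 : 0 < j.+1%:R :> R by rewrite ltr0n.
have -> : (sig / 2) ^+ j.+1 / (j.+1`!)%:R = (sig / 2) ^+ j / (j`!)%:R * (sig / 2) / j.+1%:R.
  by rewrite exprSr factS natrM invfM; ring.
by rewrite ler_pM2r ?invr_gt0 // ler_wpM2r // IH // ltnW.
Qed.

Variables (l g : R).
Hypothesis p_le : forall i, lnp i <= l.
Hypothesis p_gt : forall i, l - g < lnp i.
Hypothesis kg : k%:R * l <= k.+1%:R * (l - g).
Hypothesis l_ge0 : 0 <= l.

Lemma mtail_block : mtail p (expR (k%:R * l)) =
  \sum_(J : {set I} | (k < #|J|)%N) (-1) ^+ #|J| / d J.
Proof.
apply: eq_bigl => J; rewrite -ltr_ln ?posrE ?expR_gt0 // expRK ln_dprod //.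
have [Jk|Jk] := leqP #|J| k; last first.
  apply: le_lt_trans kg _.
  apply: (@le_lt_trans _ _ (\sum_(i in J) (l - g))).
    rewrite sumr_const -[leRHS]mulr_natl ler_wpM2r ?ler_nat //.
    have kk : 0 < k.+1%:R :> R by rewrite ltr0n.
    by rewrite -(pmulr_rge0 _ kk); apply: le_trans kg; rewrite mulr_ge0.
  have [i iJ] : exists i, i \in J by apply/card_gt0P; exact: leq_trans Jk.
  rewrite (bigD1 i) //= [ltRHS](bigD1 i) //=; apply: ltr_leD => //.
  by apply: ler_sum => i' _; rewrite ltW.
apply/negbTE; rewrite -leNgt.
apply: (@le_trans _ _ (\sum_(i in J) l)); first by apply: ler_sum => i _.
by rewrite sumr_const -[leLHS]mulr_natl ler_wpM2r // ler_nat.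
Qed.

(** The sets of exactly k + 1 primes carry the sign, and the larger sets amount to at most a third
    of them. *)
Lemma mtail_block_lower :
  (sig / 2) ^+ k.+1 / (k.+1`!)%:R / 2 <= (-1) ^+ k.+1 * mtail p (expR (k%:R * l)).
Proof.
rewrite mtail_block (bigID (fun J : {set I} => #|J| == k.+1)) /= mulrDr.
have h1 : (-1) ^+ k.+1 * \sum_(J : {set I} | (k < #|J|)%N && (#|J| == k.+1)) (-1) ^+ #|J| / d J = esum k.+1.
  rewrite mulr_sumr; apply: eq_big => [J|J /andP[_ /eqP ->]].
    by case: eqP => [->|_]; rewrite ?ltnSn ?andbF.
  by rewrite mulrA -expr2 sqrr_sign mul1r.
have h2 : `|(-1) ^+ k.+1 * \sum_(J : {set I} | (k < #|J|)%N && (#|J| != k.+1)) (-1) ^+ #|J| / d J| <= esum_ge k.+2.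
  rewrite normrM normrX normrN1 expr1n mul1r.
  apply: le_trans (ler_norm_sum _ _ _) _.
  rewrite /esum_ge le_eqVlt; apply/orP; left; apply/eqP; apply: eq_big => [J|J _].
    by rewrite [RHS]ltn_neqAle andbC eq_sym.
  exact: norm_mu.
have h3 := esum_tail_le k.+1; have h4 := esum_lower (leqnn k.+1).
move: h2; rewrite ler_norml h1 => /andP[h2 _].
have := esum_ge0 k.+1; move: h2 h3 h4.
by move: (esum _) (esum_ge _) (_ * \sum_(J | _) _) (_ ^+ _ / _) => *; lra.
Qed.

End ElementarySums.

(** * Chebyshev's bounds from central binomial coefficients *)

Section Chebyshev.
Local Open Scope nat_scope.

Definition nprimes (n : nat) : nat := count prime (iota 0 n.+1).

Lemma nprimesE n : nprimes n = size [seq q <- iota 0 n.+1 | prime q].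
Proof. by rewrite size_filter. Qed.

Lemma dvdn_prod_primes (s : seq nat) (n : nat) : uniq s -> all prime s ->
  (forall q, q \in s -> q %| n) -> \prod_(q <- s) q %| n.
Proof.
elim: s => [|a s IH] /=; first by rewrite big_nil dvd1n.
move=> /andP[as_ us] /andP[pa ps] H; rewrite big_cons Gauss_dvd.
  rewrite H ?mem_head // IH // => q qs; apply: H; by rewrite inE qs orbT.
rewrite coprime_sym big_seq; elim/big_ind: _ => [|x y cx cy|q qs].
- exact: coprime1n.
- by rewrite coprimeMl cx.
- have pq := allP ps q qs; rewrite prime_coprime // dvdn_prime2 //.
  by apply: contraNneq as_ => <-.
Qed.

Lemma prime_dvd_fact q n : prime q -> q %| n`! -> q <= n.
Proof.
move=> pq; elim: n => [|n IH]; first by rewrite fact0 dvdn1 => /eqP E; rewrite E in pq.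
rewrite factS Euclid_dvdM // => /orP[/dvdn_leq->//|/IH/leqW//].
Qed.

Lemma bin_le_pow2 n m : 'C(n, m) <= 2 ^ n.
Proof.
elim: n m => [|n IH] [|m]; rewrite ?bin0 ?expn_gt0 //.
by rewrite binS expnS mul2n -addnn leq_add.
Qed.

Lemma central_bin_mul_fact m : 'C(2 * m, m) * (m`! * m`!) = (2 * m)`!.
Proof.
have mm : m <= 2 * m by rewrite mul2n -addnn leq_addr.
by have := bin_fact mm; rewrite {2}mul2n -addnn addnK.
Qed.

Lemma pow2_le_central_bin m : 2 ^ m <= 'C(2 * m, m).
Proof.
rewrite -(leq_pmul2r (m := m`! * m`!)) ?muln_gt0 ?fact_gt0 // central_bin_mul_fact.
elim: m => [|m IH] //.
have -> : 2 * m.+1 = (2 * m).+2 by rewrite mulnS.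
rewrite !factS expnS.
have : 2 * 2 ^ m * (m.+1 * m`! * (m.+1 * m`!)) = 2 * m.+1 * m.+1 * (2 ^ m * (m`! * m`!)) by ring.
move=> ->; rewrite [leqRHS]mulnA leq_mul //; nia.
Qed.

(** The primes between m and 2m all divide the central binomial coefficient, which is at most
    2^(2m). *)
Lemma nprimes_double (m : nat) : 0 < m ->
  m ^ (nprimes (2 * m) - nprimes m) <= 2 ^ (2 * m).
Proof.
move=> m0; pose s := [seq q <- iota m.+1 m | prime q].
have ss : nprimes (2 * m) - nprimes m = size s.
  rewrite /nprimes /s size_filter mul2n -addnn -addSn iotaD count_cat add0n.
  by rewrite addKn.
rewrite ss; apply: leq_trans (bin_le_pow2 (2 * m) m).
have sm q : q \in s -> [/\ prime q, m < q & q <= 2 * m].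
  by rewrite mem_filter mem_iota => /andP[pq /andP[h1 h2]]; split => //; lia.
apply: (@leq_trans (\prod_(q <- s) q)).
  have -> : m ^ size s = \prod_(q <- s) m by rewrite big_const_seq count_predT iter_muln_1.
  rewrite !big_seq; apply: leq_prod => q /sm[_ h _]; exact: ltnW.
apply: dvdn_leq; first by rewrite bin_gt0; lia.
apply: dvdn_prod_primes; first by rewrite filter_uniq // iota_uniq.
  by apply/allP => q /sm[].
move=> q /sm[pq mq q2]; have : q %| 'C(2 * m, m) * (m`! * m`!).
  by rewrite central_bin_mul_fact dvdn_fact // q2 prime_gt0.
rewrite Euclid_dvdM // => /orP[//|]; rewrite Euclid_dvdM // orbb.
by move/(prime_dvd_fact pq); lia.
Qed.

(** In Legendre's formula each power q^k adds at most 1 to the exponent, and only if q^k <= 2m. *)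
Lemma logn_central_bin q m : prime q -> 0 < m -> q ^ logn q 'C(2 * m, m) <= 2 * m.
Proof.
move=> pq m0; have q1 := prime_gt1 pq.
have m20 : 0 < 2 * m by lia.
apply: leq_trans (_ : q ^ trunc_log q (2 * m) <= _); last by apply: trunc_logP.
rewrite leq_pexp2l ?prime_gt0 //.
have C0 : 0 < 'C(2 * m, m) by rewrite bin_gt0; lia.
have hl : logn q 'C(2 * m, m) + (logn q m`! + logn q m`!) = logn q (2 * m)`!.
  by rewrite -central_bin_mul_fact !lognM ?muln_gt0 ?fact_gt0 //.
suff : logn q (2 * m)`! <= trunc_log q (2 * m) + (logn q m`! + logn q m`!).
  by rewrite -hl leq_add2r.
have lf n : n <= 2 * m -> logn q n`! = \sum_(1 <= k < (2 * m).+1) n %/ q ^ k.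
  move=> nm; rewrite logn_fact // [RHS](@big_cat_nat _ _ _ n.+1) //=.
  rewrite [X in _ = _ + X]big_nat_cond [X in _ = _ + X]big1 ?addn0 // => k /andP[/andP[nk _] _].
  by rewrite divn_small // (leq_trans nk) // ltnW // ltn_expl.
rewrite !lf //; last by lia.
rewrite -!big_split /=.
have -> : trunc_log q (2 * m) = \sum_(1 <= k < (2 * m).+1) (k <= trunc_log q (2 * m)).
  have tl : trunc_log q (2 * m) <= 2 * m.
    by apply: ltnW; apply: leq_trans (ltn_expl _ q1) _; apply: trunc_logP.
  rewrite (@big_cat_nat _ _ _ (trunc_log q (2 * m)).+1) //=.
  rewrite [X in _ = _ + X]big_nat_cond [X in _ = _ + X]big1 ?addn0; last first.
    by move=> k /andP[/andP[h _] _]; rewrite leqNgt h.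
  rewrite big_nat_cond (eq_bigr (fun=> 1)); last by move=> k /andP[/andP[_ h] _]; rewrite -ltnS h.
  by rewrite -big_nat_cond sum_nat_const_nat subn1 muln1.
rewrite -big_split /=; apply: leq_sum => k _.
have qk : 0 < q ^ k by rewrite expn_gt0 prime_gt0.
have [h|h] := leqP k (trunc_log q (2 * m)).
  have e1 := divn_eq m (q ^ k); have h1 := ltn_pmod m qk.
  rewrite -ltnS ltn_divLR //; nia.
by rewrite divn_small // (leq_trans (trunc_log_ltn _ q1)) // leq_pexp2l // prime_gt0.
Qed.

Lemma central_bin_le_nprimes m : 0 < m -> 'C(2 * m, m) <= (2 * m) ^ nprimes (2 * m).
Proof.
move=> m0; set C := 'C(2 * m, m).
have C0 : 0 < C by rewrite bin_gt0; lia.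
rewrite {1}(prod_prime_decomp C0).
apply: (@leq_trans ((2 * m) ^ size (prime_decomp C))).
  have -> : (2 * m) ^ size (prime_decomp C) = \prod_(f <- prime_decomp C) (2 * m).
    by rewrite big_const_seq count_predT iter_muln_1.
  rewrite !big_seq; apply: leq_prod => -[q e] /mem_prime_decomp[pq e0 qe] /=.
  apply: leq_trans (logn_central_bin pq m0).
  by rewrite leq_pexp2l ?prime_gt0 // -pfactor_dvdn.
rewrite leq_pexp2l; [|lia|] => //.
have -> : size (prime_decomp C) = size (primes C) by rewrite /primes size_map.
rewrite nprimesE; apply: uniq_leq_size (primes_uniq C) _ => q.
rewrite mem_primes mem_filter mem_iota => /and3P[pq _ qC]; rewrite pq /= add0n ltnS.
by apply: (prime_dvd_fact pq); rewrite -central_bin_mul_fact dvdn_mulr.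
Qed.

End Chebyshev.

Lemma nprimes_pow2_lower k : (0 < k)%N -> (2 ^ k.-1 <= k * nprimes (2 ^ k))%N.
Proof.
case: k => // k _; have m0 : (0 < 2 ^ k)%N by rewrite expn_gt0.
have := leq_trans (pow2_le_central_bin (2 ^ k)) (central_bin_le_nprimes m0).
by rewrite -expnS -expnM leq_exp2l.
Qed.

(** The constant 6 survives the induction: doubling gives j pi(2^(j+1)) <= 8 * 2^j, and 8 (j + 1) <=
    12 j for j >= 2. *)
Lemma nprimes_pow2_upper k : (0 < k)%N -> (k * nprimes (2 ^ k) <= 6 * 2 ^ k)%N.
Proof.
elim: k => // -[_ _ //|k /(_ isT) IH _].
case: k IH => [_ //|k IH]; set j := k.+2 in IH *.
have m0 : (0 < 2 ^ j)%N by rewrite expn_gt0.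
have := nprimes_double m0; rewrite -expnM leq_exp2l // -expnS => h.
have h2 : (j * nprimes (2 ^ j.+1) <= 8 * 2 ^ j)%N.
  have : (nprimes (2 ^ j.+1) <= (nprimes (2 ^ j.+1) - nprimes (2 ^ j)) + nprimes (2 ^ j))%N.
    by lia.
  move=> h3; have e : (2 ^ j.+1 = 2 * 2 ^ j)%N by rewrite expnS.
  have : (j * nprimes (2 ^ j.+1) <= j * ((nprimes (2 ^ j.+1) - nprimes (2 ^ j)) + nprimes (2 ^ j)))%N by rewrite leq_mul2l h3 orbT.
  rewrite mulnDr; move: h IH e; move: (nprimes (2 ^ j.+1)) (nprimes (2 ^ j)) => a b.
  move: (2 ^ j.+1)%N (2 ^ j)%N => c d; lia.
have j2 : (2 <= j)%N by [].
rewrite -(leq_pmul2l (m := j)) //.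
have -> : (j * (j.+1 * nprimes (2 ^ j.+1)) = j.+1 * (j * nprimes (2 ^ j.+1)))%N by ring.
apply: leq_trans (_ : j.+1 * (8 * 2 ^ j) <= _)%N; first by rewrite leq_mul2l h2 orbT.
rewrite expnS; move: (2 ^ j)%N => x; nia.
Qed.

Lemma leq_nprimes m n : (m <= n)%N -> (nprimes m <= nprimes n)%N.
Proof.
move=> mn; rewrite /nprimes -(subnKC mn) -addSn iotaD count_cat leq_addr //.
Qed.

(** * Prime counts at real arguments *)

Section RealChebyshev.
Variable R : realType.
Implicit Types y z : R.

Lemma ln2_ge : 1 / 2 <= ln 2 :> R.
Proof. by have := @ln_succ_ge R 1 isT; rewrite ln1; lra. Qed.

Lemma ln2_le : ln 2 <= 1 :> R.
Proof. by have := @ln_succ_le R 1 isT; rewrite ln1 invr1; lra. Qed.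

Lemma dyadic y : 2 <= y -> exists k, [/\ (0 < k)%N, 2 ^+ k <= y & y < 2 ^+ k.+1].
Proof.
move=> y2; have y0 : 0 <= y by lra.
pose k := trunc_log 2 (Num.truncn y).
have t2 : (2 <= Num.truncn y)%N by rewrite truncn_ge_nat.
have t0 : (0 < Num.truncn y)%N by exact: leq_trans t2.
exists k; split.
- by rewrite /k trunc_log_gt0.
- by rewrite -natrX -truncn_ge_nat // trunc_logP.
- by rewrite -natrX -truncn_lt_nat // trunc_log_ltn.
Qed.

Lemma nprimes_upper y : 1 <= y -> (nprimes (Num.truncn y))%:R * ln y <= 12 * y.
Proof.
move=> y1; have [y2|y2] := leP 2 y; last first.
  have -> : nprimes (Num.truncn y) = 0%N.
    have : (Num.truncn y < 2)%N by rewrite truncn_lt_nat //; lra.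
    by case: (Num.truncn y) => [|[|n]].
  by rewrite mul0r; lra.
have [k [k0 h1 h2]] := dyadic y2.
have y0 : 0 < y by lra.
have hn : (nprimes (Num.truncn y) <= nprimes (2 ^ k.+1))%N.
  by apply: leq_nprimes; apply: ltnW; rewrite truncn_lt_nat ?(ltW y0) // natrX.
have hl : ln y <= k.+1%:R.
  apply: (@le_trans _ _ (ln (2 ^+ k.+1))); first by rewrite ler_ln ?posrE ?exprn_gt0 // ltW.
  rewrite lnXn // -[ln 2 *+ _]mulr_natl -[leRHS]mulr1 ler_wpM2l // ln2_le //.
have l0 : 0 <= ln y by rewrite ln_ge0.
apply: (@le_trans _ _ ((nprimes (2 ^ k.+1))%:R * k.+1%:R)).
  by apply: ler_pM => //; rewrite ler_nat.
rewrite -natrM mulnC; apply: (@le_trans _ _ (6 * 2 ^ k.+1)%:R).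
  by rewrite ler_nat nprimes_pow2_upper.
rewrite natrM natrX exprS; lra.
Qed.

Lemma nprimes_lower y : 2 <= y -> y <= (nprimes (Num.truncn y))%:R * (8 * ln y).
Proof.
move=> y2; have [k [k0 h1 h2]] := dyadic y2.
have y0 : 0 < y by lra.
have hn : (nprimes (2 ^ k) <= nprimes (Num.truncn y))%N.
  by apply: leq_nprimes; rewrite truncn_ge_nat ?(ltW y0) // natrX.
have hl : k%:R <= 2 * ln y.
  have : ln (2 ^+ k) <= ln y by rewrite ler_ln ?posrE ?exprn_gt0.
  rewrite lnXn // -[ln 2 *+ _]mulr_natl => h.
  have : k%:R * (1 / 2) <= k%:R * ln 2 :> R by rewrite ler_wpM2l // ln2_ge.
  lra.
have := nprimes_pow2_lower k0; rewrite -(ler_nat R) natrM natrX => h3.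
have h4 : 2 ^+ k.+1 = 4 * 2 ^+ k.-1 :> R by case: (k) k0 => // k' _; rewrite !exprS; ring.
apply: (@le_trans _ _ (4 * (k%:R * (nprimes (2 ^ k))%:R))); first lra.
have h5 : k%:R * (nprimes (2 ^ k))%:R <= (2 * ln y) * (nprimes (Num.truncn y))%:R :> R.
  by apply: ler_pM => //; rewrite ler_nat.
lra.
Qed.

Definition prime_list (N : nat) (P : set nat) y : seq nat :=
  [seq q <- iota 0 N.+1 | `[< P q >] && (q%:R <= y)].

Lemma finite_upto (P : set nat) y : finite_set (upto P y).
Proof.
apply: (@sub_finite_set _ _ `I_(Num.truncn `|y|).+1); last exact: finite_II.
move=> q [_ qy] /=; rewrite -(ltr_nat R); apply: le_lt_trans (truncnS_gt _).
by apply: le_trans qy _; exact: ler_norm.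
Qed.

Lemma upto_perm N (P : set nat) y : y < N.+1%:R ->
  perm_eq (fset_set (upto P y)) (prime_list N P y).
Proof.
move=> yN; apply: uniq_perm; [exact: fset_uniq|by rewrite filter_uniq // iota_uniq|move=> q].
rewrite mem_filter mem_iota add0n leq0n /= in_fset_set; last exact: finite_upto.
apply/idP/idP => [/set_mem[Pq qy]|/andP[/andP[/asboolP Pq qy] _]]; last by apply/mem_set.
by rewrite qy andbT (introT (asboolP _) Pq) /= -(ltr_nat R) (le_lt_trans qy).
Qed.

Lemma count_uptoE N (P : set nat) y : y < N.+1%:R ->
  count_upto P y = count (fun q => `[< P q >] && (q%:R <= y)) (iota 0 N.+1).
Proof.
by move=> yN; rewrite /count_upto -size_filter; exact: perm_size (upto_perm P yN).
Qed.

Lemma primepiE y : 0 <= y -> primepi y = nprimes (Num.truncn y).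
Proof.
move=> y0; rewrite /primepi (count_uptoE _ (truncnS_gt y)) /nprimes.
apply: eq_in_count => q; rewrite mem_iota add0n ltnS => /andP[_ qy].
by rewrite -truncn_ge_nat // qy andbT asboolb.
Qed.

End RealChebyshev.

(** * Reciprocals of the primes of [P] in a short block below z *)

Lemma prefix_sum (R : realType) (f : nat -> R) (M A : R) (s : seq nat) :
  0 <= M -> (forall q, q \in s -> f q <= M) -> 0 <= A -> A <= \sum_(q <- s) f q ->
  exists k, A <= \sum_(q <- take k s) f q <= A + M.
Proof.
move=> M0; elim/last_ind: s => [|s a IH] H A0 hA.
  by move: hA; rewrite big_nil => hA; exists 0%N; rewrite hA addr_ge0.
have [h|h] := leP A (\sum_(q <- s) f q).
  have [|k hk] := IH _ A0 h; first by move=> q qs; apply: H; rewrite mem_rcons inE qs orbT.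
  exists (minn k (size s)); rewrite -cats1 takel_cat ?geq_minr //.
  by rewrite take_min take_size.
exists (size (rcons s a)); rewrite take_size hA /= -cats1 big_cat big_seq1 /=.
by rewrite lerD ?(ltW h) // H // mem_rcons mem_head.
Qed.

Section ReciprocalSums.
Variable R : realType.
Variable kappa : R.
Hypothesis kappa_gt0 : 0 < kappa.
(** With this ratio and y >= K0^2, pi(y / K0) <= 24 y / (K0 ln y) is at most half of kappa y / (8 ln
    y), the lower bound for the number of elements of [P] up to y; 384 is 16 * 24. *)
Let K0 := 384 / kappa + 4.
Let Lk := ln K0.

Let K0_ge4 : 4 <= K0. Proof. by rewrite lerDr divr_ge0 ?ler0n // ltW. Qed.
Let K0_gt0 : 0 < K0. Proof. by have := K0_ge4; lra. Qed.
Let Lk_gt0 : 0 < Lk. Proof. by rewrite ln_gt0 //; have := K0_ge4; lra. Qed.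

Variables (P : set nat) (z : R).
Hypothesis P_prime : P `<=` [set q | prime q].
Hypothesis z_gt1 : 1 < z.
Let l := ln z.
Hypothesis P_dense : forall y : R, Num.sqrt z < y <= z ->
  kappa * (primepi y)%:R <= (count_upto P y)%:R.
Let N := Num.truncn z.

Let l_gt0 : 0 < l. Proof. exact: ln_gt0. Qed.
Let zN : z < N.+1%:R. Proof. exact: truncnS_gt. Qed.

Definition recip_sum (a b : R) : R :=
  \sum_(q <- iota 0 N.+1 | `[< P q >] && (a < q%:R <= b)) q%:R^-1.

Lemma recip_sum_split a b c : a <= b -> b <= c ->
  recip_sum a c = recip_sum b c + recip_sum a b.
Proof.
move=> ab bc; rewrite /recip_sum (bigID (fun q : nat => b < q%:R)) /=; congr (_ + _).
  apply: eq_bigl => q; rewrite -andbA; congr (_ && _).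
  by have [h|h] := ltP b q%:R; rewrite ?andbF ?andbT //= (le_lt_trans ab h).
apply: eq_bigl => q; rewrite -andbA; congr (_ && _); rewrite -leNgt.
by have [h|h] := leP q%:R b; rewrite ?andbF ?andbT //= (le_trans h bc) andbT.
Qed.

Lemma recip_block y : Num.sqrt z < y -> y <= z -> K0 ^+ 2 <= y ->
  kappa / (16 * l) <= recip_sum (y / K0) y.
Proof.
move=> zy yz Ky; have K00 := K0_gt0; have K4 := K0_ge4.
have y16 : 16 <= y by apply: le_trans Ky; rewrite -[16](_ : 4 ^+ 2 = 16 :> R); [rewrite ler_pXn2r // nnegrE ?ler0n // ltW|ring].
have y0 : 0 < y by lra.
have ly0 : 0 < ln y by rewrite ln_gt0 //; lra.
have hy2 : K0 <= y / K0 by rewrite ler_pdivlMr // -expr2.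
have yK1 : 1 <= y / K0 by lra.
have yK0 : 0 < y / K0 by lra.
have yKy : y / K0 <= y by rewrite ler_pdivrMr // ler_peMr ?(ltW y0) //; lra.
have cE : (count_upto P y <= nprimes (Num.truncn (y / K0)) + count (fun q => `[< P q >] && (y / K0 < q%:R <= y)%R) (iota 0 N.+1))%N.
  rewrite (@count_uptoE R N P y) ?(le_lt_trans yz) // -primepiE ?(ltW yK0) //.
  rewrite /primepi (@count_uptoE R N _ (y / K0)) ?(le_lt_trans _ zN) ?(le_trans yKy) //.
  rewrite -count_predUI; apply: leq_trans (leq_addr _ _); apply: sub_count => q /=.
  case/andP => /asboolP Pq qy; rewrite qy andbT (introT (asboolP _) Pq) /=.
  have -> : `[< prime q >] by apply/asboolP; exact: P_prime.
  by case: (leP q%:R (y / K0)).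
have hd := P_dense (introT andP (conj zy yz)).
rewrite primepiE ?(ltW y0) // in hd.
have hl := @nprimes_lower R y (le_trans _ y16).
have hu := @nprimes_upper R (y / K0) yK1.
have hlK : ln y / 2 <= ln (y / K0).
  rewrite ln_div ?posrE //.
  have : ln (K0 ^+ 2) <= ln y by rewrite ler_ln ?posrE ?exprn_gt0.
  by rewrite lnXn // mulr2n; lra.
set cnt := count _ _ in cE.
have hc : y * kappa / (16 * ln y) <= cnt%:R.
  have h1 : (count_upto P y)%:R <= (nprimes (Num.truncn (y / K0)))%:R + cnt%:R :> R.
    by rewrite -natrD ler_nat.
  have h2 : (nprimes (Num.truncn (y / K0)))%:R * (ln y / 2) <= 12 * (y / K0).
    by apply: le_trans hu; rewrite ler_wpM2l.
  have h3 : y <= (nprimes (Num.truncn y))%:R * (8 * ln y) by apply: hl; lra.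
  have h4 : 384 / K0 <= kappa.
    by rewrite ler_pdivrMr // /K0 mulrDr mulrCA divff ?gt_eqF // mulr1 lerDl mulr_ge0 // ltW.
  have h5 : kappa * y <= kappa * ((nprimes (Num.truncn y))%:R * (8 * ln y)) by rewrite ler_wpM2l // ltW.
  have h6 : kappa * (nprimes (Num.truncn y))%:R * (8 * ln y) <= ((nprimes (Num.truncn (y / K0)))%:R + cnt%:R) * (8 * ln y).
    by rewrite ler_wpM2r ?(le_trans hd) // mulr_ge0 // ltW.
  have h7 : 384 / K0 * y <= kappa * y by rewrite ler_wpM2r // ltW.
  rewrite ler_pdivrMr ?mulr_gt0 //.
  have e1 : 384 / K0 * y = 32 * (12 * (y / K0)) by field; rewrite gt_eqF.
  move: h2 h5 h6 h7; rewrite e1.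
  move: (nprimes _)%:R (nprimes _)%:R cnt%:R (12 * (y / K0)) => a b c d.
  move=> *; lra.
apply: (@le_trans _ _ (cnt%:R * y^-1)).
  apply: (@le_trans _ _ (y * kappa / (16 * ln y) * y^-1)); last by rewrite ler_wpM2r ?invr_ge0 // ltW.
  have -> : y * kappa / (16 * ln y) * y^-1 = kappa / (16 * ln y) by field; rewrite !gt_eqF.
  rewrite ler_wpM2l ?(ltW kappa_gt0) // lef_pV2 ?posrE ?mulr_gt0 // ler_wpM2l //.
  by rewrite ler_ln ?posrE // (lt_trans _ z_gt1).
rewrite /cnt -sum1_count natr_sum mulr_suml; apply: ler_sum => q /andP[_ /andP[q1 q2]].
have q0 : 0 < q%:R :> R by exact: lt_trans q1.
by rewrite mul1r lef_pV2 ?posrE.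
Qed.

Hypothesis l_ge : 4 * Lk <= l.

(** Blocks of ratio [K0] are stacked downwards from [z]; staying within a factor z^(1/4) of z keeps
    their upper ends above sqrt z, where [P] is known to be dense. *)
Lemma recip_blocks m : m%:R * Lk <= l / 4 ->
  m%:R * (kappa / (16 * l)) <= recip_sum (expR (l - m%:R * Lk)) z.
Proof.
elim: m => [_|m IH hm].
  by rewrite mul0r sumr_ge0 // => q _; rewrite invr_ge0.
have hm' : m%:R * Lk <= l / 4.
  by apply: le_trans hm; rewrite ler_wpM2r ?(ltW Lk_gt0) // ler_nat.
have z0 : 0 < z := lt_trans ltr01 z_gt1.
have lE : z = expR l by rewrite lnK ?posrE.
set y := expR (l - m%:R * Lk).
have yK : expR (l - m.+1%:R * Lk) = y / K0.
  rewrite -natr1 mulrDl mul1r opprD addrA expRB; congr (_ / _).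
  by rewrite lnK ?posrE.
have m0 : 0 <= m%:R * Lk by rewrite mulr_ge0 // ltW.
have yz : y <= z by rewrite lE ler_expR; lra.
rewrite yK (@recip_sum_split _ y) //; last first.
  by rewrite ler_pdivrMr // ler_peMr ?expR_ge0 //; have := K0_ge4; lra.
rewrite -natr1 mulrDl mul1r lerD ?IH // recip_block //.
  have -> : Num.sqrt z = expR (l / 2).
    have -> : z = expR (l / 2) ^+ 2 by rewrite -expRM_natl mulrC divfK // lE.
    by rewrite sqrtr_sqr ger0_norm // expR_ge0.
  by rewrite ltr_expR; have := l_gt0; lra.
have -> : K0 ^+ 2 = expR (2 * Lk) by rewrite expRM_natl lnK ?posrE.
by rewrite ler_expR; have := l_ge; have := Lk_gt0; lra.
Qed.

(** Rounding g / Lk down to whole blocks loses at most a factor 2, whence 32 in place of 16. *)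
Lemma recip_sum_lower g : Lk <= g -> g <= l / 4 ->
  kappa / (32 * Lk) * g / l <= recip_sum (expR (l - g)) z.
Proof.
move=> g1 g2; pose m := Num.truncn (g / Lk).
have gL : 1 <= g / Lk by rewrite ler_pdivlMr // mul1r.
have mg : m%:R <= g / Lk by rewrite truncn_le; lra.
have gm : g / Lk < m.+1%:R by exact: truncnS_gt.
have m1 : 1 <= m%:R :> R by rewrite ler1n truncn_gt0.
have mL : m%:R * Lk <= g by rewrite -ler_pdivlMr.
have h := recip_blocks (le_trans mL g2).
apply: (@le_trans _ _ (recip_sum (expR (l - m%:R * Lk)) z)); last first.
  rewrite [leRHS](@recip_sum_split _ (expR (l - m%:R * Lk))).
  - by rewrite lerDl sumr_ge0 // => q _; rewrite invr_ge0.
  - by rewrite ler_expR; lra.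
  - have -> : z = expR l by rewrite lnK ?posrE ?(lt_trans ltr01 z_gt1).
    by rewrite ler_expR; have := Lk_gt0; nra.
apply: le_trans h.
have gm2 : g / Lk <= 2 * m%:R by move: gm; rewrite -natr1; lra.
have -> : kappa / (32 * Lk) * g / l = (g / Lk) * (kappa / (32 * l)).
  by field; rewrite !gt_eqF.
have -> : m%:R * (kappa / (16 * l)) = (2 * m%:R) * (kappa / (32 * l)).
  by field; rewrite !gt_eqF.
by rewrite ler_wpM2r // divr_ge0 ?mulr_ge0 ?(ltW kappa_gt0) ?(ltW l_gt0) // ler0n.
Qed.

End ReciprocalSums.

(** * Averaging over translates *)

Definition scount (s : seq nat) (a m : nat) : nat :=
  \sum_(1 <= n < m.+1) all (fun q => ~~ (q %| a + n)%N) s.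

Lemma sum_mod_progression (F : nat -> nat) (q Q x : nat) : (0 < q)%N -> coprime Q q ->
  (\sum_(j < q) F ((x + j * Q) %% q))%N = (\sum_(j < q) F j)%N.
Proof.
move=> q0 cQ; pose h (j : 'I_q) : 'I_q := Ordinal (ltn_pmod (x + j * Q) q0).
have hinj : injective h.
  suff H (i j : 'I_q) : (i <= j)%N -> h i = h j -> i = j.
    move=> i j hij; have [ij|ij] := leqP i j; first exact: H.
    by apply/esym/H => //; exact: ltnW.
  move=> ij [] /esym /eqP; rewrite eqn_modDl eqn_mod_dvd ?leq_mul2r ?ij ?orbT //.
  rewrite -mulnBl Gauss_dvdl; last by rewrite coprime_sym.
  move=> hd; apply/val_inj/eqP; rewrite eqn_leq ij /= -subn_eq0.
  have := ltn_ord j; have lt : (j - i < q)%N by rewrite (leq_ltn_trans (leq_subr _ _)).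
  by have [//|p0] := posnP (j - i)%N; have := gtnNdvd p0 lt; rewrite hd.
by rewrite [RHS](reindex_inj hinj).
Qed.

Lemma sum_not_dvd_progression (q Q x : nat) : prime q -> coprime Q q ->
  (\sum_(j < q) ~~ (q %| x + j * Q))%N = q.-1.
Proof.
move=> pq cQ; have q0 := prime_gt0 pq.
rewrite (sum_mod_progression (fun y => ~~ (y == 0%N) : nat)) //.
case: q pq cQ q0 => // q pq cQ _; rewrite big_ord_recl /= add0n.
by rewrite (eq_bigr (fun=> 1%N)) // sum1_card card_ord.
Qed.

Lemma dvd_prod_seq (s : seq nat) q : q \in s -> (q %| \prod_(x <- s) x)%N.
Proof. by move=> qs; rewrite (big_rem q) //= dvdn_mulr. Qed.

Section Averaging.
Variable R : realType.

Lemma exists_ge_average (n : nat) (f : 'I_n -> R) (S : R) : (0 < n)%N ->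
  \sum_i f i = S * n%:R -> exists i, S <= f i.
Proof.
move=> n0 H; apply: contrapT => Hn.
have Hlt i : f i < S by rewrite ltNge; apply/negP => h; apply: Hn; exists i.
have : \sum_i f i < \sum_(i < n) S.
  rewrite (bigD1 (Ordinal n0)) //= [ltRHS](bigD1 (Ordinal n0)) //=.
  by apply: ltr_leD => //; apply: ler_sum => i _; exact: ltW.
by rewrite H sumr_const card_ord mulr_natr ltxx.
Qed.

(** Translation by multiples of [Q] leaves the sieve by [s] unchanged and runs through all residues
    mod [q]. The factor [eps] lets the same mean produce a translate above it or below it. *)
Lemma scount_add_prime (eps : R) (s : seq nat) (q a m : nat) :
  prime q -> all prime s -> q \notin s ->
  exists b, eps * (scount s a m)%:R * (1 - q%:R^-1) <= eps * (scount (q :: s) b m)%:R.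
Proof.
move=> pq ps qs; have q0 := prime_gt0 pq.
set Q := (\prod_(x <- s) x)%N.
have cQ : coprime Q q.
  rewrite /Q big_seq; elim/big_ind: _ => [|x y cx cy|x xs].
  - exact: coprime1n.
  - by rewrite coprimeMl cx.
  - have px := allP ps x xs; rewrite prime_coprime // dvdn_prime2 //.
    by apply: contraNneq qs => <-.
have tot : (\sum_(j < q) scount (q :: s) (a + j * Q) m)%N = (scount s a m * q.-1)%N.
  rewrite /scount exchange_big /= big_distrl /=; apply: eq_bigr => n _.
  rewrite -(@sum_not_dvd_progression q Q (a + n)) // big_distrr /=; apply: eq_bigr => j _.
  have -> : (a + j * Q + n = a + n + j * Q)%N by ring.
  rewrite /= -mulnb mulnC; congr (nat_of_bool _ * _)%N.
  apply: eq_in_all => x xs; congr (~~ _).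
  by rewrite dvdn_addl // dvdn_mull // dvd_prod_seq.
have q0R : 0 < q%:R :> R by rewrite ltr0n.
have [|j hj] := @exists_ge_average q (fun j => eps * (scount (q :: s) (a + j * Q) m)%:R)
    (eps * (scount s a m)%:R * (1 - q%:R^-1)) q0.
  rewrite -mulr_sumr -natr_sum tot natrM -subn1 natrB //; field; exact: lt0r_neq0.
by exists (a + j * Q)%N.
Qed.

Lemma scount_add_primes (eps : R) (s t : seq nat) (a m : nat) :
  all prime (t ++ s) -> uniq (t ++ s) ->
  exists b, eps * (scount s a m)%:R * \prod_(q <- t) (1 - q%:R^-1) <=
            eps * (scount (t ++ s) b m)%:R.
Proof.
elim: t => [|q t IH] /=; first by move=> _ _; exists a; rewrite big_nil mulr1.
move=> /andP[pq pts] /andP[qts uts]; have [b hb] := IH pts uts.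
have [b' hb'] := scount_add_prime eps b m pq pts qts.
exists b'; apply: le_trans hb'; rewrite big_cons [(1 - _) * _]mulrC mulrA.
rewrite ler_wpM2r // subr_ge0 invf_le1 ?ler1n ?ltr0n prime_gt0 //.
Qed.

Lemma scount_perm (s t : seq nat) a m : perm_eq s t -> scount s a m = scount t a m.
Proof. by move=> st; apply: eq_bigr => n _; rewrite (perm_all _ st). Qed.

(** The offset [r] decouples the length [h] from the number [m] of integer points: either may be the
    larger, by less than 1, which [deviates_trivial] exploits. *)
Lemma int_points_halfopen (a m : nat) (r h : R) (n : int) : 0 <= r -> r < 1 ->
  m%:R <= r + h -> r + h < m.+1%:R ->
  int_points `](a%:R + r), (a%:R + r + h)] n <->
  exists2 i, (0 < i <= m)%N & n = (a + i)%N%:Z.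
Proof.
move=> r0 r1 mh hm; rewrite /int_points /= in_itv /=; split.
  move=> /andP[h1 h2].
  have an : (a%:Z < n)%R.
    rewrite -(ltr_int R) -pmulrn; apply: le_lt_trans h1; by rewrite lerDl.
  have nam : (n <= (a + m)%N%:Z)%R.
    rewrite -ltzD1 -(ltr_int R) intrD -pmulrn natrD -addrA.
    by apply: le_lt_trans h2 _; rewrite -addrA ltrD2l natr1.
  case: n h1 h2 an nam => // n _ _; rewrite !ltz_nat !lez_nat => an nam.
  exists (n - a)%N; first by apply/andP; split; lia.
  by rewrite subnKC // ltnW.
move=> [i /andP[i0 im] ->]; rewrite -pmulrn natrD; apply/andP; split.
  rewrite ltrD2l; apply: lt_le_trans r1 _; by rewrite ler1n.
rewrite -addrA lerD2l; apply: le_trans mh; by rewrite ler_nat.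
Qed.

Lemma sieve_halfopen (P : set nat) (z r h : R) (a m N : nat) : 0 <= r -> r < 1 ->
  m%:R <= r + h -> r + h < m.+1%:R -> z < N.+1%:R ->
  sieve (int_points `](a%:R + r), (a%:R + r + h)]) P z = scount (prime_list N P z) a m.
Proof.
move=> r0 r1 mh hm zN; rewrite /sieve.
set A := [set n | _].
pose good i := all (fun q => ~~ (q %| a + i)%N) (prime_list N P z).
have AE n : A n <-> exists2 i, (0 < i <= m)%N && good i & n = (a + i)%N%:Z.
  have mq q : q \in prime_list N P z <-> upto P z q.
    rewrite -(perm_mem (upto_perm P zN)) in_fset_set; last exact: finite_upto.
    by split => [/set_mem|/mem_set].
  split.
    move=> [/(int_points_halfopen a n r0 r1 mh hm)[i im nE] H]; exists i => //.
    rewrite im /=; apply/allP => q /mq /H; rewrite nE => hq; apply/negP => qd; apply: hq.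
    by rewrite dvdzE /=.
  move=> [i /andP[im gi] nE]; split.
    by apply/(int_points_halfopen a n r0 r1 mh hm); exists i.
  move=> q /mq qL; rewrite nE dvdzE /=; apply/negP; exact: (allP gi).
have finA : finite_set A.
  apply: (@sub_finite_set _ _ ((fun i => (a + i)%N%:Z) @` `I_m.+1)).
    by move=> n /AE[i /andP[/andP[_ im] _] ->]; exists i.
  by apply: finite_image; exact: finite_II.
have pE : perm_eq (fset_set A) [seq (a + i)%N%:Z | i <- iota 1 m & good i].
  apply: uniq_perm; first exact: fset_uniq.
    by rewrite map_inj_uniq ?filter_uniq ?iota_uniq // => i j [] /addnI.
  move=> n; rewrite in_fset_set //; apply/idP/idP.
    move=> /set_mem /AE[i /andP[im gi] ->]; apply/mapP; exists i => //.
    by rewrite mem_filter gi mem_iota add1n ltnS.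
  move=> /mapP[i]; rewrite mem_filter mem_iota add1n ltnS => /andP[gi im] ->.
  by apply/mem_set/AE; exists i => //; rewrite im.
rewrite (perm_size pE) size_map size_filter /scount -sum1_count big_mkcond /=.
rewrite /index_iota subSS subn0; apply: eq_bigr => i _; rewrite -/(good i).
by case: (good i).
Qed.

Lemma ilength_halfopen (x h : R) : 0 < h -> ilength `]x, (x + h)] = h.
Proof.
move=> h0; rewrite /ilength lebesgue_measure_itv /= lte_fin ltrDl h0.
by rewrite -EFinB /=; ring.
Qed.

Lemma sieve_densityE (P : set nat) (z : R) N : z < N.+1%:R ->
  sieve_density P z = \prod_(q <- prime_list N P z) (1 - q%:R^-1).
Proof. by move=> zN; rewrite /sieve_density (perm_big _ (upto_perm P zN)). Qed.

(** Each prime q outside [s] multiplies the expected count and the guaranteed bound alike by 1 -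
    1/q, so the relative deviation [eta] survives. *)
Lemma interval_of_scount (P : set nat) (z : R) (s : seq nat) (r h eta eps : R) (m N : nat) :
  P `<=` [set q | prime q] -> z < N.+1%:R -> uniq s -> {subset s <= prime_list N P z} ->
  0 <= r -> r < 1 -> m%:R <= r + h -> r + h < m.+1%:R -> 0 < h ->
  eps * ((1 + eps * eta) * h * \prod_(q <- s) (1 - q%:R^-1)) <= eps * (scount s 0 m)%:R ->
  exists J : interval R, ilength J = h /\
    eps * ((1 + eps * eta) * ilength J * sieve_density P z) <= eps * (sieve (int_points J) P z)%:R.
Proof.
move=> Pp zN us sL r0 r1 mh hm h0 H; set L := prime_list N P z.
pose t := [seq q <- L | q \notin s].
have uL : uniq L by rewrite filter_uniq // iota_uniq.
have pts : perm_eq (t ++ s) L.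
  apply: uniq_perm => //.
    rewrite cat_uniq filter_uniq //= us andbT; apply/hasPn => q qs.
    by rewrite mem_filter qs.
  move=> q; rewrite mem_cat mem_filter; case: (boolP (q \in s)) => [/sL ->|_] //=.
  by rewrite orbF.
have pL : all prime L.
  by apply/allP => q; rewrite mem_filter => /andP[/andP[/asboolP /Pp]].
have [||b hb] := @scount_add_primes eps s t 0 m.
- by rewrite (perm_all _ pts).
- by rewrite (perm_uniq pts).
exists `](b%:R + r), (b%:R + r + h)]; split; first exact: ilength_halfopen.
rewrite ilength_halfopen // (sieve_halfopen P b r0 r1 mh hm zN) (sieve_densityE P zN).
rewrite -/L -(scount_perm b m pts); apply: le_trans hb.
rewrite -(perm_big _ pts) big_cat /= [X in _ * X]mulrC mulrA.
apply: le_trans (_ : eps * ((1 + eps * eta) * h * \prod_(q <- s) (1 - q%:R^-1)) * \prod_(q <- t) (1 - q%:R^-1) <= _).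
  by rewrite le_eqVlt; apply/orP; left; apply/eqP; ring.
rewrite ler_wpM2r // big_seq prodr_ge0 // => q; rewrite mem_filter => /andP[_ /(allP pL) pq].
by rewrite subr_ge0 invf_le1 ?ler1n ?ltr0n prime_gt0.
Qed.

End Averaging.

(** * Lists of primes as indexed families *)

Section PrimeSequence.
Variables (R : realType) (s : seq nat).
Hypotheses (s_prime : all prime s) (s_uniq : uniq s).

Definition pseq (i : 'I_(size s)) : nat := nth 0%N s i.

Lemma pseq_mem i : pseq i \in s. Proof. exact: mem_nth. Qed.

Lemma pseq_prime i : prime (pseq i).
Proof. exact: (allP s_prime) (pseq_mem i). Qed.

Lemma pseq_inj : injective pseq.
Proof. by move=> i j /eqP; rewrite nth_uniq // => /eqP /val_inj. Qed.

Lemma sum_pseq (f : nat -> R) : \sum_i f (pseq i) = \sum_(q <- s) f q.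
Proof. by rewrite (big_nth 0%N) big_mkord. Qed.

Lemma prod_pseq (f : nat -> R) : \prod_i f (pseq i) = \prod_(q <- s) f q.
Proof. by rewrite (big_nth 0%N) big_mkord. Qed.

Lemma scount_pseq m : scount s 0 m = ncount pseq m.
Proof.
apply: eq_bigr => n _; rewrite add0n; congr nat_of_bool.
apply/allP/forallP => [H i|H q qs]; first exact/H/pseq_mem.
have qi : (index q s < size s)%N by rewrite index_mem.
by have := H (Ordinal qi); rewrite /pseq /= nth_index.
Qed.

Lemma card_pseq_le (y : R) : 0 <= y ->
  (#|[set i | ((pseq i)%:R <= y)%R]%SET| <= nprimes (Num.truncn y))%N.
Proof.
move=> y0; rewrite nprimesE.
have -> : #|[set i | ((pseq i)%:R <= y)%R]%SET| = size [seq q <- s | (q%:R <= y)%R].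
  rewrite -sum1_card (eq_bigl (fun i => (pseq i)%:R <= y)) => [|i]; last by rewrite inE.
  rewrite size_filter -sum1_count (big_nth 0%N) big_mkord; by [].
apply: uniq_leq_size; first exact: filter_uniq.
move=> q; rewrite !mem_filter mem_iota => /andP[qy qs].
by rewrite (allP s_prime) //= add0n ltnS truncn_ge_nat.
Qed.

End PrimeSequence.

(** As soon as the set is nonempty, ln y >= l / 2, and Chebyshev's 12 y / ln y becomes 24 y / l. *)
Lemma card_pseq_linear (R : realType) (s : seq nat) (l : R) : 0 < l -> all prime s -> uniq s ->
  (forall q, q \in s -> l / 2 <= ln q%:R) ->
  forall y : R, 0 < y -> #|[set i | ((@pseq s i)%:R <= y)%R]%SET|%:R <= 24 / l * y.
Proof.
move=> l0 sp su sl y y0; have [i0 hi0|no] := pickP (fun i => (@pseq s i)%:R <= y); last first.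
  rewrite eq_card0; last by move=> i; rewrite inE no.
  by rewrite !mulr_ge0 ?invr_ge0 ?ler0n ?(ltW l0) ?(ltW y0).
have q0 : 0 < (@pseq s i0)%:R :> R by rewrite ltr0n prime_gt0 // pseq_prime.
have ly : l / 2 <= ln y.
  by apply: le_trans (sl _ (pseq_mem i0)) _; rewrite ler_ln ?posrE.
have y1 : 1 <= y.
  rewrite leNgt; apply/negP => y1; have := ln_le0 (ltW y1); lra.
apply: (@le_trans _ _ (nprimes (Num.truncn y))%:R); first by rewrite ler_nat card_pseq_le // ltW.
have h := nprimes_upper y1.
have n0 : 0 <= (nprimes (Num.truncn y))%:R :> R by [].
rewrite mulrAC ler_pdivlMr //.
have : (nprimes (Num.truncn y))%:R * (l / 2) <= (nprimes (Num.truncn y))%:R * ln y by rewrite ler_wpM2l.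
lra.
Qed.

(** * Choice of the parameters for large u *)

Section ParameterChoice.
Variables (R : realType) (kappa Dc : R).
Hypotheses (kappa_gt0 : 0 < kappa) (Dc_ge0 : 0 <= Dc).
Let c1 : R := ln (384 / kappa + 4).
Let K2 : R := (96 / kappa + 1) * expR (2 * c1).
Definition Lmin : R := 768 * c1 + 48 + 2 * ln K2.
Definition lmin : R := 2500 + 25 * (ln K2 + Dc) + 4 * c1.

Lemma c1_ge1 : 1 <= c1.
Proof.
have h0 : 0 <= 384 / kappa by rewrite mulr_ge0 ?invr_ge0 ?(ltW kappa_gt0) ?ler0n.
have h4 : ln 4 <= c1.
  by rewrite /c1; move: h0; move: (384 / kappa) => x x0; rewrite ler_ln ?posrE //; lra.
have h2 : ln 4 = 2 * ln 2 :> R.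
  by rewrite (_ : 4 = 2 ^+ 2 :> R); [rewrite lnXn // -[ln 2 *+ 2]mulr_natl|ring].
by have := ln2_ge R; lra.
Qed.

Lemma K2_ge : expR (2 * c1) <= K2.
Proof. by rewrite /K2 ler_peMl ?expR_ge0 // lerDr divr_ge0 ?ler0n // ltW. Qed.

Lemma lnK2_ge0 : 0 <= ln K2.
Proof.
apply: ln_ge0; apply: le_trans K2_ge; rewrite -[leLHS]expR0 ler_expR.
by have := c1_ge1; lra.
Qed.

Lemma ln_le_half (x : R) : 24 <= x -> ln x <= x / 2.
Proof.
move=> x24; have x0 : 0 < x by lra.
rewrite -[leRHS]expRK ler_ln ?posrE ?expR_gt0 //.
have := @expR_ge1Dxn R (x / 2) 1; rewrite (_ : 2`!%:R = 2) // => h.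
by apply: le_trans (h _); nra.
Qed.

Lemma expR_ge_cube (x : R) : 24 <= x -> x ^+ 3 <= expR x.
Proof.
move=> x24; have := @expR_ge1Dxn R x 3; rewrite (_ : 4`!%:R = 24) // => h.
apply: le_trans (h _); last lra.
have x3 : 0 <= x ^+ 3 by rewrite exprn_ge0 //; lra.
have : 24 * x ^+ 3 <= x * x ^+ 3 by rewrite ler_wpM2r.
rewrite [x ^+ 4]exprS; lra.
Qed.

Variables (P : set nat) (z u : R).
Hypothesis P_prime : P `<=` [set q | prime q].
Hypothesis P_dense : forall y : R, Num.sqrt z < y <= z ->
  kappa * (primepi y)%:R <= (count_upto P y)%:R.
Let l := ln z.
Let L := ln u.
Let N := Num.truncn z.
Hypothesis l_ge : lmin <= l.
Hypothesis L_ge : Lmin <= L.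
Hypothesis L_le : L <= l / 2 + Dc.
Hypothesis u_gt0 : 0 < u.
Hypothesis z_gt0 : 0 < z.

(** Thus e^xi = K2 u ln u. The reciprocals of the block sum to at least kappa / (32 ln u), so the
    p^(-s0) reach 3 u >= u (1 + lam): hence 96 = 3 * 32 in [K2], whose factor e^(2 c1) pays for the
    primes with ln p < l. *)
Definition choice_xi : R := ln K2 + L + ln L.
(** The block has logarithmic width lam l / 16 = c1 l / ln u, which is at least [c1], as
    [recip_sum_lower] asks, because ln u <= l; and xi lam stays bounded. *)
Definition choice_lam : R := 16 * c1 / L.
Let xi := choice_xi.
Let lam := choice_lam.

Let c1g := c1_ge1.
Let k2g := lnK2_ge0.

Lemma choice_L_ge : 768 <= L /\ 768 * c1 <= L.
Proof. by have := L_ge; rewrite /Lmin; have := c1g; have := k2g; split; lra. Qed.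

Lemma choice_l_ge : 2500 <= l.
Proof. by have := l_ge; rewrite /lmin; have := c1g; have := k2g; have := Dc_ge0; lra. Qed.

Let Lg : 768 <= L. Proof. by case: choice_L_ge. Qed.
Let Lc : 768 * c1 <= L. Proof. by case: choice_L_ge. Qed.
Let lg : 2500 <= l. Proof. exact: choice_l_ge. Qed.
Let L0 : 0 < L. Proof. by have := Lg; lra. Qed.
Let l0 : 0 < l. Proof. by have := lg; lra. Qed.
Let lnL_half : ln L <= L / 2. Proof. by apply: ln_le_half; have := Lg; lra. Qed.
Let lnL_ge0 : 0 <= ln L. Proof. by apply: ln_ge0; have := Lg; lra. Qed.
Let uE : u = expR L. Proof. by rewrite lnK ?posrE. Qed.

Lemma choice_L_le : L <= l.
Proof. by have := L_le; have := l_ge; rewrite /lmin; have := c1g; have := k2g; have := Dc_ge0; lra. Qed.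

Lemma choice_xi_ge : 48 <= xi.
Proof. by rewrite /xi /choice_xi; have := Lg; have := lnL_ge0; have := k2g; lra. Qed.

Lemma choice_xi_le2 : xi <= 2 * L.
Proof. by have := L_ge; rewrite /Lmin /xi /choice_xi; have := lnL_half; have := k2g; have := c1g; lra. Qed.

Lemma ln_le_hundredth (x : R) : 2500 <= x -> ln x <= x / 100.
Proof.
move=> x2; have x0 : 0 < x by lra.
rewrite -[leRHS]expRK ler_ln ?posrE ?expR_gt0 //.
have h24 : 24 <= x / 100 by lra.
apply: le_trans (expR_ge_cube h24).
have -> : (x / 100) ^+ 3 = x * (x / 1000) ^+ 2 by field.
by rewrite ler_peMr ?(ltW x0) //; nra.
Qed.

(** On top of l / 2, the constants ln K2 + Dc take at most l / 25 and ln ln u at most l / 100. *)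
Lemma choice_xi_le : xi <= 11 / 20 * l.
Proof.
have hl : ln L <= l / 100.
  apply: (@le_trans _ _ (ln l)); last exact: ln_le_hundredth.
  by rewrite ler_ln ?posrE // choice_L_le.
have := L_le; have := l_ge; rewrite /lmin /xi /choice_xi.
by have := c1g; have := k2g; have := Dc_ge0; lra.
Qed.

Lemma choice_lam_gt0 : 0 < lam.
Proof. by rewrite /lam /choice_lam divr_gt0 // mulr_gt0 //; have := c1g; lra. Qed.

Lemma choice_lam_le : lam <= 1 / 48.
Proof. by rewrite /lam /choice_lam ler_pdivrMr //; have := Lc; lra. Qed.

Lemma choice_lamE : lam * L = 16 * c1.
Proof. by rewrite /lam /choice_lam divfK // gt_eqF. Qed.

Lemma choice_u_ge : L ^+ 3 <= u.
Proof. by rewrite uE; apply: expR_ge_cube; have := Lg; lra. Qed.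

Lemma choice_u_geL : 768 <= u /\ L <= u.
Proof.
have h := choice_u_ge; have hL := Lg.
have : L <= L ^+ 3 by rewrite exprS ler_peMr ?(ltW L0) //; nra.
by split; lra.
Qed.

Lemma choice_ulam : 4 <= u * lam.
Proof.
have [_ h] := choice_u_geL.
apply: (@le_trans _ _ (L * lam)); last by rewrite ler_wpM2r // ltW // choice_lam_gt0.
by rewrite mulrC choice_lamE; have := c1g; lra.
Qed.

(** As lam ln u is constant and u >= (ln u)^3, the exponent is at least 32 ln u, whose exponential
    beats a left-hand side of order (ln u)^2. *)
Lemma choice_growth : 768 * xi / lam <= expR (u * lam ^+ 2 / 8).
Proof.
have hx := choice_xi_le2; have lam0 := choice_lam_gt0; have hE := choice_lamE.
rewrite ler_pdivrMr //.
have h1 : 32 * L <= u * lam ^+ 2 / 8.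
  have : L ^+ 3 * lam ^+ 2 <= u * lam ^+ 2 by rewrite ler_wpM2r ?sqr_ge0 // choice_u_ge.
  have -> : L ^+ 3 * lam ^+ 2 = L * (lam * L) ^+ 2 by ring.
  rewrite hE; have : L * 1 <= L * c1 ^+ 2.
    by rewrite ler_wpM2l ?(ltW L0) //; have := c1g; nra.
  by rewrite exprMn; move=> h2 h3; lra.
have h24 : 24 <= 32 * L by have := Lg; lra.
have h2 : (32 * L) ^+ 3 <= expR (u * lam ^+ 2 / 8).
  by apply: le_trans (expR_ge_cube h24) _; rewrite ler_expR.
have h3 : (32 * L) ^+ 3 * lam <= expR (u * lam ^+ 2 / 8) * lam by rewrite ler_wpM2r // ltW.
apply: le_trans h3.
pose y := 32 * L.
have -> : y ^+ 3 * lam = y ^+ 2 * (32 * (lam * L)) by rewrite /y; ring.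
rewrite hE; have hL := Lg; have hc := c1g.
apply: (@le_trans _ _ (y * 48)); first by rewrite /y; lra.
rewrite expr2 -mulrA ler_wpM2l //; first by rewrite /y; lra.
have : 1 * 48 <= y * (32 * (16 * c1)) by apply: ler_pM => //; rewrite /y; lra.
by rewrite mul1r.
Qed.

Let s0 := 1 - xi / l.

Lemma choice_term_le (x : R) : (1 - lam / 16) * l <= x ->
  expR (- s0 * x) <= lam ^+ 2 / 32.
Proof.
move=> hx.
have lam0 := choice_lam_gt0; have laml := choice_lam_le.
have h1 : (2 / 5) * l <= s0 * x.
  have hs : 9 / 20 <= s0.
    have : xi / l <= 11 / 20 by rewrite ler_pdivrMr // choice_xi_le.
    by rewrite /s0; lra.
  have hx2 : (8 / 9) * l <= x by apply: le_trans hx; have := l0; nra.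
  apply: (@le_trans _ _ (9 / 20 * (8 / 9 * l))); first lra.
  have l00 := l0.
  by apply: ler_pM => //; lra.
apply: (@le_trans _ _ (expR (- (2 / 5 * l)))).
  by rewrite mulNr ler_expR lerN2.
have hl := lg; have h24 : 24 <= 2 / 5 * l by lra.
have h2 := expR_ge_cube h24.
rewrite expRN.
have h3 : 8 / l ^+ 2 <= lam ^+ 2 / 32.
  have hE := choice_lamE; have hLl := choice_L_le.
  have -> : lam ^+ 2 / 32 = 8 * (c1 / L) ^+ 2.
    by rewrite /lam /choice_lam; field; rewrite gt_eqF.
  have hc := c1g; have cL : l^-1 <= c1 / L.
    apply: (@le_trans _ _ L^-1); first by rewrite lef_pV2 ?posrE.
    by rewrite ler_peMl // invr_ge0 ltW.
  rewrite -exprVn; apply: ler_wpM2l => //; rewrite ler_pXn2r // nnegrE.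
    by rewrite invr_ge0 ltW.
  by apply: le_trans cL; rewrite invr_ge0 ltW.
apply: le_trans h3; rewrite -[8 / _]invrK invf_div lef_pV2 ?posrE ?expR_gt0 ?divr_gt0 ?exprn_gt0 //.
apply: le_trans h2.
have -> : (2 / 5 * l) ^+ 3 = l ^+ 2 * (8 / 125 * l) by field.
have : l ^+ 2 * (1 / 8) <= l ^+ 2 * (8 / 125 * l) by rewrite ler_wpM2l ?sqr_ge0 //; lra.
by lra.
Qed.

Lemma choice_expR_xi : expR xi = K2 * u * L.
Proof.
have K20 : 0 < K2 by apply: lt_le_trans K2_ge; exact: expR_gt0.
by rewrite /xi /choice_xi !expRD !lnK ?posrE.
Qed.

Lemma choice_xi_lam : xi * (lam / 16) <= 2 * c1.
Proof.
have hx := choice_xi_le2; have lam0 := choice_lam_gt0; have hE := choice_lamE.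
have : xi * lam <= 2 * L * lam by rewrite ler_wpM2r // ltW.
lra.
Qed.

(** Only a prefix of the block is kept, since the two Rankin products need the sum of the p^(-s0)
    bounded on both sides near u (1 + lam); single terms being at most 1, the overshoot is at most
    1. *)
Lemma choice_sequence : exists s : seq nat,
  [/\ uniq s, all prime s, {subset s <= prime_list N P z},
      (forall q, q \in s -> (1 - lam / 16) * l <= ln q%:R <= l) &
      u * (1 + lam) <= \sum_(q <- s) expR (- s0 * ln q%:R) <= u * (1 + lam) + 1].
Proof.
have lam0 := choice_lam_gt0; have laml := choice_lam_le; have hE := choice_lamE.
have zE : z = expR l by rewrite lnK ?posrE.
have z1 : 1 < z by rewrite zE expR_gt1.
pose g := lam / 16 * l.
have g1 : c1 <= g.
  have -> : g = c1 * (l / L) by rewrite /g /lam /choice_lam; field; rewrite gt_eqF.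
  rewrite ler_peMr //; first by have := c1g; lra.
  by rewrite ler_pdivlMr // mul1r choice_L_le.
have g4 : g <= l / 4 by rewrite /g; have := l0; nra.
have l4 : 4 * c1 <= l by have := l_ge; rewrite /lmin; have := k2g; have := Dc_ge0; lra.
have hsum := recip_sum_lower kappa_gt0 P_prime z1 P_dense l4 g1 g4.
pose s1 := [seq q <- iota 0 N.+1 | `[< P q >] && (expR (l - g) < q%:R <= z)].
have s1P q : q \in s1 -> [/\ P q, prime q, expR (l - g) < q%:R & q%:R <= z].
  by rewrite mem_filter => /andP[/andP[/asboolP Pq /andP[h1 h2]] _]; split => //; exact: P_prime.
have s1ln q : q \in s1 -> (1 - lam / 16) * l <= ln q%:R <= l.
  move=> /s1P[_ _ h1 h2]; have q0 : 0 < q%:R :> R by apply: lt_trans h1; exact: expR_gt0.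
  apply/andP; split; last by rewrite ler_ln ?posrE.
  have -> : (1 - lam / 16) * l = l - g by rewrite /g; ring.
  by rewrite -[leLHS]expRK ler_ln ?posrE ?expR_gt0 // ltW.
have u0 := u_gt0; have hc := c1g.
have tot : u * (1 + lam) <= \sum_(q <- s1) expR (- s0 * ln q%:R).
  apply: (@le_trans _ _ (3 * u)); first by nra.
  apply: (@le_trans _ _ (expR (xi * (1 - lam / 16)) * (recip_sum P z (expR (l - g)) z))); last first.
    rewrite /recip_sum -big_filter mulr_sumr big_seq [leRHS]big_seq; apply: ler_sum => q qs.
    have /andP[h1 h2] := s1ln q qs; have [_ pq _ _] := s1P q qs.
    have q0 : 0 < q%:R :> R by rewrite ltr0n prime_gt0.
    have -> : - s0 * ln q%:R = xi / l * ln q%:R - ln q%:R by rewrite /s0; ring.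
    rewrite expRB lnK ?posrE // ler_wpM2r ?invr_ge0 ?(ltW q0) // ler_expR.
    have -> : xi * (1 - lam / 16) = xi / l * ((1 - lam / 16) * l) by field; rewrite gt_eqF.
    by rewrite ler_wpM2l // divr_ge0 ?(ltW l0) //; have := choice_xi_ge; lra.
  have hx : K2 * u * L * expR (- (2 * c1)) <= expR (xi * (1 - lam / 16)).
    rewrite -choice_expR_xi -expRD ler_expR; have := choice_xi_lam; lra.
  have r0 : 0 <= kappa / (32 * c1) * g / l.
    have g0 : 0 <= g by lra.
    have c0 : 0 <= c1 by lra.
    apply: divr_ge0; last exact: ltW.
    apply: mulr_ge0 => //; apply: divr_ge0; first exact: ltW.
    by apply: mulr_ge0.
  have e0 : 0 <= K2 * u * L * expR (- (2 * c1)).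
    have K20 : 0 <= K2 by apply: le_trans K2_ge; exact: expR_ge0.
    apply: mulr_ge0; last exact: expR_ge0.
    by apply: mulr_ge0; [apply: mulr_ge0 => //; exact: ltW|exact: ltW].
  apply: le_trans (ler_pM e0 r0 hx hsum).
  have c1n : c1 != 0 by rewrite gt_eqF //; lra.
  have -> : K2 * u * L * expR (- (2 * c1)) * (kappa / (32 * c1) * g / l) =
     u * ((96 / kappa + 1) * kappa / 32) * (lam * L / (16 * c1)).
    have e2 : expR (2 * c1) != 0 by rewrite gt_eqF // expR_gt0.
    have ln0 : l != 0 by rewrite gt_eqF.
    have kn0 : kappa != 0 by rewrite gt_eqF.
    by rewrite /K2 expRN /g; field; rewrite e2 ln0 kn0 c1n.
  rewrite hE divff ?mulr1; last by rewrite mulf_neq0.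
  have -> : (96 / kappa + 1) * kappa / 32 = 3 + kappa / 32 by field; rewrite gt_eqF.
  have k0 := kappa_gt0; nra.
have [||k hk] := @prefix_sum R (fun q => expR (- s0 * ln q%:R)) 1 (u * (1 + lam)) s1 ler01 _ _ tot.
- move=> q /s1ln /andP[h _]; apply: le_trans (choice_term_le h) _; nra.
- by rewrite mulr_ge0 ?(ltW u0) //; lra.
exists (take k s1); split => //.
- by rewrite take_uniq // filter_uniq // iota_uniq.
- by apply/allP => q /mem_take /s1P[].
- move=> q /mem_take; rewrite !mem_filter => /andP[/andP[-> /andP[_ ->]] ->] //.
- by move=> q /mem_take /s1ln.
Qed.

End ParameterChoice.

(** * From counts to intervals *)

Section Intervals.
Variable R : realType.
Implicit Types (P : set nat) (z u h eta eps : R).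

(** Both inequalities of the theorem in one form: eps = 1 asks for an excess, eps = -1 for a
    deficit. *)
Definition deviates P z eps eta (J : interval R) : Prop :=
  eps * ((1 + eps * eta) * ilength J * sieve_density P z) <=
  eps * (sieve (int_points J) P z)%:R.

(** The density being at most 1, a deviation of eta h in absolute terms is more than enough for the
    relative deviation [eta]. *)
Lemma deviates_of_ncount P z (s : seq nat) h eta eps :
  P `<=` [set q | prime q] -> uniq s -> all prime s ->
  {subset s <= prime_list (Num.truncn z) P z} -> 0 < h -> 0 <= eta ->
  eps = 1 \/ eps = -1 ->
  eta * h <= eps * ((ncount (@pseq s) (Num.truncn h))%:R - h * density R (@pseq s)) ->
  exists J, ilength J = h /\ deviates P z eps eta J.
Proof.
move=> Pp us ps sL h0 eta0 eps1 H.
have hh : (Num.truncn h)%:R <= 0 + h by rewrite add0r truncn_le ltW.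
have hh' : 0 + h < (Num.truncn h).+1%:R by rewrite add0r truncnS_gt.
apply: (interval_of_scount Pp (truncnS_gt z) us sL (lexx 0) ltr01 hh hh' h0).
rewrite scount_pseq -(prod_pseq s (fun q => 1 - q%:R^-1)) -/(density R (@pseq s)).
have d1 := density_le1 R (pseq_prime ps).
set d := density R _ in H d1 *; set c := _%:R in H *.
have hd : eta * h * d <= eta * h by rewrite ler_piMr // mulr_ge0 // ltW.
have e2 : eps * eps = 1 by case: eps1 => ->; ring.
have -> : eps * ((1 + eps * eta) * h * d) = eps * (h * d) + (eps * eps) * (eta * h * d) by ring.
by rewrite e2 mul1r; move: H; rewrite mulrBr; lra.
Qed.

(** Before any sieving, ]1/2, k + 1] holds k + 1 integers and ]0, k + 1/2] holds k, against a length
    k + 1/2; the relative gap is 1 / (2k + 1). *)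
Lemma deviates_trivial P z eps (k : nat) : P `<=` [set q | prime q] ->
  eps = 1 \/ eps = -1 ->
  exists J, ilength J = k%:R + 1 / 2 /\ deviates P z eps (k.*2.+1%:R^-1) J.
Proof.
move=> Pp eps1; set eta := k.*2.+1%:R^-1.
have k0 : 0 <= k%:R :> R by [].
have etaE : eta * (k%:R + 1 / 2) = 1 / 2.
  have -> : k%:R + 1 / 2 = k.*2.+1%:R / 2 :> R.
    by rewrite -[k.*2.+1%:R]natr1 -mul2n natrM; field.
  by rewrite /eta mulrA mulVf ?pnatr_eq0 // mul1r.
have sc m : scount [::] 0 m = m by rewrite /scount sum_nat_const_nat subn1 muln1.
have s0 : {subset [::] <= prime_list (Num.truncn z) P z} by [].
have h0 : 0 < k%:R + 1 / 2 :> R by lra.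
have k1 : k.+1%:R = k%:R + 1 :> R by rewrite natr1.
have k2 : k.+2%:R = k%:R + 1 + 1 :> R by rewrite !natr1.
case: eps1 => ->.
  by apply: (interval_of_scount (r := 1 / 2) (m := k.+1) Pp (truncnS_gt z) _ s0) => //;
    rewrite ?sc ?big_nil ?k2 ?k1; lra.
by apply: (interval_of_scount (r := 0) (m := k) Pp (truncnS_gt z) _ s0) => //;
  rewrite ?sc ?big_nil ?k1; lra.
Qed.

(** 73 = 1 + 24 * 3: the divisor 1 costs 1 <= h / l, and the others 24 / l from [card_pseq_linear]
    times 3 >= e. *)
Lemma ncount_mtail_error (s : seq nat) (l h : R) : 0 < l -> l <= h ->
  all prime s -> uniq s -> (forall q, q \in s -> l / 2 <= ln q%:R) ->
  \sum_(q <- s) q%:R^-1 <= 1 :> R ->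
  `|(ncount (@pseq s) (Num.truncn h))%:R - h * density R (@pseq s) + h * mtail (@pseq s) h| <=
  73 / l * h.
Proof.
move=> l0 lh ps us sl s1; have h0 := lt_le_trans l0 lh.
have pp := pseq_prime ps; have pi := @pseq_inj s us.
apply: le_trans (ncount_mtail pp pi h0) _.
have K0 : 0 <= 24 / l by rewrite divr_ge0 // ltW.
apply: le_trans (card_dprod_le pp h0 K0 (card_pseq_linear l0 ps us sl)) _.
rewrite (sum_pseq s (fun q => q%:R^-1)).
have hl : 1 <= h / l by rewrite ler_pdivlMr // mul1r.
have : 24 / l * h * expR (\sum_(q <- s) q%:R^-1) <= 24 / l * h * 3.
  apply: ler_wpM2l; first by rewrite mulr_ge0 // ltW.
  by apply: le_trans (expR1_le3 R); rewrite ler_expR.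
lra.
Qed.

Lemma powR_expR z u : 0 < z -> z `^ u = expR (u * ln z).
Proof. by move=> z0; rewrite /powR gt_eqF. Qed.

End Intervals.

(** * Large u without control of the length *)

Section MainRegime.
Variables (R : realType) (kappa Dc : R).
Hypotheses (kappa_gt0 : 0 < kappa) (Dc_ge0 : 0 <= Dc).
Variables (P : set nat) (z u : R).
Hypothesis P_prime : P `<=` [set q | prime q].
Hypothesis P_dense : forall y : R, Num.sqrt z < y <= z ->
  kappa * (primepi y)%:R <= (count_upto P y)%:R.
Let l := ln z.
Let L := ln u.
Hypothesis l_ge : lmin kappa Dc <= l.
Hypothesis L_ge : Lmin kappa <= L.
Hypothesis L_le : L <= l / 2 + Dc.
Hypothesis u_gt0 : 0 < u.
Hypothesis z_gt0 : 0 < z.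
Let xi := choice_xi kappa u.
Let lam := choice_lam kappa u.

Definition choice_eta : R := expR (- (xi * (u * (1 + 3 * lam)))).

Lemma choice_discrepancy : exists s : seq nat,
  [/\ uniq s /\ all prime s, {subset s <= prime_list (Num.truncn z) P z},
      (forall q, q \in s -> (1 - lam / 16) * l <= ln q%:R <= l),
      \sum_(q <- s) expR (- (1 - xi / l) * ln q%:R) <= 2 * u /\
      \sum_(q <- s) q%:R^-1 <= 1 :> R &
      forall eps : R, eps = 1 \/ eps = -1 -> exists n : nat,
         [/\ (0 < n)%N, u * l <= ln n%:R &
           choice_eta * n%:R <= eps * discrepancy R (@pseq s) n]].
Proof.
have [s [us ps sL sln sa]] := choice_sequence kappa_gt0 Dc_ge0 P_prime P_dense l_ge L_ge L_le u_gt0 z_gt0.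
have [u768 Lu] := choice_u_geL kappa_gt0 L_ge u_gt0.
have lam0 : 0 < lam := choice_lam_gt0 kappa_gt0 L_ge.
have laml : lam <= 1 / 48 := choice_lam_le kappa_gt0 L_ge.
have lg : 2500 <= l := choice_l_ge kappa_gt0 Dc_ge0 l_ge.
have xg : 48 <= xi := choice_xi_ge kappa_gt0 L_ge.
have [Lg _] := choice_L_ge kappa_gt0 L_ge.
have l0 : 0 < l by lra.
move: sa => /andP[sa1 sa2].
have sa3 : \sum_(q <- s) expR (- (1 - xi / l) * ln q%:R) <= 2 * u.
  by apply: le_trans sa2 _; rewrite -/lam; nra.
exists s; split => //; first split => //.
  (* Since 1 / p = p^(-s0) p^(-xi / l) and p^(-xi / l) <= e^(2 c1 - xi) <= 1 / (u ln u), the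
     reciprocals sum to at most 2 / ln u. *)
  apply: (@le_trans _ _ (\sum_(q <- s) expR (- (1 - xi / l) * ln q%:R) * expR (- (xi * (1 - lam / 16))))).
    rewrite big_seq [leRHS]big_seq; apply: ler_sum => q qs.
    have /andP[h1 h2] := sln q qs.
    have q0 : 0 < q%:R :> R by rewrite ltr0n prime_gt0 // (allP ps).
    rewrite -expRD -[q%:R in leLHS]lnK ?posrE // -expRN ler_expR.
    have : xi / l * ((1 - lam / 16) * l) <= xi / l * ln q%:R.
      by rewrite ler_wpM2l // divr_ge0 ?(ltW l0) //; lra.
    have -> : xi / l * ((1 - lam / 16) * l) = xi * (1 - lam / 16) by field; rewrite gt_eqF.
    lra.
  rewrite -mulr_suml.
  have hx := choice_expR_xi kappa_gt0 L_ge u_gt0.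
  have hK := K2_ge kappa_gt0.
  have hxl := choice_xi_lam kappa_gt0 L_ge.
  rewrite -/xi -/lam in hx hxl.
  set c1 := ln _ in hx hK hxl; set K2 := _ * expR _ in hx hK.
  apply: (@le_trans _ _ (2 * u * expR (- (xi * (1 - lam / 16))))).
    by rewrite ler_wpM2r // expR_ge0.
  have -> : - (xi * (1 - lam / 16)) = xi * (lam / 16) - xi by ring.
  rewrite expRB hx mulrA ler_pdivrMr; last by rewrite -hx expR_gt0.
  rewrite mul1r.
  have h1 : expR (xi * (lam / 16)) <= K2 by apply: le_trans hK; rewrite ler_expR.
  have h2 : 2 * u * expR (xi * (lam / 16)) <= 2 * u * K2 by rewrite ler_wpM2l //; lra.
  apply: le_trans h2 _.
  have -> : 2 * u * K2 = K2 * u * 2 by ring.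
  apply: ler_wpM2l; last by move: Lg; rewrite /L; lra.
  by apply: mulr_ge0; [apply: le_trans h1; exact: expR_ge0|exact: ltW].
move=> eps eps1.
have pp := pseq_prime ps; have pi := @pseq_inj s us.
have aE := sum_pseq s (fun q => expR (- (1 - xi / l) * ln (q%:R : R))).
have sln' i : (1 - lam / 16) * l <= ln (@pseq s i)%:R <= l by apply: sln; exact: pseq_mem.
have [||||||||||||n [n0 /andP[h1 h2] h3]] := @large_discrepancy R _ (@pseq s) pp pi l xi lam u _ _ _ lam0 _ _ _ _ _ _ _ _ _ eps eps1.
- by lra.
- by lra.
- exact: (@choice_xi_le R kappa Dc kappa_gt0 Dc_ge0 z u l_ge L_ge L_le).
- by lra.
- exact: (@choice_ulam R kappa kappa_gt0 u L_ge u_gt0).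
- by move=> i; have /andP[] := sln' i.
- by move=> i; have /andP[] := sln' i.
- move=> i; have /andP[h _] := sln' i.
  exact: (@choice_term_le R kappa Dc kappa_gt0 Dc_ge0 z u l_ge L_ge L_le _ h).
- by rewrite aE.
- by rewrite aE.
- exact: (@choice_growth R kappa kappa_gt0 u L_ge u_gt0).
- rewrite aE; apply: le_trans (expR_ge1Dx _).
  set a := \sum_(q <- s) _; have : u * (1 + lam) <= a by exact: sa1.
  have h1 : u * lam ^+ 2 <= u * 1 by apply: ler_wpM2l; [exact: ltW|nra].
  have h2 : 0 <= u * lam by rewrite mulr_ge0 // ltW.
  by move=> ?; lra.
by exists n; split.
Qed.

Lemma unbounded_regime eps : eps = 1 \/ eps = -1 ->
  exists J : interval R, z `^ u <= ilength J /\ deviates P z eps choice_eta J.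
Proof.
move=> eps1.
have [s [[us ps] sL sln _ H]] := choice_discrepancy.
have [n [n0 un hn]] := H eps eps1.
have nR : 0 < n%:R :> R by rewrite ltr0n.
have pp := pseq_prime ps; have pi := @pseq_inj s us.
have [||J [Jl Jd]] := @deviates_of_ncount R P z s n%:R choice_eta eps P_prime us ps sL nR _ eps1.
- exact: expR_ge0.
- rewrite natrK ncountE // addrAC subrr add0r //.
exists J; split => //.
by rewrite Jl powR_expR // -[leRHS]lnK ?posrE // ler_expR.
Qed.

End MainRegime.

(** * Large u with length at most z^(u + 2) *)

Section SmallLengthRegime.
Variables (R : realType) (kappa Dc : R).
Hypotheses (kappa_gt0 : 0 < kappa) (Dc_ge0 : 0 <= Dc).
Variables (P : set nat) (z u : R).
Hypothesis P_prime : P `<=` [set q | prime q].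
Hypothesis P_dense : forall y : R, Num.sqrt z < y <= z ->
  kappa * (primepi y)%:R <= (count_upto P y)%:R.
Let l := ln z.
(** The propagation starts from a large tail beyond z^(u + 1), so the parameters are those belonging
    to u + 1. *)
Let u1 := u + 1.
Let L := ln u1.
Hypothesis l_ge : lmin kappa Dc <= l.
Hypothesis L_ge : Lmin kappa <= L.
Hypothesis L_le : L <= l / 2 + Dc.
Hypothesis u_gt0 : 0 < u.
Hypothesis z_gt0 : 0 < z.
Let xi := choice_xi kappa u1.
Let lam := choice_lam kappa u1.
Let eta := choice_eta kappa u1.
Hypothesis eta_ge : 400 / l <= eta.

Lemma small_length_regime eps : eps = 1 \/ eps = -1 ->
  exists J : interval R, z `^ u <= ilength J <= z `^ (u + 2) /\ deviates P z eps (eta / 20) J.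
Proof.
move=> eps1.
have u10 : 0 < u1 by rewrite /u1; have := u_gt0; lra.
have [s [[us ps] sL sln [sa s1] H]] := choice_discrepancy kappa_gt0 Dc_ge0 P_prime P_dense l_ge L_ge L_le u10 z_gt0.
have [u768 Lu] := choice_u_geL kappa_gt0 L_ge u10.
have lam0 : 0 < lam := choice_lam_gt0 kappa_gt0 L_ge.
have laml : lam <= 1 / 48 := choice_lam_le kappa_gt0 L_ge.
have lg : 2500 <= l := choice_l_ge kappa_gt0 Dc_ge0 l_ge.
have xg : 48 <= xi := choice_xi_ge kappa_gt0 L_ge.
have l0 : 0 < l by lra.
have eta0 : 0 < eta by exact: expR_gt0.
have pp := pseq_prime ps; have pi := @pseq_inj s us.
have lam2 : l / 2 <= (1 - lam / 16) * l.
  by rewrite mulrC ler_wpM2r ?(ltW l0) //; lra.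
have slhalf q : q \in s -> l / 2 <= ln (q%:R : R).
  by move=> /sln /andP[h _]; apply: le_trans h.
have l_le (x : R) : l <= x -> l <= expR x by move=> h; have := expR_ge1Dx x; lra.
have err h (lh : l <= h) := @ncount_mtail_error R s l h l0 lh ps us slhalf s1.
have lu : l <= u * l by rewrite ler_peMl ?(ltW l0) //; rewrite /u1 in u768; lra.
have el : 73 / l <= 73 / 400 * eta.
  have -> : 73 / l = 73 / 400 * (400 / l) by field; rewrite gt_eqF.
  by apply: ler_wpM2l; [lra|exact: eta_ge].
(* The extra 3 u1 / xi gives y^(-xi / l) <= eta e^(-3 u1) for y >= z^V, which outweighs the product
   e^(2 u1) in [mlogtail_far]. *)
pose V := u1 * (1 + 3 * lam) + 3 * u1 / xi.
have hex : exists2 x : R, expR ((u + 1) * l) <= x & eta / 4 <= `|mtail (@pseq s) x|.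
  have [n [n0 un hn]] := H 1 (or_introl erefl).
  have nR : 0 < n%:R :> R by rewrite ltr0n.
  have xn : expR ((u + 1) * l) <= n%:R by rewrite -[leRHS]lnK ?posrE // ler_expR.
  exists n%:R => //.
  have ln' : l <= n%:R.
    by apply: le_trans xn; apply: l_le; rewrite mulrDl mul1r; lra.
  have := err _ ln'; rewrite natrK ncountE //.
  rewrite mul1r in hn; set D := discrepancy _ _ _ in hn *; set m := mtail _ _.
  have -> : n%:R * density R (@pseq s) + D - n%:R * density R (@pseq s) + n%:R * m = D + n%:R * m.
    by ring.
  move=> he; have he2 : 73 / l * n%:R <= 73 / 400 * eta * n%:R by rewrite ler_wpM2r // ltW.
  have h3 : `|D| <= `|D + n%:R * m| + n%:R * `|m|.
    have -> : n%:R * `|m| = `|- (n%:R * m)| by rewrite normrN normrM (gtr0_norm nR).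
    by apply: le_trans (ler_normD _ _); rewrite addrK.
  have h4 : eta * n%:R <= `|D| by apply: le_trans hn _; rewrite ler_norm.
  have h5 : 0 <= eta * n%:R by rewrite mulr_ge0 // ltW.
  rewrite -(ler_pM2l nR); lra.
(* The sign is reversed because E h / h is close to -L h. *)
have [||||||||h [/andP[h1 h2] h3]] := @propagation R _ (@pseq s) pp l u V (eta / 4) l0 _ _ _ _ _ _ _ hex (- eps).
- by rewrite /u1 in u768; lra.
- by lra.
- have hx : 3 * u1 / xi <= u1 / 16 by rewrite ler_pdivrMr; [nra|lra].
  have : u1 * (3 * lam) <= u1 * (1 / 16) by apply: ler_wpM2l; [exact: ltW|lra].
  by rewrite /V; rewrite /u1 in u768 hx *; lra.
- by move=> i; have /andP[] := sln _ (pseq_mem i).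
- by rewrite (sum_pseq s (fun q => q%:R^-1)).
- move=> i; have q0 : 0 < (@pseq s i)%:R :> R by rewrite ltr0n prime_gt0.
  have := slhalf _ (pseq_mem i) => hq.
  have h24 : 24 <= l / 2 by lra.
  have hq2 : l * (l / 2) <= (@pseq s i)%:R.
    rewrite -[leRHS]lnK ?posrE //; apply: (@le_trans _ _ (expR (l / 2))); last by rewrite ler_expR.
    apply: le_trans (expR_ge_cube h24).
    have -> : (l / 2) ^+ 3 = l * (l / 2) * (l / 4) by field.
    by rewrite ler_peMr ?mulr_ge0 ?divr_ge0 ?(ltW l0) //; lra.
  apply: (@le_trans _ _ (100 / l)); last by have := eta_ge; lra.
  rewrite ler_pdivrMr // mulrAC ler_pdivlMr //.
  apply: (@le_trans _ _ (100 * (l * (l / 2)))); last by apply: ler_wpM2l => //; rewrite ler0n.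
  nra.
- move=> y yV; have y0 : 0 < y by apply: lt_le_trans yV; exact: expR_gt0.
  have b0 : 0 < xi / l by rewrite divr_gt0 //; lra.
  apply: le_trans (mlogtail_far pp b0 y0) _.
  have hP : \prod_i (1 + expR (- (1 - xi / l) * ln (@pseq s i)%:R)) <= expR (2 * u1).
    apply: le_trans (prodr_1D_le_expR _) _; first by move=> i; exact: expR_ge0.
    by rewrite ler_expR (sum_pseq s (fun q => expR (- (1 - xi / l) * ln q%:R))).
  have hy : expR (- (xi / l) * ln y) <= eta * expR (- (3 * u1)).
    rewrite /eta /choice_eta -expRD ler_expR.
    have lyV : V * l <= ln y by rewrite -[leLHS]expRK ler_ln ?posrE ?expR_gt0.
    have h : xi / l * (V * l) <= xi / l * ln y by rewrite ler_wpM2l // ltW.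
    have hE : xi / l * (V * l) = xi * (u1 * (1 + 3 * lam)) + 3 * u1.
      by rewrite /V; field; rewrite !gt_eqF //; lra.
    by rewrite mulNr; move: h hE; rewrite -/xi -/lam; lra.
  have e1 := expR_ge0 (- (xi / l) * ln y).
  apply: (@le_trans _ _ ((xi / l)^-1 * (eta * expR (- (3 * u1))) * expR (2 * u1))).
    apply: ler_pM => //; first by rewrite mulr_ge0 // invr_ge0 ltW.
      by rewrite prodr_ge0 // => i _; rewrite addr_ge0 // expR_ge0.
    by rewrite ler_wpM2l // invr_ge0 ltW.
  have -> : (xi / l)^-1 * (eta * expR (- (3 * u1))) * expR (2 * u1) = l * eta * (xi^-1 * expR (- u1)).
    have -> : - u1 = - (3 * u1) + 2 * u1 by ring.
    by rewrite expRD invf_div; ring.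
  rewrite [leRHS]mulrA; apply: ler_wpM2l; first by rewrite mulr_ge0 // ltW.
  have h1 : expR (- u1) <= 1 by rewrite -[leRHS]expR0 ler_expR oppr_le0 ltW.
  have h2 : xi^-1 <= 4^-1 by rewrite lef_pV2 ?posrE //; lra.
  have h3 : 0 <= xi^-1 by rewrite invr_ge0; lra.
  by rewrite -[leRHS]mulr1; apply: ler_pM => //; exact: expR_ge0.
- by case: eps1 => ->; rewrite ?opprK; auto.
have hl : l <= h by apply: le_trans h1; exact: l_le.
have h0 : 0 < h by lra.
have he := err _ hl.
(* A tail of eta / 4 less the error 73 / 400 eta still exceeds eta / 20. *)
have [||J [Jl Jd]] := @deviates_of_ncount R P z s h (eta / 20) eps P_prime us ps sL h0 _ eps1.
- by lra.
- have epsn : `|eps| = 1 by case: eps1 => ->; rewrite ?normrN normr1.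
  set A := _ - _ in he *; set m := mtail _ _ in he h3.
  have h5 : - (eps * (A + h * m)) <= 73 / l * h.
    by apply: le_trans he; apply: le_trans (ler_norm _) _; rewrite normrN normrM epsn mul1r.
  have h6 : 73 / l * h <= 73 / 400 * eta * h by rewrite ler_wpM2r // ltW.
  have h7 : eta / 4 * h <= - eps * m * h by rewrite ler_wpM2r // ltW.
  have -> : eps * A = eps * (A + h * m) + (- eps * m * h) by ring.
  have h8 : 0 < eta * h by rewrite mulr_gt0.
  lra.
by exists J; rewrite Jl !powR_expR // h1 h2.
Qed.

End SmallLengthRegime.

(** * Bounded u *)

Lemma signr_or (R : pzRingType) k : (-1) ^+ k = 1 :> R \/ (-1) ^+ k = -1 :> R.
Proof.
elim: k => [|k [E|E]]; first by left; rewrite expr0.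
  by right; rewrite exprS E mulr1.
by left; rewrite exprS E mulrNN mulr1.
Qed.

Section BoundedRegime.
Variables (R : realType) (kappa : R).
Hypothesis kappa_gt0 : 0 < kappa.
Variable K : nat.
Let c1 : R := ln (384 / kappa + 4).
Let b : R := (K + 4)%:R.
(** A lower bound for the reciprocals in the block of logarithmic width l / b; the cap 1/8, with an
    overshoot of at most 1 / l <= 1/8, keeps the selected sum at most 1/4. *)
Let tau : R := Num.min (kappa / (32 * c1) / b) (1 / 8).
(** Half of the bound of [mtail_block_lower] at k = K, which serves every smaller k as well; the
    other half pays for the error 73 / l. *)
Definition block_eta : R := (tau / 2) ^+ K.+1 / (K.+1`!)%:R / 4.
Definition block_lmin : R := 100 + c1 * b + 8 * c1 + 20 * b / tau + 80 / block_eta.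

Let c1g : 1 <= c1. Proof. exact: c1_ge1. Qed.
Let b_ge : 4 <= b. Proof. by rewrite /b ler_nat leq_addl. Qed.
Let tau_gt0 : 0 < tau.
Proof.
have c0 : 0 < 32 * c1 by have := c1g; lra.
have b0 : 0 < b by have := b_ge; lra.
rewrite lt_min; apply/andP; split; last by lra.
by apply: divr_gt0 => //; exact: divr_gt0.
Qed.
Let tau_le : tau <= 1 / 8. Proof. by rewrite ge_min lexx orbT. Qed.

Lemma block_eta_gt0 : 0 < block_eta.
Proof.
apply: divr_gt0 => //; apply: divr_gt0; last by rewrite ltr0n fact_gt0.
by apply: exprn_gt0; apply: divr_gt0 => //; exact: tau_gt0.
Qed.

Lemma block_eta_le1 : block_eta <= 1.
Proof.
rewrite /block_eta -mulrA -invfM.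
apply: (@le_trans _ _ ((tau / 2) ^+ K.+1 * 1)).
  apply: ler_wpM2l; first by rewrite exprn_ge0 // divr_ge0 // ltW.
  rewrite invf_le1 ?mulr_gt0 ?ltr0n ?fact_gt0 //.
  have : 1 <= (K.+1`!)%:R :> R by rewrite ler1n fact_gt0.
  lra.
by rewrite mulr1 exprn_ile1 ?divr_ge0 ?(ltW tau_gt0) //; have := tau_le; lra.
Qed.

Variables (P : set nat) (z : R).
Hypothesis P_prime : P `<=` [set q | prime q].
Hypothesis P_dense : forall y : R, Num.sqrt z < y <= z ->
  kappa * (primepi y)%:R <= (count_upto P y)%:R.
Let l := ln z.
Hypothesis l_ge : block_lmin <= l.
Hypothesis z_gt0 : 0 < z.

Lemma bounded_regime k : (0 < k <= K)%N ->
  exists J : interval R, ilength J = expR (k%:R * l) /\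
    deviates P z ((-1) ^+ k) block_eta J.
Proof.
move=> /andP[k0 kK].
have cg := c1g; have bg := b_ge; have t0 := tau_gt0; have t8 := tau_le; have e0 := block_eta_gt0.
have [l100 [lcb [lc [lbt le]]]] : 100 <= l /\ (c1 * b <= l /\ (8 * c1 <= l /\ (20 * b / tau <= l /\ 80 / block_eta <= l))).
  have h1 : 0 <= c1 * b by rewrite mulr_ge0 //; lra.
  have h2 : 0 <= 20 * b / tau by rewrite divr_ge0 ?mulr_ge0 ?(ltW t0) //; lra.
  have h3 : 0 <= 80 / block_eta by rewrite divr_ge0 ?(ltW e0) ?ler0n.
  move: l_ge; rewrite /block_lmin; move: h1 h2 h3.
  by move: (c1 * b) (20 * b / tau) (80 / block_eta) => A B D; do 4 (split; first lra); lra.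
have l0 : 0 < l by lra.
have zE : z = expR l by rewrite lnK ?posrE.
have z1 : 1 < z by rewrite zE expR_gt1.
pose g := l / b.
have bp : 0 < b by lra.
have g1 : c1 <= g by rewrite ler_pdivlMr.
have g4 : g <= l / 4 by rewrite ler_wpM2l ?(ltW l0) // lef_pV2 ?posrE.
have l4 : 4 * c1 <= l by lra.
have hsum := recip_sum_lower kappa_gt0 P_prime z1 P_dense l4 g1 g4.
rewrite -/c1 -/l in hsum.
pose s1 := [seq q <- iota 0 (Num.truncn z).+1 | `[< P q >] && (expR (l - g) < q%:R <= z)].
have s1P q : q \in s1 -> [/\ P q, prime q, expR (l - g) < q%:R & q%:R <= z].
  by rewrite mem_filter => /andP[/andP[/asboolP Pq /andP[h1 h2]] _]; split => //; exact: P_prime.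
have s1ln q : q \in s1 -> l - g < ln q%:R <= l.
  move=> /s1P[_ _ h1 h2]; have q0 : 0 < q%:R :> R by apply: lt_trans h1; exact: expR_gt0.
  apply/andP; split; last by rewrite ler_ln ?posrE.
  by rewrite -[ltLHS]expRK ltr_ln ?posrE ?expR_gt0.
have tot : tau <= \sum_(q <- s1) q%:R^-1.
  rewrite big_filter; apply: le_trans hsum.
  have -> : kappa / (32 * c1) * g / l = kappa / (32 * c1) / b.
    by rewrite /g; field; rewrite !gt_eqF //; lra.
  by rewrite ge_min lexx.
have big q : q \in s1 -> l / 2 <= ln q%:R /\ l * (l / 4) <= q%:R.
  move=> qs; have /andP[h _] := s1ln q qs; have [_ pq _ _] := s1P q qs.
  have q0 : 0 < q%:R :> R by rewrite ltr0n prime_gt0.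
  have h2 : l / 2 <= ln q%:R by lra.
  split => //; have h24 : 24 <= l / 2 by lra.
  rewrite -[leRHS]lnK ?posrE //; apply: (@le_trans _ _ (expR (l / 2))); last by rewrite ler_expR.
  apply: le_trans (expR_ge_cube h24).
  have -> : (l / 2) ^+ 3 = l * (l / 4) * (l / 2) by field.
  by rewrite ler_peMr ?mulr_ge0 ?divr_ge0 ?(ltW l0) //; lra.
have inv_le q : q \in s1 -> q%:R^-1 <= l^-1 :> R.
  move=> qs; have [_ h] := big q qs; rewrite lef_pV2 ?posrE //; last by nra.
  by nra.
have [|k' /andP[hk1 hk2]] := @prefix_sum R (fun q => q%:R^-1) l^-1 tau s1 _ inv_le (ltW t0) tot.
  by rewrite invr_ge0 ltW.
set s := take k' s1 in hk1 hk2.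
have ss1 q : q \in s -> q \in s1 by exact: mem_take.
have us : uniq s by rewrite take_uniq // filter_uniq // iota_uniq.
have ps : all prime s by apply/allP => q /ss1 /s1P[].
have sL : {subset s <= prime_list (Num.truncn z) P z}.
  by move=> q /ss1; rewrite !mem_filter => /andP[/andP[-> /andP[_ ->]] ->].
have pp := pseq_prime ps.
have SE := sum_pseq s (fun q => q%:R^-1 : R).
have linv : l^-1 <= 1 / 8.
  by rewrite -[1 / 8]invrK lef_pV2 ?posrE ?invr_gt0 ?divr_gt0 // div1r invrK; lra.
have sig4 : \sum_i (@pseq s i)%:R^-1 <= 1 / 4 :> R by rewrite SE; lra.
have kb : k.+1%:R <= b :> R by rewrite /b ler_nat -[k.+1]addn1 leq_add.
have hlow := @mtail_block_lower R _ (@pseq s) pp sig4 k _ l g _ _ _ (ltW l0).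
have {}hlow : (tau / 2) ^+ k.+1 / (k.+1`!)%:R / 2 <= (-1) ^+ k.+1 * mtail (@pseq s) (expR (k%:R * l)).
  apply: le_trans (hlow _ _ _ _).
  - rewrite SE; rewrite ler_pM2r ?invr_gt0 // ler_pM2r ?invr_gt0 ?ltr0n ?fact_gt0 //.
    by rewrite lerXn2r ?nnegrE ?divr_ge0 ?(ltW t0) ?(le_trans (ltW t0) hk1) // ler_pM2r ?invr_gt0.
  - move=> i; rewrite SE; have qs := ss1 _ (pseq_mem i); have [_ hq] := big _ qs.
    have q0 : 0 < (@pseq s i)%:R :> R by rewrite ltr0n prime_gt0.
    apply: (@le_trans _ _ (tau / 2)); last by rewrite ler_pM2r ?invr_gt0.
    rewrite ler_pdivrMr //; apply: (@le_trans _ _ b); first by move: kb; rewrite -[k.+1%:R]natr1; lra.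
    have h1 : 20 * b <= l * tau by rewrite -ler_pdivrMr.
    apply: (@le_trans _ _ (tau / 2 * (l * (l / 4)))); last by rewrite ler_wpM2l ?divr_ge0 ?(ltW t0).
    have -> : tau / 2 * (l * (l / 4)) = l * tau * (l / 8) by field.
    apply: (@le_trans _ _ (20 * b * 1)); first lra.
    by apply: ler_pM => //; [rewrite mulr_ge0 //; lra|lra].
  - by move=> i; have /andP[] := s1ln _ (ss1 _ (pseq_mem i)).
  - by move=> i; have /andP[] := s1ln _ (ss1 _ (pseq_mem i)).
  - rewrite mulrBr -[k.+1%:R * l](_ : k%:R * l + l = _); last by rewrite -natr1; ring.
    rewrite -addrA lerDl subr_ge0 /g mulrCA -[leRHS]mulr1 ler_wpM2l ?(ltW l0) //.
    by rewrite ler_pdivrMr // mul1r.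
have hetak : 2 * block_eta <= (tau / 2) ^+ k.+1 / (k.+1`!)%:R / 2.
  have -> : 2 * block_eta = (tau / 2) ^+ K.+1 / (K.+1`!)%:R / 2 by rewrite /block_eta; field; rewrite pnatr_eq0 -lt0n fact_gt0.
  rewrite ler_pM2r ?invr_gt0 //; apply: ler_pM.
  - by rewrite exprn_ge0 // divr_ge0 // ltW.
  - by rewrite invr_ge0.
  - by apply: ler_wiXn2l; [rewrite divr_ge0 // ltW|lra|rewrite ltnS].
  - by rewrite lef_pV2 ?posrE ?ltr0n ?fact_gt0 // ler_nat leq_fact.
set h := expR (k%:R * l) in hlow *.
have hl : l <= h.
  rewrite /h; have := expR_ge1Dx (k%:R * l); have : 1 * l <= k%:R * l by rewrite ler_wpM2r ?(ltW l0) // ler1n.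
  lra.
have h0 : 0 < h by exact: expR_gt0.
have slhalf q : q \in s -> l / 2 <= ln (q%:R : R) by move=> /ss1 /big[].
have s1' : \sum_(q <- s) q%:R^-1 <= 1 :> R by rewrite -SE; lra.
have he := @ncount_mtail_error R s l h l0 hl ps us slhalf s1'.
have eps1 := signr_or R k.
apply: (deviates_of_ncount P_prime us ps sL h0 (ltW e0) eps1).
have epsn : `|(-1) ^+ k| = 1 :> R by rewrite normrX normrN1 expr1n.
set A := _ - _ in he *; set m := mtail _ _ in he hlow; set eps := (-1) ^+ k in epsn *.
have h5 : - (eps * (A + h * m)) <= 73 / l * h.
  by apply: le_trans he; apply: le_trans (ler_norm _) _; rewrite normrN normrM epsn mul1r.
have h6 : 73 / l * h <= block_eta * h.
  rewrite ler_wpM2r ?(ltW h0) // ler_pdivrMr //.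
  have h80 : 80 <= l * block_eta by rewrite -ler_pdivrMr.
  by rewrite mulrC; lra.
have h7 : 2 * block_eta * h <= - eps * m * h.
  rewrite ler_wpM2r ?(ltW h0) //; apply: le_trans hetak _; apply: le_trans hlow _.
  by rewrite exprS mulN1r.
have -> : eps * A = eps * (A + h * m) + (- eps * m * h) by ring.
lra.
Qed.

End BoundedRegime.

(** * Comparison with (c / (u ln u))^u *)

Section FinalEstimates.
Variable R : realType.
Implicit Types (P : set nat) (z u c eta eps : R).

Lemma deviates_weaken P z eps eta eta' (J : interval R) : P `<=` [set q | prime q] ->
  eps = 1 \/ eps = -1 -> 0 <= ilength J -> eta' <= eta ->
  deviates P z eps eta J -> deviates P z eps eta' J.
Proof.
move=> Pp eps1 J0 ee; apply: le_trans.
have e2 : eps * eps = 1 by case: eps1 => ->; ring.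
have d0 : 0 <= sieve_density P z.
  rewrite (sieve_densityE P (truncnS_gt z)) big_seq prodr_ge0 // => q.
  rewrite mem_filter => /andP[/andP[/asboolP /Pp pq _] _].
  by rewrite subr_ge0 invf_le1 ?ler1n ?ltr0n prime_gt0.
have H x : eps * ((1 + eps * x) * ilength J * sieve_density P z) =
   eps * (ilength J * sieve_density P z) + x * (ilength J * sieve_density P z).
  transitivity (eps * (ilength J * sieve_density P z) + (eps * eps) * (x * (ilength J * sieve_density P z))); first by ring.
  by rewrite e2 mul1r.
by rewrite !H lerD2l ler_wpM2r // mulr_ge0.
Qed.

Lemma powR_ratio_expR c u : 0 < c -> 1 < u ->
  (c / (u * ln u)) `^ u = expR (u * (ln c - ln u - ln (ln u))).
Proof.
move=> c0 u1; have u0 : 0 < u by lra.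
have L0 : 0 < ln u by exact: ln_gt0.
have uL : 0 < u * ln u by rewrite mulr_gt0.
rewrite powR_expR ?divr_gt0 // ln_div ?posrE // lnM ?posrE //.
by congr (expR (_ * _)); ring.
Qed.

(** The base is at most [eta] because u ln u >= u0 ln u0, and an exponent of at least 1 only lowers
    it. This settles bounded u and bounded z, where some fixed deviation is available. *)
Lemma powR_ratio_le c u u0 eta : 1 < u0 -> u0 <= u -> 0 < c ->
  c <= u0 * ln u0 * eta -> eta <= 1 -> (c / (u * ln u)) `^ u <= eta.
Proof.
move=> u01 u0u c0 ce e1.
have L0 : 0 < ln u0 by exact: ln_gt0.
have u0p : 0 < u0 by lra.
have up : 0 < u by lra.
have Lu : ln u0 <= ln u by rewrite ler_ln ?posrE.
have L : 0 < ln u by lra.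
have uL : 0 < u * ln u by rewrite mulr_gt0.
have uL0 : 0 < u0 * ln u0 by rewrite mulr_gt0.
have e0 : 0 < eta by rewrite -(pmulr_rgt0 _ uL0); exact: lt_le_trans ce.
have hx : c / (u * ln u) <= eta.
  rewrite ler_pdivrMr // mulrC; apply: le_trans ce _.
  by rewrite ler_wpM2r ?(ltW e0) //; apply: ler_pM => //; exact: ltW.
have x0 : 0 < c / (u * ln u) by rewrite divr_gt0.
apply: (le_trans _ hx); apply: ge1r_powR; last by lra.
by rewrite x0 (le_trans hx).
Qed.

Lemma ln_add1_le u : 1 <= u -> ln (u + 1) <= ln u + 1.
Proof.
move=> u1; have u0 : 0 < u by lra.
rewrite -lerBlDl -ln_div ?posrE //; last by lra.
apply: (@le_trans _ _ (ln 2)); last exact: ln2_le.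
rewrite ler_ln ?posrE ?divr_gt0 //; last by lra.
by rewrite ler_pdivrMr //; lra.
Qed.

Lemma ln_ln_add1_le u : 1 <= ln u -> ln (ln (u + 1)) <= ln (ln u) + 1.
Proof.
move=> L1; have u1 : 1 <= u.
  by rewrite leNgt; apply/negP => h; have := ln_le0 (ltW h); lra.
have h := ln_add1_le u1; have L0 : 0 < ln u by lra.
have M0 : 0 < ln (u + 1) by rewrite ln_gt0 //; lra.
rewrite -lerBlDl -ln_div ?posrE //.
apply: (@le_trans _ _ (ln 2)); last exact: ln2_le.
rewrite ler_ln ?posrE ?divr_gt0 //.
by rewrite ler_pdivrMr //; lra.
Qed.

(** With Y = ln X one has u <= X / Y, hence u ln u <= X and ln u + ln ln u <= Y; the margin K / Y
    then frees the K X / Y that bounds u K. Here X will be ln ln z. *)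
Lemma mul_ln_le_of_margin (K X u : R) : 0 <= K -> 1 <= ln u -> 1 <= ln X -> 0 < u -> 0 < X ->
  u <= (1 - K / ln X) * (X / ln X) -> u * (ln u + ln (ln u) + K) <= X.
Proof.
move=> K0 L1 Y1 u0 X0; set Y := ln X in Y1 *; set A := X / Y => hm.
have Y0 : 0 < Y by lra.
have L0 : 0 < ln u by lra.
have A0 : 0 < A by rewrite divr_gt0.
have AY : A * Y = X by rewrite divfK // gt_eqF.
have KA : 0 <= K / Y * A by apply: mulr_ge0; [apply: divr_ge0; lra|exact: ltW].
have uA : u <= A by lra.
have LY : ln u <= Y.
  by rewrite ler_ln ?posrE // -AY (le_trans uA) // ler_peMr // (ltW A0).
have uLY : ln u + ln (ln u) <= Y.
  rewrite -lnM ?posrE // ler_ln ?posrE ?mulr_gt0 // -AY.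
  by apply: ler_pM => //; exact: ltW.
have e1 : u * (ln u + ln (ln u)) <= u * Y by apply: ler_wpM2l => //; exact: ltW.
have e2 : u * K <= A * K by exact: ler_wpM2r.
have e3 : u * Y <= (1 - K / Y) * A * Y by apply: ler_wpM2r => //; exact: ltW.
have e4 : (1 - K / Y) * A * Y = A * Y - A * K by field; rewrite gt_eqF.
by rewrite mulrDr; lra.
Qed.

Variables (kappa : R).
Hypothesis kappa_gt0 : 0 < kappa.
Let c1 : R := ln (384 / kappa + 4).
(** xi (1 + 3 lam) = xi + 48 (xi lam / 16), and xi lam / 16 <= 2 c1, whence 96 c1. *)
Definition choice_loss : R := ln ((96 / kappa + 1) * expR (2 * c1)) + 96 * c1.
Let Kc := choice_loss.

Lemma choice_loss_ge0 : 0 <= Kc.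
Proof.
have := c1_ge1 kappa_gt0; have := lnK2_ge0 kappa_gt0.
by rewrite /Kc /choice_loss /c1; lra.
Qed.

Lemma choice_eta_lower u : Lmin kappa <= ln u -> 0 < u ->
  expR (- (u * (ln u + ln (ln u) + Kc))) <= choice_eta kappa u.
Proof.
move=> L_ge u0; rewrite ler_expR lerN2.
have h := choice_xi_lam kappa_gt0 L_ge; rewrite -/c1 in h.
have -> : choice_xi kappa u * (u * (1 + 3 * choice_lam kappa u)) =
   u * (choice_xi kappa u + 48 * (choice_xi kappa u * (choice_lam kappa u / 16))) by field.
apply: ler_wpM2l; first exact: ltW.
move: h; set x := _ * (_ / 16) => h.
by rewrite /choice_xi /Kc /choice_loss -/c1; lra.
Qed.

Lemma choice_eta_succ_lower u : Lmin kappa <= ln u -> 0 < u ->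
  expR (- (u * (ln u + ln (ln u) + 2 * Kc + 5))) <= choice_eta kappa (u + 1).
Proof.
move=> L_ge u0.
have [Lg _] := choice_L_ge kappa_gt0 L_ge.
have [ug Lu] := choice_u_geL kappa_gt0 L_ge u0.
have L1 : 1 <= ln u by lra.
have u1 : 1 <= u by lra.
have h1 := ln_add1_le u1; have h2 := ln_ln_add1_le L1.
have L_ge' : Lmin kappa <= ln (u + 1).
  by apply: le_trans L_ge _; rewrite ler_ln ?posrE //; lra.
apply: le_trans (choice_eta_lower L_ge' _); last by lra.
rewrite ler_expR lerN2.
have lL : ln (ln u) <= u.
  have : ln (ln u) <= ln u / 2 by apply: ln_le_half; lra.
  lra.
have K0 := choice_loss_ge0.
apply: (@le_trans _ _ ((u + 1) * (ln u + ln (ln u) + 2 + Kc))).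
  by apply: ler_wpM2l; lra.
have uK : Kc <= u * Kc by rewrite ler_peMl.
lra.
Qed.

End FinalEstimates.

(** * Assembly of the regimes and the uniform constant *)

Section Assembly.
Variables (R : realType) (kappa C u0 : R).
Hypotheses (kappa_gt0 : 0 < kappa) (C_gt0 : 0 < C) (u0_gt1 : 1 < u0).
Let Dc : R := `|ln C| + 1.
Let U0 : R := expR (Lmin kappa).
Let K : nat := (Num.truncn U0 + 2)%N.
Let l1 : R := `|lmin kappa Dc| + `|block_lmin kappa K| + expR (expR 1).
Let Z1 : R := expR l1.
(** An integer above z^u for all z <= Z1 and u <= C sqrt z. *)
Let k1 : nat := (Num.truncn (expR (C * Num.sqrt Z1 * l1))).+1.
Let Kc : R := choice_loss kappa.
Let eta1 : R := Num.min (block_eta kappa K) (k1.*2.+1%:R^-1).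

(** The first entry serves large u, by the factor e^(-u (2 Kc + 6)); the second serves bounded u and
    bounded z through [powR_ratio_le]. *)
Definition rate : R := Num.min (expR (- (2 * Kc + 6))) (u0 * ln u0 * eta1).
(** The value 1 makes the length condition void for z <= Z1, as u > 0; beyond, the numerator is the
    constant K of [mul_ln_le_of_margin]. *)
Definition margin (z : R) : R :=
  if z <= Z1 then 1 else (2 * Kc + 6) / ln (ln (ln z)).

Let Kc_ge0 : 0 <= Kc. Proof. exact: choice_loss_ge0. Qed.
Let l1_ge0 : 0 <= l1.
Proof. by rewrite !addr_ge0 ?normr_ge0 ?expR_ge0. Qed.
Let eta1_gt0 : 0 < eta1.
Proof. by rewrite lt_min block_eta_gt0 //= invr_gt0 ltr0n. Qed.
Let uL0 : 0 < u0 * ln u0.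
Proof. by rewrite mulr_gt0 ?ln_gt0 // (lt_trans ltr01 u0_gt1). Qed.

Lemma rate_gt0 : 0 < rate.
Proof. by rewrite lt_min expR_gt0 mulr_gt0. Qed.

Lemma margin_cvg : margin z @[z --> +oo] --> (0 : R).
Proof.
apply/cvgrPdist_le => e e0.
pose B := expR (expR (expR ((2 * Kc + 6) / e))).
near=> z.
have zB : Num.max Z1 B < z by near: z; apply: nbhs_pinfty_gt; exact: num_real.
move: zB; rewrite gt_max => /andP[zZ zB].
rewrite sub0r normrN /margin (lt_geF zZ).
have h1 : expR (expR ((2 * Kc + 6) / e)) < ln z.
  by rewrite -[ltLHS]expRK ltr_ln ?posrE ?expR_gt0 // (lt_trans _ zB) // expR_gt0.
have h2 : expR ((2 * Kc + 6) / e) < ln (ln z).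
  by rewrite -[ltLHS]expRK ltr_ln ?posrE ?expR_gt0 // (lt_trans _ h1) // expR_gt0.
have h3 : (2 * Kc + 6) / e < ln (ln (ln z)).
  by rewrite -[ltLHS]expRK ltr_ln ?posrE ?expR_gt0 // (lt_trans _ h2) // expR_gt0.
have K6 : 0 < 2 * Kc + 6 by have := Kc_ge0; lra.
have h4 : 0 < ln (ln (ln z)) by apply: lt_trans h3; rewrite divr_gt0.
rewrite ger0_norm ?divr_ge0 ?(ltW h4) ?(ltW K6) //.
by rewrite ler_pdivrMr // [e * _]mulrC -ler_pdivrMr // ltW.
Unshelve. all: by end_near. Qed.

Variables (P : set nat) (z u : R).
Hypothesis P_prime : P `<=` [set q | prime q].
Hypothesis P_dense : forall y : R, Num.sqrt z < y <= z ->
  kappa * (primepi y)%:R <= (count_upto P y)%:R.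
Hypotheses (u_ge : u0 <= u) (u_le : u <= C * Num.sqrt z).

Let z_gt0 : 0 < z.
Proof.
rewrite -sqrtr_gt0 -(pmulr_rgt0 _ C_gt0); apply: lt_le_trans u_le.
by apply: lt_le_trans u_ge; apply: lt_trans u0_gt1.
Qed.
Let u_gt1 : 1 < u. Proof. exact: lt_le_trans u0_gt1 u_ge. Qed.
Let u_gt0 : 0 < u. Proof. exact: lt_trans u_gt1. Qed.
Let eta := (rate / (u * ln u)) `^ u.

Lemma rate_small eta' : eta1 <= eta' -> eta' <= 1 -> eta <= eta'.
Proof.
move=> h1 h2; apply: (powR_ratio_le u0_gt1 u_ge rate_gt0 _ h2).
by rewrite ge_min; apply/orP; right; rewrite ler_pM2l.
Qed.

Lemma rate_expR_le : eta <= expR (- (u * (ln u + ln (ln u) + 2 * Kc + 6))).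
Proof.
rewrite /eta powR_ratio_expR ?rate_gt0 // ler_expR.
have : ln rate <= - (2 * Kc + 6).
  by rewrite -[leRHS]expRK ler_ln ?posrE ?rate_gt0 ?expR_gt0 // ge_min lexx.
move=> h; rewrite -mulrN ler_wpM2l ?(ltW u_gt0) //; lra.
Qed.

Lemma deviation_intervals (s : R) : s = 1 \/ s = -1 ->
  exists J : interval R, [/\ z `^ u <= ilength J, deviates P z s eta J &
    u <= (1 - margin z) * (ln (ln z) / ln (ln (ln z))) -> ilength J <= z `^ (u + 2)].
Proof.
move=> s1; have zp := z_gt0; have up := u_gt0; have u1 := u_gt1.
have l10 := l1_ge0.
have weak eta' (J : interval R) : eta <= eta' -> z `^ u <= ilength J -> deviates P z s eta' J -> deviates P z s eta J.
  by move=> ee Jl; apply: deviates_weaken => //; apply: le_trans Jl; exact: powR_ge0.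
have [zZ|zZ] := leP z Z1.
  have [J [Jl Jd]] := deviates_trivial z k1 P_prime s1.
  have hl : z `^ u <= ilength J.
    rewrite Jl powR_expR //; apply: (@le_trans _ _ (k1%:R)); last by lra.
    apply: (@le_trans _ _ (expR (C * Num.sqrt Z1 * l1))); last by rewrite /k1 ltW // truncnS_gt.
    rewrite ler_expR.
    have uZ : u <= C * Num.sqrt Z1.
      by apply: le_trans u_le _; rewrite ler_wpM2l ?(ltW C_gt0) // ler_wsqrtr.
    have lz : ln z <= l1 by rewrite -[leRHS]expRK ler_ln ?posrE ?expR_gt0.
    apply: (@le_trans _ _ (u * l1)); first by rewrite ler_wpM2l ?(ltW up).
    by rewrite ler_wpM2r.
  exists J; split => //.
    apply: (weak _ _ _ hl Jd); apply: rate_small; first by rewrite ge_min lexx orbT.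
    by rewrite invf_le1 ?ltr0n // ler1n.
  by rewrite /margin zZ subrr mul0r => h; lra.
have lz : l1 < ln z by rewrite -[ltLHS]expRK ltr_ln ?posrE ?expR_gt0.
have [lm [lb le1]] : lmin kappa Dc <= ln z /\ (block_lmin kappa K <= ln z /\ expR (expR 1) <= ln z).
  have := ler_norm (lmin kappa Dc); have := ler_norm (block_lmin kappa K).
  have := normr_ge0 (lmin kappa Dc); have := normr_ge0 (block_lmin kappa K).
  have := expR_ge0 (expR 1 : R); move: lz; rewrite /l1.
  by move=> *; do 2 (split; first lra); lra.
have l0 : 0 < ln z by apply: lt_le_trans le1; exact: expR_gt0.
have [uU|uU] := leP U0 u; last first.
  (* Of floor(u) + 1 and floor(u) + 2, the one with (-1)^k = s; thus u <= k <= u + 2, and u < U0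
     gives k <= K. *)
  pose k : nat := if odd (Num.truncn u).+1 == (s == -1) then (Num.truncn u).+1 else (Num.truncn u).+2.
  have kE : ((-1) ^+ k = s)%R.
    have n1 : (-1 == 1 :> R) = false by apply/negbTE; rewrite lt_eqF //; lra.
    have par m b : odd (if odd m == b then m else m.+1) = b.
      by case: eqP => [//|/eqP]; rewrite /=; case: (odd m); case: b.
    rewrite -signr_odd /k par; case: (s1) => ->; rewrite ?eqxx ?expr1 //.
    by rewrite eq_sym n1 expr0.
  have k0 : (0 < k)%N by rewrite /k; case: ifP.
  have ku : u <= k%:R.
    apply: (@le_trans _ _ (Num.truncn u).+1%:R); first by rewrite ltW // truncnS_gt.
    by rewrite ler_nat /k; case: ifP.
  have ku2 : k%:R <= u + 2.
    have h : (Num.truncn u)%:R <= u by rewrite truncn_le ltW.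
    apply: (@le_trans _ _ (Num.truncn u).+2%:R); first by rewrite ler_nat /k; case: ifP.
    by rewrite -addn2 natrD lerD2r.
  have kK : (k <= K)%N.
    have : (Num.truncn u <= Num.truncn U0)%N by apply: le_truncn; exact: ltW.
    by rewrite /k /K; case: ifP => _ h; rewrite addn2 !ltnS // (leq_trans h).
  have [J [Jl Jd]] := bounded_regime kappa_gt0 P_prime P_dense lb z_gt0 (introT andP (conj k0 kK)).
  rewrite kE in Jd.
  have hl : z `^ u <= ilength J by rewrite Jl powR_expR // ler_expR ler_wpM2r // ltW.
  exists J; split => //.
    apply: (weak _ _ _ hl Jd); apply: rate_small; first by rewrite ge_min lexx.
    exact: block_eta_le1.
  by move=> _; rewrite Jl powR_expR // ler_expR ler_wpM2r // ltW.
have L_ge : Lmin kappa <= ln u by rewrite -[leLHS]expRK ler_ln ?posrE ?expR_gt0.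
have [Lg _] := choice_L_ge kappa_gt0 L_ge.
have [ug Lu] := choice_u_geL kappa_gt0 L_ge u_gt0.
have Dc0 : 0 <= Dc by rewrite addr_ge0.
have L_le1 : ln u <= ln z / 2 + ln C.
  have -> : ln z / 2 = ln (Num.sqrt z).
    have -> : z = Num.sqrt z ^+ 2 by rewrite sqr_sqrtr // ltW.
    by rewrite lnXn ?sqrtr_gt0 // sqrtr_sqr ger0_norm ?sqrtr_ge0 // mulr2n; field.
  by rewrite addrC -lnM ?posrE ?sqrtr_gt0 // ler_ln ?posrE ?mulr_gt0 ?sqrtr_gt0.
have lnC := ler_norm (ln C).
have u11 : 1 <= u by lra.
have h1 := ln_add1_le u11.
have L_le : ln u <= ln z / 2 + Dc by rewrite /Dc; lra.
have L_le' : ln (u + 1) <= ln z / 2 + Dc by rewrite /Dc; lra.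
have L_ge' : Lmin kappa <= ln (u + 1).
  by apply: le_trans L_ge _; rewrite ler_ln ?posrE //; lra.
have hr := rate_expR_le.
have hs := choice_eta_succ_lower kappa_gt0 L_ge u_gt0; rewrite -/Kc in hs.
have K0 := Kc_ge0.
have lnnum (x : R) : 0 < x -> x <= 768 -> ln x <= u.
  move=> x0 x7; rewrite -[leRHS]expRK ler_ln ?posrE ?expR_gt0 //.
  by have := expR_ge1Dx u; lra.
have [hm|hm] := pselect (u <= (1 - margin z) * (ln (ln z) / ln (ln (ln z)))); last first.
  have [J [Jl Jd]] := unbounded_regime kappa_gt0 Dc0 P_prime P_dense lm L_ge L_le u_gt0 z_gt0 s1.
  exists J; split => //.
  apply: (weak _ _ _ Jl Jd); apply: le_trans hr _.
  apply: le_trans (choice_eta_lower kappa_gt0 L_ge u_gt0); rewrite -/Kc ler_expR lerN2.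
  by apply: ler_wpM2l; [exact: ltW|lra].
have X1 : expR 1 <= ln (ln z) by rewrite -[leLHS]expRK ler_ln ?posrE ?expR_gt0.
have X0 : 0 < ln (ln z) by apply: lt_le_trans X1; exact: expR_gt0.
have Y1 : 1 <= ln (ln (ln z)) by rewrite -[leLHS]expRK ler_ln ?posrE ?expR_gt0.
have L0 : 1 <= ln u by lra.
rewrite /margin (lt_geF zZ) in hm.
have K6 : 0 <= 2 * Kc + 6 by lra.
have key := mul_ln_le_of_margin K6 L0 Y1 u_gt0 X0 hm.
(* The constants 5 in [choice_eta_succ_lower] and 6 in [rate] leave a spare u in the exponent, which
   pays for the factors 400 and 20. *)
have uB : u <= u * (ln u + ln (ln u) + 2 * Kc + 6) - u * (ln u + ln (ln u) + 2 * Kc + 5).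
  by rewrite -[leLHS]mulr1 -mulrBr; rewrite opprD addrACA subrr add0r; lra.
set B5 := u * (_ + 5) in hs uB; set B6 := u * (_ + 6) in hr uB.
have {}key : B6 <= ln (ln z) by apply: le_trans key; rewrite /B6 !addrA.
have eta_ge : 400 / ln z <= choice_eta kappa (u + 1).
  apply: le_trans hs.
  have -> : 400 / ln z = expR (ln 400 - ln (ln z)).
    by rewrite expRB !lnK ?posrE ?ltr0n.
  rewrite ler_expR.
  have h4 : ln 400 <= u by apply: lnnum; [rewrite ltr0n|lra].
  lra.
have [J [/andP[Jl1 Jl2] Jd]] := small_length_regime kappa_gt0 Dc0 P_prime P_dense lm L_ge' L_le' u_gt0 z_gt0 eta_ge s1.
exists J; split => //.
apply: (weak _ _ _ Jl1 Jd); apply: le_trans hr _.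
apply: (@le_trans _ _ (expR (- B5) / 20)); last first.
  by apply: ler_wpM2r => //; rewrite invr_ge0 ler0n.
have h20 : ln 20 <= u by apply: lnnum; [rewrite ltr0n|lra].
have -> : (20 : R)^-1 = expR (- ln 20) by rewrite expRN lnK // posrE ltr0n.
rewrite -expRD ler_expR; lra.
Qed.

End Assembly.

Theorem corollary1p1 (R : realType) (kappa C u0 : R) :
  0 < kappa -> 0 < C -> 1 < u0 ->
  exists c : R, 0 < c /\
  exists eps : R -> R, eps z @[z --> +oo] --> (0 : R) /\
  forall (P : set nat) (z : R),
    P `<=` [set p | prime p] ->
    (forall y : R, Num.sqrt z < y <= z ->
       kappa * (primepi y)%:R <= (count_upto P y)%:R) ->
  forall u : R, u0 <= u -> u <= C * Num.sqrt z ->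
  exists Ip Im : interval R,
    [/\ z `^ u <= ilength Ip /\ z `^ u <= ilength Im,
        (sieve (int_points Ip) P z)%:R >=
          (1 + (c / (u * ln u)) `^ u) * ilength Ip * sieve_density P z,
        (sieve (int_points Im) P z)%:R <=
          (1 - (c / (u * ln u)) `^ u) * ilength Im * sieve_density P z
      & u <= (1 - eps z) * (ln (ln z) / ln (ln (ln z))) ->
        ilength Ip <= z `^ (u + 2) /\ ilength Im <= z `^ (u + 2)].
Proof.
move=> kappa0 C0 u01; exists (rate kappa C u0); split; first exact: rate_gt0.
exists (margin kappa C); split; first exact: margin_cvg.
move=> P z Pp Pd u uu uC.
have [Ip [p1 p2 p3]] := deviation_intervals kappa0 C0 u01 Pp Pd uu uC (or_introl erefl).
have [Im [m1 m2 m3]] := deviation_intervals kappa0 C0 u01 Pp Pd uu uC (or_intror erefl).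
exists Ip, Im; split => //.
- by move: p2; rewrite /deviates !mul1r.
- by move: m2; rewrite /deviates !mulN1r lerN2.
- by move=> h; split; [exact: p3|exact: m3].
Qed.
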